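(* Let $X$ be a compact metric space and let $f:X\to X$ be a homeomorphism with the exponential specification property. Let $A:X\to GL(m,\mathbb{R})$ be a H\''older continuous matrix function. Then either all ergodic $f$-invariant Borel probability measures have the same Lyapunov spectrum for $A$, or the Lyapunov-irregular set $LI(A,f)$ contains an uncountable DC1-scrambled set.
   Context: Cocycle: for $n>0$, $A(x,n):=A(f^{n-1}x)\cdots A(fx)A(x)$ and $A(x,-n):=A(f^{-n}x,n)^{-1}$. Exponential specification: for $x\in X$, $\delta>0$, $\lambda>0$, $n\ge 0$, let $B_n(x,\delta,\lambda)=\{y\in X: d(f^ix,f^iy)<\delta e^{-\lambda\min\{i,n-i\}} \text{ for all } 0\le i\le n\}$. The map $f$ has the exponential specification property (with some exponent $\lambda>0$ depending only on $f$) if for every $\delta>0$ there is a positive integer $N=N(\delta)$ such that for every $k\ge1$, all points $x_1,\dots,x_k\in X$ and all nonnegative integer sequences $\{N_i\}_{i=1}^k,\{M_i\}_{i=1}^k$ with $N_1=0$ and $N_j\ge N_{j-1}+M_{j-1}+N$ for $2\le j\le k$, the set $\bigcap_{i=1}^k f^{-N_i}B_{M_i}(x_i,\delta,\lambda)$ is nonempty. Lyapunov spectrum: for an ergodic $f$-invariant measure $\mu$, by the Oseledec multiplicative ergodic theorem there are numbers $\chi_1<\dots<\chi_r$, and for $\mu$-a.e. $x$ a cocycle-invariant splitting $\mathbb{R}^m=E_{\chi_1}(x)\oplus\cdots\oplus E_{\chi_r}(x)$ with $\dim E_{\chi_i}(x)=m_i$, such that $\lim_{n\to\pm\infty}\frac1n\log\|A(x,n)v\|=\chi_i$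 for all $0\ne v\in E_{\chi_i}(x)$. The Lyapunov spectrum of $\mu$ is $Sp(\mu,A)=\{(\chi_i,m_i):1\le i\le r\}$. Lyapunov-irregular set: a point $x\in X$ is (forward) Lyapunov-regular for $A$ if there exist numbers $\chi_1<\dots<\chi_r$ ($r\le m$) and a cocycle-invariant decomposition $\mathbb{R}^m=G_1(x)\oplus\cdots\oplus G_r(x)$ such that $\lim_{n\to+\infty}\frac1n\log\|A(x,n)v\|=\chi_i$ for each $i$ and each $0\neq v\in G_i(x)$; otherwise $x$ is Lyapunov-irregular. $LI(A,f)$ is the set of Lyapunov-irregular points. DC1: a pair $x,y\in X$ is DC1-scrambled if for every $t>0$, $\limsup_{n\to\infty}\frac1n|\{i\in[0,n-1]: d(f^ix,f^iy)<t\}|=1$, and there exists $t_0>0$ with $\liminf_{n\to\infty}\frac1n|\{i\in[0,n-1]: d(f^ix,f^iy)<t_0\}|=0$. A set $S\subseteq X$ is DC1-scrambled if every pair of distinct points of $S$ is DC1-scrambled. *)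

(* Defs.v *)
From HB Require Import structures.
From mathcomp Require Import all_boot all_order all_algebra.
From mathcomp Require Import all_classical all_reals all_analysis.
Set Implicit Arguments. Unset Strict Implicit. Unset Printing Implicit Defensive.
Import Order.TTheory GRing.Theory Num.Theory.
Import numFieldNormedType.Exports.
Local Open Scope classical_set_scope.
Local Open Scope ring_scope.

Section Defs.
Variable R : realType.
Variable X : Type.
Variable d : X -> X -> R.

Definition is_metric : Prop :=
  [/\ forall x y, 0 <= d x y,
      forall x y, d x y = 0 <-> x = y,
      forall x y, d x y = d y x &
      forall x y z, d x z <= d x y + d y z].

Definition d_open (U : set X) : Prop :=
  forall x, U x -> exists2 r : R, 0 < r & forall y, d x y < r -> U y.

Definition d_compact : Prop :=
  forall (I : Type) (U : I -> set X), (forall i, d_open (U i)) ->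
    (forall x, exists i, U i x) ->
    exists (n : nat) (g : 'I_n -> I), forall x, exists j, U (g j) x.

Definition d_continuous (g : X -> X) : Prop :=
  forall x (e : R), 0 < e -> exists2 delta : R, 0 < delta &
    forall y, d x y < delta -> d (g x) (g y) < e.

Definition homeomorphism (f finv : X -> X) : Prop :=
  [/\ cancel f finv, cancel finv f, d_continuous f & d_continuous finv].

Definition expBall (f : X -> X) (x : X) (delta lambda : R) (n : nat) : set X :=
  [set y | forall i : nat, (i <= n)%N ->
     d (iter i f x) (iter i f y) < delta * expR (- lambda * (minn i (n - i))%:R)].

(** exponential specification property (indices 0..k-1 instead of 1..k) *)
Definition exp_specification (f : X -> X) : Prop :=
  exists2 lambda : R, 0 < lambda &
  forall delta : R, 0 < delta -> exists2 N : nat, (0 < N)%N &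
  forall (k : nat) (xs : nat -> X) (Ns Ms : nat -> nat),
    (1 <= k)%N -> Ns 0%N = 0%N ->
    (forall j, (1 <= j < k)%N -> (Ns j.-1 + Ms j.-1 + N <= Ns j)%N) ->
    exists y : X, forall i, (i < k)%N ->
      expBall f (xs i) delta lambda (Ms i) (iter (Ns i) f y).

Variable m : nat.

(** max-entry norm on matrices / vectors (all norms are equivalent) *)
Definition mxnorm p q (M : 'M[R]_(p, q)) : R :=
  \big[Num.max/0]_(i < p) \big[Num.max/0]_(j < q) `|M i j|.

Definition holder_GL (A : X -> 'M[R]_m) : Prop :=
  (forall x, A x \in unitmx) /\
  exists C alpha : R, 0 < alpha /\
    forall x y, mxnorm (A x - A y) <= C * (d x y) `^ alpha.

Fixpoint cocycle (f : X -> X) (A : X -> 'M[R]_m) (x : X) (n : nat) : 'M[R]_m :=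
  match n with
  | 0%N => 1%:M
  | n'.+1 => A (iter n' f x) *m cocycle f A x n'
  end.

Definition cocycle_neg (f finv : X -> X) (A : X -> 'M[R]_m) (x : X) (n : nat)
  : 'M[R]_m := invmx (cocycle f A (iter n finv x) n).

(** Vectors of R^m are row vectors 'rV_m; M acts by v |-> M v, i.e. v *m M^T.
    Subspaces are row spaces (mxalgebra). *)
Definition act (M : 'M[R]_m) (v : 'rV[R]_m) : 'rV[R]_m := v *m M^T.

Definition fwd_exponent (f : X -> X) (A : X -> 'M[R]_m) x (v : 'rV[R]_m)
    (chi : R) : Prop :=
  (fun n : nat => n%:R^-1 * ln (mxnorm (act (cocycle f A x n) v))) @ \oo --> chi.

Definition bwd_exponent (f finv : X -> X) (A : X -> 'M[R]_m) x (v : 'rV[R]_m)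
    (chi : R) : Prop :=
  (fun n : nat => - n%:R^-1 * ln (mxnorm (act (cocycle_neg f finv A x n) v)))
    @ \oo --> chi.

Definition splitting r (E : 'I_r -> 'M[R]_m) : Prop :=
  mxdirect (\sum_(i < r) E i)%MS /\ (\sum_(i < r) E i == 1%:M)%MS.

End Defs.

Section Measures.
Variables (R : realType) (dsp : measure_display) (X : measurableType dsp).

Definition invariant (f : X -> X) (mu : probability X R) : Prop :=
  forall B : set X, measurable B -> mu (f @^-1` B) = mu B.

Definition ergodic (f : X -> X) (mu : probability X R) : Prop :=
  invariant f mu /\
  forall B : set X, measurable B -> f @^-1` B = B ->
    mu B = 0%E \/ mu B = 1%E.

Variable m : nat.

(** [s] is the Lyapunov spectrum Sp(mu, A) = [:: (chi_1,m_1); ...; (chi_r,m_r)]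
    as given by the Oseledec theorem: chi_1 < ... < chi_r, and for mu-a.e. x a
    cocycle-invariant splitting R^m = E_1(x) (+) ... (+) E_r(x) with
    dim E_i(x) = m_i >= 1 and two-sided exponent chi_i on E_i(x) \ {0}. *)
Definition sdflt : R * nat := (0%R, 0%N).

Definition lyapunov_spectrum (f finv : X -> X) (A : X -> 'M[R]_m)
    (mu : probability X R) (s : seq (R * nat)) : Prop :=
  let r := size s in
  sorted <%R (map fst s) /\
  exists E : X -> 'I_r -> 'M[R]_m,
    {ae mu, forall x,
      [/\ splitting (E x),
          forall i : 'I_r, (E (f x) i == E x i *m (A x)^T)%MS,
          forall i : 'I_r, \rank (E x i) = (nth sdflt s i).2 /\
                           (0 < (nth sdflt s i).2)%N &
          forall (i : 'I_r) (v : 'rV[R]_m), v != 0 -> (v <= E x i)%MS ->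
            fwd_exponent f A x v (nth sdflt s i).1 /\
            bwd_exponent f finv A x v (nth sdflt s i).1]}.
End Measures.

Section Irregular.
Variables (R : realType) (X : Type) (m : nat).

(** forward Lyapunov-regular point: numbers chi_1 < ... < chi_r (r <= m) and a
    cocycle-invariant decomposition G_i(f^n x) = A(x,n) G_i(x) of R^m along
    the forward orbit, with exponent chi_i on G_i(x) \ {0}. *)
Definition lyapunov_regular (f : X -> X) (A : X -> 'M[R]_m) (x : X) : Prop :=
  exists (r : nat) (chi : 'I_r -> R) (G : nat -> 'I_r -> 'M[R]_m),
    [/\ (r <= m)%N,
        forall i j : 'I_r, (i < j)%N -> chi i < chi j,
        forall n, splitting (G n),
        forall n (i : 'I_r), (G n.+1 i == G n i *m (A (iter n f x))^T)%MS &
        forall (i : 'I_r) (v : 'rV[R]_m), v != 0 -> (v <= G 0%N i)%MS ->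
          fwd_exponent f A x v (chi i)].

Definition LI (f : X -> X) (A : X -> 'M[R]_m) : set X :=
  [set x | ~ lyapunov_regular f A x].

Variable d : X -> X -> R.

Definition close_freq (f : X -> X) (x y : X) (t : R) (n : nat) : R :=
  (count (fun i => d (iter i f x) (iter i f y) < t) (iota 0 n))%:R / n%:R.

Definition DC1_pair (f : X -> X) (x y : X) : Prop :=
  (forall t : R, 0 < t -> limn_sup (close_freq f x y t) = 1) /\
  exists2 t0 : R, 0 < t0 & limn_inf (close_freq f x y t0) = 0.

Definition DC1_scrambled (f : X -> X) (S : set X) : Prop :=
  forall x y, S x -> S y -> x <> y -> DC1_pair f x y.
End Irregular.

(* Main.v *)
(** Let [qm t M] be a norm of the [t]-th compound matrix of [M] (all [t]-minors),
    and [b_t] the maximal exponential growth rate of [qm t] along the cocycle.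
    If for every [t] this rate is attained uniformly at all points, the forward
    exponents at every point, with multiplicities, are the increments
    [b_t - b_(t-1)], so all spectra agree.

    Otherwise let [t] be the least level that is not uniform.  Exponential
    shadowing perturbs an orbit segment of length [n] by a factor
    [expR (- g * n)] below the maximal rate, hence preserves both segments of
    maximal growth and segments of definitely slower growth.  Glue long slow
    blocks (following a fixed slow orbit or its image under [f]) and comparably
    long blocks of maximal growth.  Levels below [t] being uniform, the slow
    blocks create a gap between the [t]-th and the preceding singular values
    which never closes, so there is a subspace of codimension [t - 1] whose
    growth along the orbit of the glued point is that of the [t]-th singular
    value, and this oscillates: the glued point is irregular.  The two choices
    for the slow blocks give uncountably many glued points, any two of which are
    alternately close and separated during almost all of an orbit segment. *)
Require Import Defs.
From HB Require Import structures.
From mathcomp Require Import all_boot all_order all_algebra.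
From mathcomp Require Import all_classical all_reals all_analysis.
From mathcomp Require Import fingroup perm ring lra zify.
Set Implicit Arguments. Unset Strict Implicit. Unset Printing Implicit Defensive.
Import Order.TTheory GRing.Theory Num.Theory.
Import numFieldNormedType.Exports.
Local Open Scope classical_set_scope.
Local Open Scope ring_scope.

(** * Entry-sum norm and compound matrices *)

Section EntrySumNorm.
Variable R : realFieldType.

Definition nrm a b (M : 'M[R]_(a, b)) : R := \sum_i \sum_j `|M i j|.

Lemma nrm_ge0 a b (M : 'M[R]_(a, b)) : 0 <= nrm M.
Proof. by apply: sumr_ge0 => i _; apply: sumr_ge0. Qed.

Lemma nrm0 a b : nrm (0 : 'M[R]_(a, b)) = 0.
Proof. by apply: big1 => i _; apply: big1 => j _; rewrite mxE normr0. Qed.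

Lemma ler_nrmD a b (M N : 'M[R]_(a, b)) : nrm (M + N) <= nrm M + nrm N.
Proof.
rewrite /nrm -big_split; apply: ler_sum => i _ /=.
by rewrite -big_split; apply: ler_sum => j _ /=; rewrite mxE ler_normD.
Qed.

Lemma nrmN a b (M : 'M[R]_(a, b)) : nrm (- M) = nrm M.
Proof. by apply: eq_bigr => i _; apply: eq_bigr => j _; rewrite mxE normrN. Qed.

Lemma nrmZ a b c (M : 'M[R]_(a, b)) : nrm (c *: M) = `|c| * nrm M.
Proof.
rewrite /nrm mulr_sumr; apply: eq_bigr => i _; rewrite mulr_sumr.
by apply: eq_bigr => j _; rewrite mxE normrM.
Qed.

Lemma nrm_tr a b (M : 'M[R]_(a, b)) : nrm M^T = nrm M.
Proof.
rewrite /nrm exchange_big; apply: eq_bigr => i _.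
by apply: eq_bigr => j _; rewrite mxE.
Qed.

Lemma nrm_entry a b (M : 'M[R]_(a, b)) i j : `|M i j| <= nrm M.
Proof.
rewrite /nrm (bigD1 i) //= (bigD1 j) //= -addrA lerDl addr_ge0 //.
  by apply: sumr_ge0.
by apply: sumr_ge0 => k _; apply: sumr_ge0.
Qed.

Lemma nrm_le a b (M : 'M[R]_(a, b)) c :
  (forall i j, `|M i j| <= c) -> nrm M <= (a * b)%:R * c.
Proof.
move=> h; apply: (@le_trans _ _ (\sum_(i < a) \sum_(j < b) c)).
  by apply: ler_sum => i _; apply: ler_sum => j _.
by rewrite sumr_const sumr_const !card_ord -mulrnA mulnC mulr_natl.
Qed.

Lemma nrm_eq0 a b (M : 'M[R]_(a, b)) : (nrm M == 0) = (M == 0).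
Proof.
apply/eqP/eqP => [h|->]; last exact: nrm0.
by apply/matrixP => i j; apply/eqP; rewrite mxE -normr_le0 -h nrm_entry.
Qed.

Lemma nrm_gt0 a b (M : 'M[R]_(a, b)) : (0 < nrm M) = (M != 0).
Proof. by rewrite lt_def nrm_eq0 nrm_ge0 andbT. Qed.

Lemma nrmM a b c (M : 'M[R]_(a, b)) (N : 'M[R]_(b, c)) :
  nrm (M *m N) <= nrm M * nrm N.
Proof.
rewrite [X in X * _]/nrm mulr_suml; apply: ler_sum => i _.
apply: (@le_trans _ _ (\sum_j \sum_k `|M i k| * `|N k j|)).
  apply: ler_sum => j _; rewrite mxE; apply: le_trans (ler_norm_sum _ _ _) _.
  by apply: ler_sum => k _; rewrite normrM.
rewrite exchange_big mulr_suml; apply: ler_sum => k _ /=.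
rewrite -mulr_sumr ler_wpM2l // /nrm (bigD1 k) //= lerDl.
by apply: sumr_ge0 => l _; apply: sumr_ge0.
Qed.

Lemma nrm_mxsub a b a' b' (f : 'I_a' -> 'I_a) (g : 'I_b' -> 'I_b)
    (M : 'M[R]_(a, b)) : nrm (mxsub f g M) <= (a' * b')%:R * nrm M.
Proof. by apply: nrm_le => i j; rewrite mxE nrm_entry. Qed.

End EntrySumNorm.

Section CauchyBinet.
Variable R : comNzRingType.

Lemma det_mulmx_rect t m (X : 'M[R]_(t, m)) (Y : 'M[R]_(m, t)) :
  \det (X *m Y) =
  \sum_(h : {ffun 'I_t -> 'I_m}) (\prod_i X i (h i)) * \det (rowsub h Y).
Proof.
pose XY (s : 'S_t) i j := X i j * Y j (s i).
transitivity (\sum_(h : {ffun 'I_t -> 'I_m}) \sum_(s : 'S_t)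
    (-1) ^+ s * \prod_i XY s i (h i)).
  rewrite exchange_big; apply: eq_bigr => /= s _; rewrite -big_distrr /=.
  congr (_ * _); rewrite -(bigA_distr_bigA (XY s)) /=.
  by apply: eq_bigr => x _; rewrite mxE.
apply: eq_bigr => h _; rewrite /determinant mulr_sumr; apply: eq_bigr => s _.
rewrite mulrCA big_split //=; congr (_ * (_ * _)).
by apply: eq_bigr => i _; rewrite mxE.
Qed.

Lemma det_rowsub_perm t m (s : 'S_t) (h : 'I_t -> 'I_m) (Y : 'M[R]_(m, t)) :
  \det (rowsub (h \o s) Y) = (-1) ^+ s * \det (rowsub h Y).
Proof. by rewrite rowsub_comp -row_permEsub row_permE det_mulmx det_perm. Qed.

Lemma cauchy_binet t m (X : 'M[R]_(t, m)) (Y : 'M[R]_(m, t)) :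
  t`!%:R * \det (X *m Y) =
  \sum_(h : {ffun 'I_t -> 'I_m}) \det (colsub h X) * \det (rowsub h Y).
Proof.
under [RHS]eq_bigr => h _ do rewrite [\det (colsub _ _)]/determinant mulr_suml.
rewrite exchange_big /=.
rewrite (eq_bigr (fun=> \det (X *m Y))).
  rewrite sumr_const -[RHS]mulr_natl; congr (_ * _); rewrite -card_Sn.
  by congr _%:R; apply: eq_card => x; rewrite !inE.
move=> s _; rewrite det_mulmx_rect.
pose F (h : {ffun 'I_t -> 'I_m}) := [ffun i => h (s i)].
have Finj : injective F.
  move=> h1 h2 /ffunP E; apply/ffunP => i.
  by have := E (s^-1%g i); rewrite !ffunE permKV.
rewrite [RHS](reindex_inj Finj); apply: eq_bigr => h _ /=.
have -> : rowsub (F h) Y = rowsub (h \o s) Y.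
  by apply: eq_rowsub => i; rewrite /F ffunE.
rewrite det_rowsub_perm mulrCA mulrA; congr (_ * _ * _).
by apply: eq_bigr => i _; rewrite /F ffunE mxE.
Qed.

End CauchyBinet.

Section CompoundMatrix.
Variable R : realFieldType.

Definition fnth t a (i : 'I_#|{ffun 'I_t -> 'I_a}|) : {ffun 'I_t -> 'I_a} :=
  enum_val i.

(* Rows and columns range over all maps ['I_t -> 'I_a], not only increasing
   ones; the factor [1 / t!] makes this compound multiplicative. *)
Definition compound t a b (M : 'M[R]_(a, b)) :
    'M[R]_(#|{ffun 'I_t -> 'I_a}|, #|{ffun 'I_t -> 'I_b}|) :=
  \matrix_(i, j) (t`!%:R^-1 * \det (mxsub (fnth i) (fnth j) M)).

Let fact_neq0 t : t`!%:R != 0 :> R.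
Proof. by rewrite pnatr_eq0 -lt0n fact_gt0. Qed.

Lemma compoundM t a b c (M : 'M[R]_(a, b)) (N : 'M[R]_(b, c)) :
  compound t (M *m N) = compound t M *m compound t N.
Proof.
apply/matrixP => i j; rewrite !mxE mxsub_mul.
apply: (mulfI (fact_neq0 t)); rewrite mulrCA cauchy_binet !mulr_sumr.
rewrite (reindex_onto (@fnth t b) enum_rank) /=; last first.
  by move=> h _; rewrite /fnth enum_rankK.
rewrite (eq_bigl predT); last by move=> k; rewrite /fnth /= enum_valK eqxx.
apply: eq_bigr => k _; rewrite !mxE.
have -> : colsub (fnth k) (rowsub (fnth i) M) = mxsub (fnth i) (fnth k) M.
  by apply/matrixP => x y; rewrite !mxE.
have -> : rowsub (fnth k) (colsub (fnth j) N) = mxsub (fnth k) (fnth j) N.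
  by apply/matrixP => x y; rewrite !mxE.
by have := fact_neq0 t; move=> h; field.
Qed.

Definition qm t a b (M : 'M[R]_(a, b)) : R := nrm (compound t M).

Lemma qm_ge0 t a b (M : 'M[R]_(a, b)) : 0 <= qm t M.
Proof. exact: nrm_ge0. Qed.

Lemma qmM t a b c (M : 'M[R]_(a, b)) (N : 'M[R]_(b, c)) :
  qm t (M *m N) <= qm t M * qm t N.
Proof. by rewrite /qm compoundM nrmM. Qed.

Lemma qm_tr t a b (M : 'M[R]_(a, b)) : qm t M^T = qm t M.
Proof.
rewrite /qm -nrm_tr; congr nrm; apply/matrixP => i j.
by rewrite !mxE -trmx_mxsub det_tr.
Qed.

Lemma minor_le_qm t a b (M : 'M[R]_(a, b)) (f : 'I_t -> 'I_a) (g : 'I_t -> 'I_b) :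
  `|\det (mxsub f g M)| <= t`!%:R * qm t M.
Proof.
rewrite -mxsub_ffun.
have := nrm_entry (compound t M) (enum_rank (finfun f)) (enum_rank (finfun g)).
rewrite mxE /fnth !enum_rankK normrM normrV ?unitfE // normr_nat.
by rewrite ler_pdivrMl // ltr0n fact_gt0.
Qed.

Definition qcst t a b : R := (#|{ffun 'I_t -> 'I_a}| * #|{ffun 'I_t -> 'I_b}|)%:R.

Lemma qm_le t a b (M : 'M[R]_(a, b)) c :
  (forall (f : {ffun 'I_t -> 'I_a}) (g : {ffun 'I_t -> 'I_b}),
    `|\det (mxsub f g M)| <= c) ->
  qm t M <= qcst t a b * c.
Proof.
move=> h; apply: nrm_le => i j; rewrite mxE normrM normrV ?unitfE // normr_nat.
have c0 := le_trans (normr_ge0 _) (h (fnth i) (fnth j)).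
rewrite ler_pdivrMl ?ltr0n ?fact_gt0 //; apply: le_trans (h _ _) _.
by rewrite ler_peMl // ler1n fact_gt0.
Qed.

Lemma exists_minor_ge_qm t a b (M : 'M[R]_(a, b)) : 0 < qm t M ->
  exists (f : {ffun 'I_t -> 'I_a}) (g : {ffun 'I_t -> 'I_b}),
    \det (mxsub f g M) != 0 /\ qm t M <= qcst t a b * `|\det (mxsub f g M)|.
Proof.
move=> q0.
pose D (p : {ffun 'I_t -> 'I_a} * {ffun 'I_t -> 'I_b}) := `|\det (mxsub p.1 p.2 M)|.
have [/existsP[p0 p0P]|/existsPn h] := boolP [exists p, D p != 0]; last first.
  suff : qm t M <= qcst t a b * 0 by rewrite mulr0 leNgt q0.
  apply: qm_le => f g.
  by have := h (f, g); rewrite negbK => /eqP; rewrite /D /= => ->.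
pose p := [arg max_(i > p0) D i]%O.
have pP i : D i <= D p by rewrite /p; case: arg_maxP => // j _; apply.
exists p.1, p.2; split; last first.
  by apply: qm_le => f g; exact: (pP (f, g)).
rewrite -normr_gt0; apply: lt_le_trans (pP p0).
by rewrite lt_def p0P /= normr_ge0.
Qed.

Lemma qm0 a b (M : 'M[R]_(a, b)) : qm 0 M = 1.
Proof.
rewrite /qm /nrm (eq_bigr (fun=> 1)); last first.
  move=> i _; rewrite (eq_bigr (fun=> 1)).
    by rewrite sumr_const card_ord card_ffun !card_ord expn0.
  by move=> j _; rewrite mxE det_mx00 fact0 invr1 mul1r normr1.
by rewrite sumr_const card_ord card_ffun !card_ord expn0.
Qed.

Lemma qm1_gt0 t m : (t <= m)%N -> 0 < qm t (1%:M : 'M[R]_m).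
Proof.
move=> tm; pose f := widen_ord tm.
have := minor_le_qm 1%:M f f.
have -> : mxsub f f 1%:M = 1%:M :> 'M[R]_t.
  by apply/matrixP => i j; rewrite !mxE; congr (_%:R); congr nat_of_bool.
rewrite det1 normr1 => h.
have : 0 < t`!%:R * qm t (1%:M : 'M[R]_m) by apply: lt_le_trans h.
by rewrite pmulr_rgt0 // ltr0n fact_gt0.
Qed.

Lemma qm_gt0 t m (M : 'M[R]_m) : M \in unitmx -> (t <= m)%N -> 0 < qm t M.
Proof.
move=> Mu tm; have := qmM t (invmx M) M; rewrite mulVmx // => h.
have h2 := lt_le_trans (qm1_gt0 tm) h.
by rewrite lt_def qm_ge0 andbT; apply: contraTneq h2 => ->; rewrite mulr0 ltxx.
Qed.

Lemma det_le t (M : 'M[R]_t) (K : R) : 1 <= K -> (forall i j, `|M i j| <= K) ->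
  `|\det M| <= t`!%:R * K ^+ t.
Proof.
move=> K1 h; rewrite /determinant; apply: le_trans (ler_norm_sum _ _ _) _.
apply: (@le_trans _ _ (\sum_(s : 'S_t) K ^+ t)).
  apply: ler_sum => s _; rewrite normrM normrX normrN1 expr1n mul1r normr_prod.
  rewrite -[X in K ^+ X]card_ord -prodr_const; apply: ler_prod => i _.
  by rewrite normr_ge0 h.
rewrite sumr_const -[leLHS]mulr_natl ler_wpM2r ?exprn_ge0 ?(le_trans ler01) //.
by rewrite ler_nat -card_Sn; apply/eq_leq/eq_card => x; rewrite !inE.
Qed.

Lemma prod_lipschitz t (u v : 'I_t -> R) (K e : R) : 1 <= K -> 0 <= e ->
  (forall i, `|u i| <= K) -> (forall i, `|v i| <= K) ->
  (forall i, `|u i - v i| <= e) ->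
  `|\prod_i u i - \prod_i v i| <= t%:R * K ^+ t * e.
Proof.
move=> K1 e0; elim: t u v => [|t IH] u v hu hv huv.
  by rewrite !big_ord0 subrr normr0 mul0r mul0r.
rewrite !big_ord_recl.
set U := \prod_(i < t) _; set V := \prod_(i < t) v _.
have -> : u ord0 * U - v ord0 * V = (u ord0 - v ord0) * U + v ord0 * (U - V).
  by ring.
have K0 : 0 <= K by apply: le_trans K1.
have Ub : `|U| <= K ^+ t.
  rewrite normr_prod -[X in K ^+ X]card_ord -prodr_const; apply: ler_prod => i _.
  by rewrite normr_ge0 hu.
have hUV : `|U - V| <= t%:R * K ^+ t * e by apply: IH => i.
apply: le_trans (ler_normD _ _) _; rewrite !normrM.
have h1 : `|u ord0 - v ord0| * `|U| <= e * K ^+ t by apply: ler_pM.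
have h2 : `|v ord0| * `|U - V| <= K * (t%:R * K ^+ t * e) by apply: ler_pM.
apply: le_trans (lerD h1 h2) _; rewrite -natr1 exprS.
have : K ^+ t * e <= K * (K ^+ t * e) by rewrite ler_peMl // mulr_ge0 ?exprn_ge0.
by lra.
Qed.

Lemma det_lipschitz t (M N : 'M[R]_t) (K e : R) : 1 <= K -> 0 <= e ->
  (forall i j, `|M i j| <= K) -> (forall i j, `|N i j| <= K) ->
  (forall i j, `|M i j - N i j| <= e) ->
  `|\det M - \det N| <= t`!%:R * (t%:R * K ^+ t) * e.
Proof.
move=> K1 e0 hM hN hMN; rewrite /determinant -sumrB.
apply: le_trans (ler_norm_sum _ _ _) _.
apply: (@le_trans _ _ (\sum_(s : 'S_t) (t%:R * K ^+ t * e))).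
  apply: ler_sum => s _.
  rewrite -mulrBr normrM normrX normrN1 expr1n mul1r.
  by apply: prod_lipschitz.
rewrite sumr_const -[leLHS]mulr_natl -!mulrA ler_wpM2r //.
  by have K0 := le_trans ler01 K1; rewrite !mulr_ge0 ?exprn_ge0.
by rewrite ler_nat -card_Sn; apply/eq_leq/eq_card => x; rewrite !inE.
Qed.

Lemma qm_bounded t a b (K : R) : exists C, forall M : 'M[R]_(a, b),
  nrm M <= K -> qm t M <= C.
Proof.
exists (qcst t a b * (t`!%:R * (Num.max 1 K) ^+ t)) => M h.
apply: qm_le => f g; apply: det_le => [|i j]; first by rewrite le_max lexx.
by rewrite mxE le_max (le_trans (nrm_entry _ _ _) h) orbT.
Qed.

Lemma compound_lipschitz t a b (K : R) : exists2 C, 0 <= C &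
  forall M N : 'M[R]_(a, b), nrm M <= K -> nrm N <= K ->
    nrm (compound t M - compound t N) <= C * nrm (M - N).
Proof.
pose K' := Num.max 1 K.
have K1 : 1 <= K' by rewrite le_max lexx.
have K0 : 0 <= K' by apply: le_trans K1.
exists (qcst t a b * (t`!%:R * (t%:R * K' ^+ t))) => [|M N hM hN].
  by rewrite !mulr_ge0 ?exprn_ge0.
rewrite -mulrA; apply: nrm_le => i j; rewrite !mxE -mulrBr normrM.
rewrite normrV ?unitfE // normr_nat.
have := @det_lipschitz t (mxsub (fnth i) (fnth j) M) (mxsub (fnth i) (fnth j) N)
  K' (nrm (M - N)) K1 (nrm_ge0 _) => h.
rewrite ler_pdivrMl ?ltr0n ?fact_gt0 //.
have {}h := h _ _ _.
apply: le_trans (h _ _ _) _ => [k l|k l|k l|].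
- by rewrite mxE le_max (le_trans (nrm_entry _ _ _) hM) orbT.
- by rewrite mxE le_max (le_trans (nrm_entry _ _ _) hN) orbT.
- by have := nrm_entry (M - N) (fnth i k) (fnth j l); rewrite !mxE.
rewrite ler_peMl ?ler1n ?fact_gt0 //.
by rewrite !mulr_ge0 ?exprn_ge0 ?nrm_ge0.
Qed.

End CompoundMatrix.

(** * Pivots, Schur complements and log-concavity of minor norms *)

Section Pivots.
Variable R : realFieldType.

Lemma cofactor_le_qm q a b (M : 'M[R]_(a, b)) (f : 'I_q.+1 -> 'I_a)
    (g : 'I_q.+1 -> 'I_b) i j :
  `|cofactor (mxsub f g M) i j| <= q`!%:R * qm q M.
Proof.
rewrite /cofactor normrM normrX normrN1 expr1n mul1r.
have -> : row' i (col' j (mxsub f g M)) = mxsub (f \o lift i) (g \o lift j) M.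
  by apply/matrixP => x y; rewrite !mxE.
exact: minor_le_qm.
Qed.

Lemma qm_small_rows q a b (W : 'M[R]_(a, b)) (J : pred 'I_a) (e : R) :
  (#|[predC J]| <= q)%N -> 0 <= e ->
  (forall i, J i -> forall j, `|W i j| <= e) ->
  qm q.+1 W <= qcst R q.+1 a b * (q.+1%:R * (e * (q`!%:R * qm q W))).
Proof.
move=> cJ e0 hW; apply: qm_le => f g.
have rhs0 : 0 <= q.+1%:R * (e * (q`!%:R * qm q W)) by rewrite !mulr_ge0 ?qm_ge0.
have [/injectiveP fi|/injectivePn[i1 [i2 d12 e12]]] := boolP (injectiveb f); last first.
  by rewrite (determinant_alternate d12) ?normr0 // => j; rewrite !mxE e12.
have [k Jk] : exists k, J (f k).
  apply/existsP; apply: contraT; rewrite negb_exists => /forallP h.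
  suff : (q.+1 <= q)%N by rewrite ltnn.
  apply: leq_trans cJ; rewrite -[X in (X <= _)%N]card_ord -(card_codom fi).
  by apply/subset_leq_card/fintype.subsetP => x /codomP[i ->]; rewrite !inE h.
rewrite (expand_det_row _ k); apply: le_trans (ler_norm_sum _ _ _) _.
apply: (@le_trans _ _ (\sum_(j < q.+1) e * (q`!%:R * qm q W))).
  apply: ler_sum => j _; rewrite normrM mxE; apply: ler_pM => //.
    exact: hW.
  exact: cofactor_le_qm.
by rewrite sumr_const card_ord -[leLHS]mulr_natl.
Qed.

Definition subst_col t b (D : 'M[R]_t) (i : 'I_t) (Y : 'M[R]_(t, b)) (j : 'I_b) :=
  \matrix_(k, l) (if l == i then Y k j else D k l).

Lemma cramer_col t b (D : 'M[R]_t) (Y : 'M[R]_(t, b)) i j : D \in unitmx ->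
  (invmx D *m Y) i j = (\det D)^-1 * \det (subst_col D i Y j).
Proof.
move=> Du; rewrite /invmx Du -scalemxAl mxE; congr (_ * _).
rewrite (expand_det_col _ i) mxE; apply: eq_bigr => k _.
rewrite !mxE eqxx mulrC; congr (_ * _); rewrite /cofactor.
congr (_ * \det _); apply/matrixP => x y; rewrite !mxE.
by rewrite eq_sym (negbTE (neq_lift _ _)).
Qed.

Definition pivot q a b (M : 'M[R]_(a, b)) (g : 'I_q -> 'I_a) (f : 'I_q -> 'I_b) :=
  \det (mxsub g f M) != 0 /\ qm q M <= qcst R q a b * `|\det (mxsub g f M)|.

Lemma exists_pivot q a b (M : 'M[R]_(a, b)) : 0 < qm q M -> 
  exists g f, @pivot q a b M g f.
Proof. by move=> /exists_minor_ge_qm [g [f h]]; exists g, f. Qed.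

Lemma pivot_unit q a b (M : 'M[R]_(a, b)) g f : @pivot q a b M g f ->
  mxsub g f M \in unitmx.
Proof. by case=> h _; rewrite unitmxE unitfE. Qed.

Lemma pivot_inv_le q a b (M : 'M[R]_(a, b)) g f x y : @pivot q a b M g f ->
  0 < qm q M -> 0 <= y -> x <= y ->
  `|\det (mxsub g f M)|^-1 * x <= qcst R q a b * y / qm q M.
Proof.
move=> [d0 h] q0 y0 xy; rewrite -normr_gt0 in d0.
rewrite ler_pdivlMr // -mulrA ler_pdivrMl //.
have -> : `|\det (mxsub g f M)| * (qcst R q a b * y) =
   (qcst R q a b * `|\det (mxsub g f M)|) * y by ring.
rewrite mulrC; apply: le_trans (_ : qm q M * y <= _); first by rewrite ler_wpM2l // qm_ge0.
by rewrite ler_wpM2r.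
Qed.

Lemma pivot_rows_le q a b (M : 'M[R]_(a, b)) g f i j : @pivot q a b M g f ->
  0 < qm q M ->
  `|(invmx (mxsub g f M) *m rowsub g M) i j| <= qcst R q a b * q`!%:R.
Proof.
move=> pv q0; rewrite cramer_col ?(pivot_unit pv) // normrM normrV; last first.
  by rewrite unitfE; case: pv.
have -> : qcst R q a b * q`!%:R = qcst R q a b * (q`!%:R * qm q M) / qm q M.
  by rewrite mulrA mulfK // gt_eqF.
apply: pivot_inv_le => //; first by rewrite mulr_ge0 // qm_ge0.
have -> : subst_col (mxsub g f M) i (rowsub g M) j =
    mxsub g (fun l => if l == i then j else f l) M.
  by apply/matrixP => k l; rewrite !mxE; case: (l == i).
exact: minor_le_qm.
Qed.

Lemma pivot_cols_le q a b (M : 'M[R]_(a, b)) g f i j : @pivot q a b M g f ->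
  0 < qm q M ->
  `|(colsub f M *m invmx (mxsub g f M)) i j| <= qcst R q a b * q`!%:R.
Proof.
move=> [d0 h] q0.
have pv : pivot M^T f g.
  by rewrite /pivot -trmx_mxsub det_tr qm_tr /qcst mulnC.
have := pivot_rows_le j i pv; rewrite qm_tr -!trmx_mxsub -trmx_inv -trmx_mul mxE.
by rewrite /qcst [in X in _ -> X]mulnC; apply.
Qed.

(* By Cramer's rule an entry is a quotient of minors; its numerator factors
   through [M], and expanding the remaining factor along the column that was
   replaced leaves minors of [B] of order one less. *)
Lemma pivot_mul_le q a b c (M : 'M[R]_(a, b)) (B : 'M[R]_(b, c))
    (g : 'I_q.+1 -> 'I_a) (f : 'I_q.+1 -> 'I_c) i j :
  pivot (M *m B) g f -> 0 < qm q.+1 (M *m B) ->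
  `|(invmx (mxsub g f (M *m B)) *m rowsub g M) i j| <=
  qcst R q.+1 a c * (#|{ffun 'I_q.+1 -> 'I_b}|%:R *
    (qm q.+1 M * (q.+1%:R * (q`!%:R * qm q B)))) / qm q.+1 (M *m B).
Proof.
move=> pv q0; rewrite cramer_col ?(pivot_unit pv) // normrM normrV; last first.
  by rewrite unitfE; case: pv.
apply: pivot_inv_le => //; first by rewrite !mulr_ge0 // qm_ge0.
pose B' : 'M[R]_(b, q.+1) := \matrix_(k, l) (if l == i then (k == j)%:R else B k (f l)).
have -> : subst_col (mxsub g f (M *m B)) i (rowsub g M) j = rowsub g M *m B'.
  apply/matrixP => k l; rewrite !mxE; have [li|li] := eqVneq l i.
    rewrite (bigD1 j) //= !mxE li !eqxx mulr1 big1 ?addr0 // => x xj.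
    by rewrite !mxE eqxx (negbTE xj) mulr0.
  by apply: eq_bigr => x _; rewrite !mxE (negbTE li).
have F0 : 0 < q.+1`!%:R :> R by rewrite ltr0n fact_gt0.
rewrite -(ler_pM2l F0) -[X in X * `|_|](ger0_norm (ltW F0)) -normrM cauchy_binet.
apply: le_trans (ler_norm_sum _ _ _) _.
apply: (@le_trans _ _ (\sum_(h : {ffun 'I_q.+1 -> 'I_b})
   (q.+1`!%:R * qm q.+1 M) * (q.+1%:R * (q`!%:R * qm q B)))); last first.
  rewrite sumr_const -[leLHS]mulr_natl le_eqVlt; apply/orP; left; apply/eqP.
  by ring.
apply: ler_sum => h _; rewrite normrM; apply: ler_pM => //.
  have -> : colsub h (rowsub g M) = mxsub g h M by apply/matrixP => x y; rewrite !mxE.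
  exact: minor_le_qm.
rewrite (expand_det_col _ i); apply: le_trans (ler_norm_sum _ _ _) _.
apply: (@le_trans _ _ (\sum_(k < q.+1) (q`!%:R * qm q B))); last first.
  by rewrite sumr_const card_ord -[leLHS]mulr_natl.
apply: ler_sum => k _; rewrite normrM !mxE eqxx.
rewrite -[leRHS]mul1r; apply: ler_pM => //.
  by case: (h k == j); rewrite ?normr1 ?normr0.
have -> : cofactor (rowsub h B') k i = cofactor (mxsub h f B) k i.
  rewrite /cofactor; congr (_ * \det _); apply/matrixP => x y; rewrite !mxE.
  by rewrite eq_sym (negbTE (neq_lift _ _)).
exact: cofactor_le_qm.
Qed.

Lemma schur_entry q a b (M : 'M[R]_(a, b)) g f i j : @pivot q a b M g f ->
  0 < qm q M ->
  `|(M - colsub f M *m invmx (mxsub g f M) *m rowsub g M) i j| <=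
  qcst R q a b * (q.+1`!%:R * qm q.+1 M) / qm q M.
Proof.
move=> pv q0; set D := mxsub g f M; set S := M - _.
have Du : D \in unitmx := pivot_unit pv.
pose gi (k : 'I_(q + 1)) := match fintype.split k with inl x => g x | inr _ => i end.
pose fj (k : 'I_(q + 1)) := match fintype.split k with inl x => f x | inr _ => j end.
have E : mxsub gi fj M = block_mx D (rowsub g (col j M)) (row i (colsub f M)) (M i j)%:M.
  apply/matrixP => x y; rewrite !mxE /gi /fj.
  case: (fintype.split x) => x'; rewrite mxE; case: (fintype.split y) => y'; rewrite /D !mxE //.
  by rewrite (ord1 x') (ord1 y') eqxx mulr1n.
have S11 : (M i j)%:M - row i (colsub f M) *m invmx D *m rowsub g (col j M) = (S i j)%:M :> 'M[R]_1.
  apply/matrixP => x y; rewrite !ord1 /S !mxE eqxx; congr (_ - _).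
  apply: eq_bigr => k _; rewrite !mxE; congr (_ * _).
  by apply: eq_bigr => l _; rewrite !mxE.
have detE : \det (mxsub gi fj M) = \det D * S i j.
  have -> : mxsub gi fj M = block_mx D 0 (row i (colsub f M)) 1%:M *m
      block_mx 1%:M (invmx D *m rowsub g (col j M)) 0 (S i j)%:M.
    rewrite mulmx_block !mulmx0 !mul0mx !mulmx1 !mul1mx !addr0 mulKVmx // E.
    by rewrite -S11 mulmxA addrC subrK.
  by rewrite det_mulmx det_lblock det_ublock !det1 mulr1 mul1r det_scalar1.
have -> : S i j = (\det D)^-1 * \det (mxsub gi fj M).
  by rewrite detE mulKf //; case: pv.
rewrite normrM normrV; last by rewrite unitfE; case: pv.
apply: pivot_inv_le => //; first by rewrite mulr_ge0 // qm_ge0.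
suff : `|\det (mxsub gi fj M)| <= (q + 1)`!%:R * qm (q + 1) M by rewrite [in X in _ <= X -> _]addn1.
exact: minor_le_qm.
Qed.

(* With a maximal [q]-minor as pivot, [M = [X | 1] *m [rows of M; Schur
   complement]] with bounded [X], and at least two rows of every minor of order
   [q + 2] of the last factor are rows of the Schur complement. *)
Lemma qm_concave q a b : exists2 C : R, 0 < C & forall M : 'M[R]_(a, b),
  0 < qm q M -> qm q.+2 M * qm q M <= C * qm q.+1 M ^+ 2.
Proof.
pose c1 := qcst R q a b * q`!%:R.
have c1_ge0 : 0 <= c1 by rewrite mulr_ge0.
have [C1 hC1] := @qm_bounded R q.+2 a (q + a) ((a * (q + a))%:R * (c1 + 1)).
have [C2 hC2] := @qm_bounded R q.+1 (q + a) a (((q + a) * a)%:R * (q%:R * c1 + 1)).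
pose c3 := qcst R q a b * q.+1`!%:R.
pose c4 := qcst R q.+2 (q + a) b * (q.+2%:R * q.+1`!%:R).
exists (Num.max 1 (C1 * (c4 * (c3 * C2)))); first by rewrite lt_max ltr01.
move=> M q0; have [g [f pv]] := exists_pivot q0.
pose X := colsub f M *m invmx (mxsub g f M).
pose S := M - X *m rowsub g M.
pose W := col_mx (rowsub g M) S.
pose e := c3 * qm q.+1 M / qm q M.
have e0 : 0 <= e by rewrite /e !mulr_ge0 ?invr_ge0 ?qm_ge0.
have hX i k : `|X i k| <= c1 by apply: pivot_cols_le.
have MW : M = row_mx X 1%:M *m W by rewrite mul_row_col mul1mx addrC subrK.
have WM : W = col_mx (rowsub g 1%:M) (1%:M - X *m rowsub g 1%:M) *m M.
  rewrite mul_col_mx mulmxBl mul1mx -mulmxA -rowsubE.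
  by congr col_mx; rewrite rowsubE.
have q1 : qm q.+2 M <= C1 * qm q.+2 W.
  rewrite {1}MW; apply: le_trans (qmM _ _ _) _; rewrite ler_wpM2r ?qm_ge0 //.
  apply: hC1; apply: nrm_le => i j; rewrite mxE; case: (fintype.split j) => k.
    by apply: le_trans (hX _ _) _; rewrite lerDl.
  by rewrite !mxE; case: (i == k); rewrite ?normr1 ?normr0 ?lerDr ?addr_ge0.
have q2 : qm q.+1 W <= C2 * qm q.+1 M.
  rewrite {1}WM; apply: le_trans (qmM _ _ _) _; rewrite ler_wpM2r ?qm_ge0 //.
  have c2_ge0 : 0 <= q%:R * c1 by rewrite mulr_ge0.
  apply: hC2; apply: nrm_le => i j; rewrite mxE; case: (fintype.split i) => k.
    by rewrite !mxE; case: (_ == _); rewrite ?normr1 ?normr0 ?lerDr ?addr_ge0.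
  rewrite !mxE [leRHS]addrC; apply: le_trans (ler_normB _ _) _; apply: lerD.
    by case: (_ == _); rewrite ?normr1 ?normr0.
  apply: le_trans (ler_norm_sum _ _ _) _.
  apply: (@le_trans _ _ (\sum_(l < q) c1)).
    apply: ler_sum => l _; rewrite normrM -[leRHS]mulr1; apply: ler_pM => //.
    by rewrite !mxE; case: (_ == _); rewrite ?normr1 ?normr0.
  by rewrite sumr_const card_ord -[leLHS]mulr_natl.
have q3 : qm q.+2 W <= c4 * (e * qm q.+1 W).
  have -> : c4 * (e * qm q.+1 W) = qcst R q.+2 (q + a) b *
     (q.+2%:R * (e * (q.+1`!%:R * qm q.+1 W))) by rewrite /c4; ring.
  pose J := [pred i : 'I_(q + a) | if fintype.split i is inr _ then true else false].
  apply: (@qm_small_rows q.+1 (q + a) b W J) => // [|i].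
    apply: leq_trans (_ : #|codom (@lshift q a)| <= _)%N.
      apply/subset_leq_card/fintype.subsetP => i; rewrite !inE.
      case: splitP => // j ij _; apply/codomP; exists j.
      by apply: val_inj.
    by apply: leq_trans (leq_image_card _ _) _; rewrite card_ord.
  rewrite /J /= => Ji j; rewrite /W mxE; case: (fintype.split i) Ji => // k _.
  have := schur_entry k j pv q0.
  by rewrite /e /c3 /S /X !mulrA.
have C10 : 0 <= C1.
  have := qm_ge0 q.+2 (0 : 'M[R]_(a, q + a)); move/le_trans; apply; apply: hC1.
  by rewrite nrm0 !mulr_ge0 // addr_ge0.
have c40 : 0 <= c4 by rewrite !mulr_ge0.
have c30 : 0 <= c3 by rewrite !mulr_ge0.
have C20 : 0 <= C2.
  have := qm_ge0 q.+1 (0 : 'M[R]_(q + a, a)); move/le_trans; apply; apply: hC2.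
  by rewrite nrm0 !mulr_ge0 // addr_ge0 // mulr_ge0.
apply: le_trans (_ : C1 * (c4 * (c3 * C2)) * qm q.+1 M ^+ 2 <= _); last first.
  by rewrite ler_wpM2r ?sqr_ge0 // le_max lexx orbT.
clearbody c4 c3.
rewrite -ler_pdivlMr //; apply: le_trans q1 _.
rewrite -!mulrA ler_wpM2l //; apply: le_trans q3 _; rewrite ler_wpM2l //.
rewrite /e -!mulrA ler_wpM2l //.
apply: (@le_trans _ _ (qm q.+1 M * ((qm q M)^-1 * (C2 * qm q.+1 M)))).
  by rewrite !ler_wpM2l ?invr_ge0 ?qm_ge0.
by rewrite le_eqVlt; apply/orP; left; apply/eqP; ring.
Qed.

End Pivots.

(** * Slow vectors of matrix products *)

Section SlowVectors.
Variable R : realFieldType.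

(* [P] projects onto the coordinates of a maximal minor along the vectors which
   the pivot columns of [M] annihilate. *)
Lemma slow_projection q m : exists2 c : R, 0 <= c & forall M : 'M[R]_m,
  0 < qm q.+1 M -> exists P : 'M[R]_m,
  [/\ (\rank P <= q.+1)%N,
      forall v : 'rV_m, nrm (v *m (1%:M - P) *m M) <=
        c * (qm q.+2 M / qm q.+1 M) * nrm (v *m (1%:M - P)) &
      forall (N B : 'M[R]_m), M = N *m B -> forall v : 'rV_m,
        nrm (v *m P *m N) <=
        c * (qm q B * qm q.+1 N / qm q.+1 M) * nrm (v *m M)].
Proof.
pose c1 := (m * m)%:R * (qcst R q.+1 m m * q.+2`!%:R).
pose c2 := (1 * q.+1)%:R * ((q.+1 * m)%:R * (qcst R q.+1 m m *
  (#|{ffun 'I_q.+1 -> 'I_m}|%:R * (q.+1%:R * q`!%:R)))).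
have c10 : 0 <= c1 by rewrite !mulr_ge0.
have c20 : 0 <= c2 by rewrite !mulr_ge0.
exists (c1 + c2) => [|M M0]; first exact: addr_ge0.
have [g [f pv]] := exists_pivot M0; have Du := pivot_unit pv.
set D := mxsub g f M in Du.
pose X := colsub f M *m invmx D.
pose P := X *m rowsub g 1%:M.
have gX : rowsub g 1%:M *m X = 1%:M.
  rewrite /X mulmxA -rowsubE (_ : rowsub g (colsub f M) = D) ?mulmxV //.
  by apply/matrixP => x y; rewrite !mxE.
have PP : (1%:M - P) *m (1%:M - P) = 1%:M - P.
  rewrite mulmxBr mulmx1 mulmxBl mul1mx.
  have -> : P *m P = X *m (rowsub g 1%:M *m X) *m rowsub g 1%:M by rewrite !mulmxA.
  by rewrite gX mulmx1 subrr subr0.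
exists P; split.
- by rewrite /P; apply: leq_trans (mulmx_max_rank _ _) _.
- move=> v; rewrite -{1}PP -mulmxA -(mulmxA _ _ M) mulmxA mulrC.
  apply: le_trans (nrmM _ _) _; rewrite ler_wpM2l ?nrm_ge0 //.
  apply: (@le_trans _ _ (c1 * (qm q.+2 M / qm q.+1 M))); last first.
    by rewrite ler_wpM2r ?lerDl // divr_ge0 ?qm_ge0.
  have -> : c1 * (qm q.+2 M / qm q.+1 M) =
    (m * m)%:R * (qcst R q.+1 m m * (q.+2`!%:R * qm q.+2 M) / qm q.+1 M).
    by rewrite /c1; ring.
  apply: nrm_le => i j.
  have -> : (1%:M - P) *m M = M - colsub f M *m invmx D *m rowsub g M.
    by rewrite mulmxBl mul1mx (rowsubE g M) !mulmxA.
  exact: schur_entry.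
move=> N B MNB v.
have -> : v *m P *m N = colsub f (v *m M) *m (invmx D *m rowsub g N).
  by rewrite /P /X -mulmx_colsub (rowsubE g N) !mulmxA.
apply: le_trans (nrmM _ _) _.
have h1 : nrm (colsub f (v *m M)) <= (1 * q.+1)%:R * nrm (v *m M) by apply: nrm_mxsub.
have h2 : nrm (invmx D *m rowsub g N) <= (q.+1 * m)%:R * (qcst R q.+1 m m *
   (#|{ffun 'I_q.+1 -> 'I_m}|%:R * (qm q.+1 N * (q.+1%:R * (q`!%:R * qm q B)))) / qm q.+1 M).
  apply: nrm_le => i j; rewrite /D; move: M0 pv; rewrite MNB => M0 pv.
  exact: pivot_mul_le.
have h3 : 0 <= qm q B * qm q.+1 N / qm q.+1 M by rewrite !mulr_ge0 ?invr_ge0 ?qm_ge0.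
apply: (@le_trans _ _ (c2 * (qm q B * qm q.+1 N / qm q.+1 M) * nrm (v *m M))); last first.
  by rewrite ler_wpM2r ?nrm_ge0 // ler_wpM2r // lerDr.
apply: le_trans (ler_pM (nrm_ge0 _) (nrm_ge0 _) h1 h2) _.
by rewrite le_eqVlt; apply/orP; left; apply/eqP; rewrite /c2; ring.
Qed.

Variables (m q : nat) (M : nat -> 'M[R]_m) (B : nat -> nat -> 'M[R]_m) (K : R).
Hypothesis Munit : forall n, M n \in unitmx.
Hypothesis M0 : M 0%N = 1%:M.
Hypothesis MB : forall n k, M (n + k)%N = M n *m B n k.
Hypothesis MK : forall n (v : 'rV_m), nrm (v *m M n) <= K * nrm (v *m M n.+1).
Hypothesis qm_lt : (q.+2 <= m)%N.

Definition srate j := qm q.+2 (M j) / qm q.+1 (M j).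
Definition drift i j :=
  qm q (B i (j - i)) * qm q.+1 (M i) / qm q.+1 (M j) * srate j.+1.

Let q1_gt0 n : 0 < qm q.+1 (M n).
Proof. by apply: qm_gt0 => //; apply: ltnW. Qed.

Lemma srate_ge0 j : 0 <= srate j.
Proof. by rewrite divr_ge0 ?qm_ge0. Qed.

Lemma drift_ge0 i j : 0 <= drift i j.
Proof. by rewrite !mulr_ge0 ?invr_ge0 ?qm_ge0 ?srate_ge0. Qed.

(* [drift i j] bounds, at time [i], the correction needed to turn a slow vector
   for time [j + 1] into one for time [j]. *)
Lemma slow_chain : exists2 c : R, 0 <= c & forall E k (U : 'M[R]_m),
  (forall a b, (a <= b)%N -> \prod_(a <= j < b) (1 + c * drift 0 j) <= E) ->
  (q.+1 < \rank U)%N ->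
  exists u : 'rV_m, [/\ (u <= U)%MS, nrm u = 1 &
   forall n, (n <= k)%N ->
    nrm (u *m M n) <= E * (c * srate n + \sum_(n <= j < k) c * drift n j)].
Proof.
have [c c0 hc] := slow_projection q m.
have K0 : 0 <= K.
  have [m' mE] : exists m', m = m'.+1 by exists m.-1; rewrite prednK // (leq_trans _ qm_lt).
  have v0 : 0 < nrm (const_mx 1 *m M 1%N : 'rV[R]_m).
    rewrite nrm_gt0; apply/eqP => /(congr1 (mulmx^~ (invmx (M 1%N)))).
    rewrite mulmxK // mul0mx => /matrixP/(_ ord0 (cast_ord (esym mE) ord0)).
    by rewrite !mxE => /eqP; rewrite oner_eq0.
  have := le_trans (nrm_ge0 _) (MK 0 (const_mx 1)).
  by rewrite pmulr_lge0.
pose C := c + c * (K * c).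
have C0 : 0 <= C by rewrite addr_ge0 ?mulr_ge0.
have cC : c <= C by rewrite lerDl !mulr_ge0.
have cC' : c * (K * c) <= C by rewrite lerDr.
exists C => // E k U hE rU.
have slow0 n (w : 'rV_m) : nrm (w *m M n) <= c * srate n * nrm w ->
    nrm (w *m M n) <= C * srate n * nrm w.
  by move/le_trans; apply; rewrite ler_wpM2r ?nrm_ge0 // ler_wpM2r ?srate_ge0.
pose pr a b := \prod_(a <= j < b) (1 + C * drift 0 j).
have pr0 a b : 0 <= pr a b.
  by apply: prodr_ge0 => j _; rewrite addr_ge0 // mulr_ge0 ?drift_ge0.
have E0 : 0 <= E by apply: le_trans (hE 0%N 0%N _); rewrite // big_geq.
have [P [rP Pslow _]] := hc (M k) (q1_gt0 k).
have [u [uU uP u1]] : exists u : 'rV_m, [/\ (u <= U)%MS, u *m P = 0 & nrm u = 1].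
  have r0 : (U :&: kermx P)%MS != 0.
    rewrite -mxrank_eq0 -lt0n.
    have := mxrank_sum_cap U (kermx P); rewrite mxrank_ker.
    have := rank_leq_col (U + kermx P)%MS; have := rank_leq_row P.
    move: rU rP; clear; move: (\rank _) (\rank _) (\rank _) (\rank _) => a b c' d.
    lia.
  have /rowV0Pn[v vU v0] := r0; move: vU; rewrite sub_capmx => /andP[vU /sub_kermxP vP].
  exists ((nrm v)^-1 *: v); split; first exact: scalemx_sub.
    by rewrite -scalemxAl vP scaler0.
  by rewrite nrmZ ger0_norm ?invr_ge0 ?nrm_ge0 // mulVf // gt_eqF // nrm_gt0.
have step d : forall n, (n + d)%N = k -> exists w : 'rV_m,
    [/\ nrm (w *m M n) <= c * srate n * nrm w, nrm w <= pr n k &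
        forall i, (i <= n)%N ->
          nrm ((u - w) *m M i) <= \sum_(n <= j < k) E * (C * drift i j)].
  elim: d => [n|d IH n].
    rewrite addn0 => ->; exists u; split.
    - have uE : u = u *m (1%:M - P) by rewrite mulmxBr mulmx1 uP subr0.
      by have := Pslow u; rewrite -uE.
    - by rewrite u1 /pr big_geq.
    - by move=> i _; rewrite subrr mul0mx nrm0 big_geq.
  rewrite addnS -addSn => nk; have [w [w1 w2 w3]] := IH _ nk.
  have [Q [_ Qslow Qdrift]] := hc (M n) (q1_gt0 n).
  have nk' : (n < k)%N by rewrite -nk leq_addr.
  have wE : nrm w <= E by apply: le_trans w2 _; apply: hE.
  have key i : (i <= n)%N -> nrm (w *m Q *m M i) <= C * drift i n * nrm w.
    move=> ilen; have Mn : M n = M i *m B i (n - i)%N by rewrite -MB subnKC.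
    apply: le_trans (Qdrift _ _ Mn w) _.
    have h1 : nrm (w *m M n) <= K * (c * srate n.+1 * nrm w).
      by apply: le_trans (MK _ _) _; rewrite ler_wpM2l.
    have h2 : 0 <= c * (qm q (B i (n - i)) * qm q.+1 (M i) / qm q.+1 (M n)).
      by rewrite !mulr_ge0 ?invr_ge0 ?qm_ge0.
    apply: le_trans (ler_wpM2l h2 h1) _.
    apply: (@le_trans _ _ (c * (K * c) * drift i n * nrm w)).
      by rewrite le_eqVlt; apply/orP; left; apply/eqP; rewrite /drift; ring.
    by rewrite ler_wpM2r ?nrm_ge0 // ler_wpM2r ?drift_ge0.
  exists (w *m (1%:M - Q)); split.
  - exact: Qslow.
  - rewrite mulmxBr mulmx1; apply: le_trans (ler_nrmD _ _) _; rewrite nrmN.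
    have := key 0%N isT; rewrite M0 mulmx1 => h.
    rewrite /pr big_ltn // -/(pr _ _).
    apply: (@le_trans _ _ ((1 + C * drift 0 n) * nrm w)); first by rewrite mulrDl mul1r lerD2l.
    by rewrite ler_wpM2l // addr_ge0 // mulr_ge0 ?drift_ge0.
  - move=> i ilen; rewrite big_ltn //.
    have -> : u - w *m (1%:M - Q) = w *m Q + (u - w).
      by rewrite mulmxBr mulmx1 opprB addrCA addrA addrAC -addrA.
    rewrite mulmxDl; apply: le_trans (ler_nrmD _ _) _; apply: lerD.
      apply: le_trans (key _ ilen) _; rewrite [leRHS]mulrC ler_wpM2l //.
      by rewrite mulr_ge0 ?drift_ge0.
    exact/w3/leqW.
exists u; split=> // n nk.
have [w [w1 w2 w3]] := step (k - n)%N n (subnKC nk).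
have -> : u = w + (u - w) by rewrite addrCA subrr addr0.
rewrite mulmxDl mulrDr; apply: le_trans (ler_nrmD _ _) _; apply: lerD.
  apply: le_trans (slow0 _ _ w1) _; rewrite [leRHS]mulrC.
  apply: ler_wpM2l; first by apply: mulr_ge0 => //; apply: srate_ge0.
  by apply: le_trans w2 _; apply: hE.
by rewrite mulr_sumr; apply: w3.
Qed.

End SlowVectors.

Section Limits.
Variable R : realType.

Lemma unit_cluster m (u : nat -> 'rV[R]_m) : (forall k, nrm (u k) = 1) ->
  exists2 p : 'rV[R]_m, p != 0 &
    forall b (Z : 'M[R]_(m, b)) c k1,
      (forall k, (k1 <= k)%N -> nrm (u k *m Z) <= c) -> nrm (p *m Z) <= c.
Proof.
move=> u1.
pose A := [set v : 'rV[R]_m | forall i, `[(-1 : R), 1]%classic (v ord0 i)].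
have cA : compact A.
  by apply: (@rV_compact R m (fun=> `[(-1 : R), 1]%classic)) => i; exact: segment_compact.
have [|p [_ clp]] := cA (u @ \oo) _.
  exists 0%N => // k _ i /=; rewrite in_itv /= -ler_norml -(u1 k); exact: nrm_entry.
have near_p e k1 : 0 < e -> exists2 k, (k1 <= k)%N & nrm (u k - p) <= e.
  move=> e0.
  pose e' := e / (m%:R + 1).
  have m1 : 0 < m%:R + 1 :> R by rewrite ltr_wpDl.
  have e'0 : 0 < e' by rewrite divr_gt0.
  have FA : (u @ \oo) [set u k | k in [set k | (k1 <= k)%N]].
    by exists k1 => // k /= hk; exists k.
  have nB : nbhs p (ball p e') by exact: nbhsx_ballx.
  have [_ [[k /= hk <-] hb]] := clp _ _ FA nB.
  exists k => //; case: hb => _ hb.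
  apply: le_trans (@nrm_le _ _ _ _ e' _) _ => [i j|].
    rewrite !mxE distrC; apply: ltW; exact: hb.
  by rewrite mul1n /e' mulrA ler_pdivrMr // mulrC ler_pM2l // lerDl.
have pn0 : p != 0.
  apply/eqP => p0.
  have [k _] := near_p (1 / 2) 0%N ltac:(by lra).
  by rewrite p0 subr0 u1; lra.
exists p => // b Z c k1 hc; apply/ler_addgt0Pr => e e0.
pose z := nrm Z + 1.
have z0 : 0 < z by rewrite ltr_wpDl ?nrm_ge0.
have [k hk pk] := near_p (e / z) k1 (divr_gt0 e0 z0).
have -> : p = u k - (u k - p) by rewrite opprB addrCA subrr addr0.
rewrite mulmxBl; apply: le_trans (ler_nrmD _ _) _; rewrite nrmN lerD ?hc //.
apply: le_trans (nrmM _ _) _.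
apply: le_trans (ler_wpM2r (nrm_ge0 _) pk) _.
by rewrite mulrAC ler_pdivrMr // ler_pM2l // lerDl.
Qed.

Lemma sum_geom_le (x : R) a b : 0 <= x < 1 ->
  \sum_(a <= j < b) x ^+ (j - a) <= (1 - x)^-1.
Proof.
move=> /andP[x0 x1].
have [ab|/ltnW ba] := leqP a b; last first.
  by rewrite big_geq // invr_ge0 subr_ge0 ltW.
rewrite -{1}[a]add0n big_addn (eq_bigr (fun j => x ^+ j)); last first.
  by move=> j _; rewrite addnK.
have d0 : 0 < 1 - x by rewrite subr_gt0.
rewrite -[leRHS]mul1r ler_pdivlMr // mulrC.
rewrite big_mkord -opprB mulNr -subrX1 opprB gerBl ?exprn_ge0 //.
Qed.

Lemma bounded_sum_of_tail (e : nat -> R) n0 C : (forall j, 0 <= e j) -> 0 <= C ->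
  (forall a b, (n0 <= a)%N -> \sum_(a <= j < b) e j <= C) ->
  exists T, forall a b, \sum_(a <= j < b) e j <= T.
Proof.
move=> e0 C0 h; exists (\sum_(0 <= j < n0) e j + C) => a b.
have pos x y : 0 <= \sum_(x <= j < y) e j by apply: sumr_ge0.
have [n0a|an0] := leqP n0 a; first by apply: le_trans (h a b n0a) _; rewrite lerDr.
have [bn0|n0b] := leqP b n0.
  have [ab|/ltnW ba] := leqP a b; last by rewrite big_geq // addr_ge0.
  rewrite (@big_cat_nat _ _ _ a 0 n0) //= ?(ltnW an0) //.
  rewrite (@big_cat_nat _ _ _ b a n0) //=.
  by rewrite -!addrA addrCA lerDl !addr_ge0.
rewrite (@big_cat_nat _ _ _ n0 a b) //= ?(ltnW an0) ?(ltnW n0b) //; apply: lerD; last exact: h.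
by rewrite (@big_cat_nat _ _ _ a 0 n0) //= ?(ltnW an0) // lerDr.
Qed.

End Limits.

Section SlowVector.
Variable R : realType.

Lemma le_expR_of_ln (x y : R) : 0 < x -> ln x <= y -> x <= expR y.
Proof. by move=> x0 h; rewrite -[x]lnK ?posrE // ler_expR. Qed.

Lemma expR_le_of_ln (x y : R) : 0 < x -> y <= ln x -> expR y <= x.
Proof. by move=> x0 h; rewrite -[x]lnK ?posrE // ler_expR. Qed.

Lemma ler_prod_expR (F : nat -> R) a b : (forall j, 0 <= F j) ->
  \prod_(a <= j < b) (1 + F j) <= expR (\sum_(a <= j < b) F j).
Proof.
move=> F0; rewrite expR_sum; apply: ler_prod => j _.
by rewrite expR_ge1Dx andbT addr_ge0.
Qed.

Variables (m q : nat) (M : nat -> 'M[R]_m) (B : nat -> nat -> 'M[R]_m) (K : R).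
Hypothesis Munit : forall n, M n \in unitmx.
Hypothesis M0 : M 0%N = 1%:M.
Hypothesis MB : forall n k, M (n + k)%N = M n *m B n k.
Hypothesis MK : forall n (v : 'rV_m), nrm (v *m M n) <= K * nrm (v *m M n.+1).
Hypothesis qm_lt : (q.+2 <= m)%N.
Variables (b0 b1 a s C4 : R) (L : nat -> Prop).
Hypothesis growB : forall e, 0 < e -> exists C, forall n k,
  ln (qm q (B n k)) <= (b0 + e) * k%:R + C.
Hypothesis growM : forall e, 0 < e -> exists C, forall n,
  `|ln (qm q.+1 (M n)) - b1 * n%:R| <= e * n%:R + C.
Hypothesis s_gt0 : 0 < s.
Hypothesis lowM : forall n, L n -> forall j, (n <= j)%N ->
  ln (qm q.+2 (M j)) <= (2 * b1 - b0) * j%:R - a * n%:R - s * (j - n)%:R + C4.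

Lemma slow_vector (e : R) (U : 'M[R]_m) : 0 < e -> (q.+1 < \rank U)%N ->
  exists u : 'rV_m, [/\ u != 0, (u <= U)%MS & exists C, forall n, L n ->
    nrm (u *m M n) <= expR ((b1 - b0 - a + e) * n%:R + C)].
Proof.
move=> e0 rU.
have [[n0 Ln0]|noL] := pselect (exists n, L n); last first.
  have /rowV0Pn[v vU v0] : U != 0 by rewrite -mxrank_eq0; apply: contraTneq rU => ->.
  by exists v; split => //; exists 0 => n Ln; case: noL; exists n.
have Bunit n k : B n k \in unitmx.
  by have := Munit (n + k); rewrite MB unitmx_mul => /andP[].
have qB n k : 0 < qm q (B n k) by apply: qm_gt0 => //; lia.
have q1 n : 0 < qm q.+1 (M n) by apply: qm_gt0 => //; lia.
have q2 n : 0 < qm q.+2 (M n) by apply: qm_gt0.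
have [e' [e'0 e'e e's]] : exists e' : R, [/\ 0 < e', 3 * e' <= e & 3 * e' < s].
  exists (Num.min e s / 4); have : 0 < Num.min e s by rewrite lt_min e0.
  have : Num.min e s <= e by rewrite ge_min lexx.
  have : Num.min e s <= s by rewrite ge_min lexx orbT.
  by move: (Num.min e s) => x h1 h2 h3; split; lra.
have [C1 hC1] := growB e'0.
have [C2 hC2] := growM e'0.
have {}hC2 n : ln (qm q.+1 (M n)) <= (b1 + e') * n%:R + C2 /\
    (b1 - e') * n%:R - C2 <= ln (qm q.+1 (M n)).
  by have := hC2 n; rewrite ler_norml => /andP[]; split; lra.
pose x := expR (- (s - 3 * e')).
have x01 : 0 <= x < 1 by rewrite expR_ge0 expR_lt1 oppr_lt0 subr_gt0.
have [c c0 hc] := slow_chain Munit M0 MB MK qm_lt.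
pose C' := b1 - b0 - s + e' + C1 + 3 * C2 + C4.
have drift_le i n j : L n -> (i <= n)%N -> (n <= j)%N ->
    drift q M B i j <= expR ((b1 - b0) * i%:R + (3 * e' - a) * n%:R + C') * x ^+ (j - n).
  move=> Ln ilen nlej.
  have dp : 0 < drift q M B i j by rewrite /drift /srate !(mulr_gt0, invr_gt0).
  rewrite /x -expRM_natr -expRD; apply: le_expR_of_ln => //.
  rewrite /drift /srate !(lnM, lnV) ?posrE ?(mulr_gt0, invr_gt0) //.
  have := hC1 i (j - i)%N; have [+ _] := hC2 i; have [_] := hC2 j.
  have [_] := hC2 j.+1; have := lowM Ln (leqW nlej); rewrite /C'.
  have -> : (j.+1 - n)%N = (j - n).+1 by lia.
  rewrite !natrB ?(leq_trans ilen nlej) // -!natr1 natrB //.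
  set l1 := ln _; set l2 := ln _; set l3 := ln _; set l4 := ln _; set l5 := ln _.
  move: (i%:R : R) (j%:R : R) (n%:R : R) => ri rj rn.
  by move=> *; nra.
have sum_le i n k : L n -> (i <= n)%N ->
    \sum_(n <= j < k) c * drift q M B i j <=
    c * (expR ((b1 - b0) * i%:R + (3 * e' - a) * n%:R + C') * (1 - x)^-1).
  move=> Ln ilen; rewrite -mulr_sumr ler_wpM2l //.
  apply: le_trans (ler_wpM2l (expR_ge0 _) (sum_geom_le n k x01)).
  rewrite mulr_sumr big_nat_cond [leRHS]big_nat_cond; apply: ler_sum => j.
  by rewrite andbT => /andP[nj _]; apply: drift_le.
have [T hT] : exists T, forall a b, \sum_(a <= j < b) c * drift q M B 0 j <= T.
  have d0 j : 0 <= c * drift q M B 0 j by rewrite mulr_ge0 // drift_ge0.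
  apply: (@bounded_sum_of_tail _ _ n0
     (c * (expR ((b1 - b0) * 0 + (3 * e' - a) * n0%:R + C') * (1 - x)^-1))) => // [|u v nu].
    by rewrite !mulr_ge0 ?expR_ge0 // invr_ge0 subr_ge0; case/andP: x01 => _ /ltW.
  apply: le_trans (sum_le 0%N n0 v Ln0 (leq0n _)).
  have [uv|/ltnW vu] := leqP u v; last by rewrite big_geq // sumr_ge0.
  by rewrite (@big_cat_nat _ _ _ u n0 v) //= lerDr sumr_ge0.
pose E := expR T.
have hE u v : (u <= v)%N -> \prod_(u <= j < v) (1 + c * drift q M B 0 j) <= E.
  move=> _; apply: le_trans (ler_prod_expR _ _ _) _ => [j|].
    by rewrite mulr_ge0 // drift_ge0.
  by rewrite ler_expR.
have /choice[u hu] k := hc E k U hE rU.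
have [p p0 hp] := @unit_cluster R m u (fun k => let: And3 _ h _ := hu k in h).
exists p; split => //.
  rewrite submxE -nrm_eq0 -normr_le0 ger0_norm ?nrm_ge0 //.
  apply: (hp _ _ _ 0%N) => k _; have [+ _ _] := hu k.
  by rewrite submxE => /eqP ->; rewrite nrm0.
pose C5 := C4 + C2.
pose F := E * (c * expR C5 + c * (expR C' * (1 - x)^-1)).
have F0 : 0 <= F.
  rewrite !mulr_ge0 ?expR_ge0 // addr_ge0 // !mulr_ge0 ?expR_ge0 //.
  by rewrite invr_ge0 subr_ge0; case/andP: x01 => _ /ltW.
exists (ln (F + 1)) => n Ln.
apply: (hp _ _ _ n) => k nk; have [_ _ /(_ n nk)] := hu k; move/le_trans; apply.
rewrite expRD lnK ?posrE ?ltr_wpDl //.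
set y := expR _.
have y0 : 0 <= y by exact: expR_ge0.
have s1 : srate q M n <= expR C5 * y.
  rewrite /y -expRD; apply: le_expR_of_ln.
    by rewrite /srate !(mulr_gt0, invr_gt0).
  rewrite /srate !(lnM, lnV) ?posrE ?(mulr_gt0, invr_gt0) //.
  have [_] := hC2 n; have := lowM Ln (leqnn n); rewrite subnn mulr0 /C5.
  set l1 := ln _; set l2 := ln _.
  have : 0 <= n%:R :> R by [].
  by move: (n%:R : R) => rn *; nra.
have s2 : expR ((b1 - b0) * n%:R + (3 * e' - a) * n%:R + C') <= expR C' * y.
  rewrite /y -expRD ler_expR.
  have : 0 <= n%:R :> R by [].
  by move: (n%:R : R) => rn *; nra.
apply: (@le_trans _ _ (E * (c * (expR C5 * y) + c * ((expR C' * y) * (1 - x)^-1)))).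
  rewrite ler_wpM2l ?expR_ge0 //; apply: lerD; first by rewrite ler_wpM2l.
  apply: le_trans (sum_le n n k Ln (leqnn _)) _; rewrite ler_wpM2l // ler_wpM2r //.
  by rewrite invr_ge0 subr_ge0; case/andP: x01 => _ /ltW.
have -> : E * (c * (expR C5 * y) + c * (expR C' * y * (1 - x)^-1)) = y * F.
  by rewrite /F; ring.
by rewrite ler_wpM2l // lerDl.
Qed.

End SlowVector.

(** * Lyapunov exponents and slow subspaces *)

Section Exponents.
Variable R : realType.

Lemma finite_pos_lower_bound (I : finType) (P : pred I) (F : I -> R) :
  (forall i, P i -> 0 < F i) -> exists2 e : R, 0 < e & forall i, P i -> e <= F i.
Proof.
move=> h; have s0 (Q : pred I) : 0 <= \sum_(i | P i && Q i) (F i)^-1.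
  by apply: sumr_ge0 => i /andP[Pi _]; rewrite invr_ge0 ltW // h.
have sP : 0 <= \sum_(i | P i) (F i)^-1.
  by apply: sumr_ge0 => i Pi; rewrite invr_ge0 ltW // h.
exists (1 + \sum_(i | P i) (F i)^-1)^-1 => [|i Pi].
  by rewrite invr_gt0 ltr_wpDr.
rewrite -[leRHS]invrK lef_pV2 ?posrE ?invr_gt0 ?h ?ltr_wpDr //.
by rewrite (bigD1 i) //= addrCA lerDl addr_ge0.
Qed.

Lemma linear_bound_of_eventually (u : nat -> R) b C N :
  (forall n, (N <= n)%N -> u n <= b * n%:R + C) ->
  exists C', forall n, u n <= b * n%:R + C'.
Proof.
move=> h; exists (`|C| + \sum_(j < N) `|u j - b * j%:R|) => n.
have [Nn|nN] := leqP N n.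
  apply: le_trans (h n Nn) _; rewrite lerD2l; apply: le_trans (ler_norm _) _.
  by rewrite lerDl sumr_ge0.
rewrite (bigD1 (Ordinal nN)) //=.
have : u n - b * n%:R <= `|u n - b * n%:R| by exact: ler_norm.
have : 0 <= \sum_(i < N | i != Ordinal nN) `|u i - b * i%:R| by apply: sumr_ge0.
by have := normr_ge0 C; lra.
Qed.

Lemma mxnorm_ge a b (M : 'M[R]_(a, b)) i j : `|M i j| <= mxnorm M.
Proof.
rewrite /mxnorm; apply: le_trans (_ : \big[Num.max/0]_(j < b) `|M i j| <= _).
  exact: le_bigmax.
exact: (le_bigmax _ (fun i => \big[Num.max/0]_(j < b) `|M i j|)).
Qed.

Lemma mxnorm_le_nrm a b (M : 'M[R]_(a, b)) : mxnorm M <= nrm M.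
Proof.
apply: bigmax_le; first exact: nrm_ge0.
move=> i _; apply: bigmax_le; first exact: nrm_ge0.
by move=> j _; exact: nrm_entry.
Qed.

Lemma nrm_le_mxnorm a b (M : 'M[R]_(a, b)) : nrm M <= (a * b)%:R * mxnorm M.
Proof. by apply: nrm_le => i j; exact: mxnorm_ge. Qed.

Lemma nrm_le_qm1 a b (M : 'M[R]_(a, b)) : nrm M <= (a * b)%:R * qm 1 M.
Proof.
apply: nrm_le => i j; have := minor_le_qm M (fun _ : 'I_1 => i) (fun=> j).
by rewrite det_mx11 mxE factS fact0 mul1r.
Qed.

Variables (m : nat) (M : nat -> 'M[R]_m).
Hypothesis Munit : forall n, M n \in unitmx.

Let mulM_gt0 (v : 'rV_m) n : v != 0 -> 0 < nrm (v *m M n).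
Proof.
move=> v0; rewrite nrm_gt0; apply: contraNneq v0 => /(congr1 (mulmx^~ (invmx (M n)))).
by rewrite mulmxK // mul0mx => ->.
Qed.

Lemma exponent_bounds (v : 'rV[R]_m) (chi e : R) : v != 0 -> 0 < e ->
  (fun n : nat => n%:R^-1 * ln (mxnorm (v *m M n))) @ \oo --> chi ->
  exists C, forall n, (chi - e) * n%:R - C <= ln (nrm (v *m M n)) /\
                      ln (nrm (v *m M n)) <= (chi + e) * n%:R + C.
Proof.
move=> v0 e0 /cvgrPdist_le /(_ e e0) [N _ hN].
have m0 : (0 < m)%N.
  apply: contraNltn v0; rewrite leqn0 => /eqP m0; apply/eqP/matrixP => i [j jm].
  by exfalso; move: jm; rewrite [X in (_ < X)%N]m0.
have mx0 n : 0 < mxnorm (v *m M n).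
  have := lt_le_trans (mulM_gt0 n v0) (nrm_le_mxnorm _).
  by rewrite pmulr_rgt0 // ltr0n mul1n.
have key n : (N.+1 <= n)%N -> (chi - e) * n%:R <= ln (mxnorm (v *m M n)) /\
    ln (mxnorm (v *m M n)) <= (chi + e) * n%:R.
  move=> nN; have := hN n (ltnW nN) => /=.
  have n0 : 0 < n%:R :> R by rewrite ltr0n; lia.
  rewrite ler_norml => /andP[h1 h2].
  have E : ln (mxnorm (v *m M n)) = n%:R^-1 * ln (mxnorm (v *m M n)) * n%:R.
    by rewrite mulrAC mulVf ?mul1r // gt_eqF.
  by split; rewrite E ler_pM2r //; lra.
have [C1 h1] : exists C, forall n, ln (nrm (v *m M n)) <= (chi + e) * n%:R + C.
  apply: (@linear_bound_of_eventually _ _ (ln (1 * m)%:R) N.+1) => n nN.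
  have [_ h] := key n nN; apply: le_trans (lerD h (lexx _)).
  rewrite -lnM ?posrE ?ltr0n ?mul1n // ler_ln ?posrE ?mulM_gt0 ?mulr_gt0 ?ltr0n //.
  by rewrite mulrC; have := nrm_le_mxnorm (v *m M n); rewrite mul1n.
have [C2 h2] : exists C, forall n, - ln (nrm (v *m M n)) <= (- (chi - e)) * n%:R + C.
  apply: (@linear_bound_of_eventually _ _ 0 N.+1) => n nN.
  have [h _] := key n nN; rewrite addr0 mulNr lerN2; apply: le_trans h _.
  by rewrite ler_ln ?posrE ?mulM_gt0 // mxnorm_le_nrm.
exists (`|C1| + `|C2|) => n; have := h1 n; have := h2 n.
by have := ler_norm C1; have := ler_norm C2; have := normr_ge0 C1; have := normr_ge0 C2; split; lra.
Qed.

Lemma qm_of_slow_subspace q (V : 'M[R]_m) (c : R) : (q.+1 <= m)%N ->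
  (m <= q + \rank V)%N ->
  (forall v : 'rV_m, (v <= V)%MS ->
     exists C, forall n, nrm (v *m M n) <= expR (c * n%:R + C)) ->
  exists C, forall n, ln (qm q.+1 (M n)) <= c * n%:R + ln (qm q (M n)) + C.
Proof.
move=> qm_lt rV hV; pose P := row_ebase V.
have Pu : P \in unitmx by exact: row_ebase_unit.
pose J := [pred i : 'I_m | (i < \rank V)%N].
have rowJ i : J i -> (row i P <= V)%MS.
  move=> Ji; have -> : row i P = row (Ordinal Ji) (row_base V).
    apply/rowP => j; rewrite /row_base !mxE (bigD1 i) //= !mxE eqxx (Ji : (i < \rank V)%N) mul1r.
    by rewrite big1 ?addr0 // => k ki; rewrite !mxE eq_sym val_eqE (negbTE ki) mul0r.
  by rewrite -(eq_row_base V) row_sub.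
have cJ : (#|[predC J]| <= q)%N.
  have := cardC J; rewrite card_ord => cE.
  suff cV : (\rank V <= #|J|)%N.
    rewrite -(leq_add2l #|J|) cE; apply: leq_trans rV _.
    by rewrite addnC leq_add2r.
  have rm := rank_leq_row V.
  rewrite -[X in (X <= _)%N]card_ord -(card_codom (f := widen_ord rm)); last first.
    by move=> x y /(congr1 val) /= E; apply: val_inj.
  by apply: subset_leq_card; apply/fintype.subsetP => i /codomP[k ->]; rewrite inE /= ltn_ord.
have /choice[C hC] i : exists C, J i -> forall n, nrm (row i P *m M n) <= expR (c * n%:R + C).
  have [Ji|nJi] := boolP (J i); last by exists 0.
  by have [C hC] := hV _ (rowJ i Ji); exists C.
pose S := \sum_i expR (C i).
have S0 : 0 <= S by apply: sumr_ge0 => i _; exact: expR_ge0.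
pose D := qm q.+1 (invmx P) * (qcst R q.+1 m m * (q.+1%:R * (q`!%:R * (S * qm q P)))) + 1.
have D0 : 0 < D by rewrite ltr_wpDl // !mulr_ge0 ?qm_ge0.
have qp k n : (k <= m)%N -> 0 < qm k (M n) by move=> km; apply: qm_gt0.
exists (ln D) => n.
have main : qm q.+1 (M n) <= expR (c * n%:R) * qm q (M n) * D.
  have -> : M n = invmx P *m (P *m M n) by rewrite mulKmx.
  apply: le_trans (qmM _ _ _) _; rewrite mulKmx //.
  have eJ i : J i -> forall j, `|(P *m M n) i j| <= expR (c * n%:R) * S.
    move=> Ji j; have -> : (P *m M n) i j = (row i P *m M n) ord0 j.
      by rewrite -row_mul [RHS]mxE.
    apply: le_trans (nrm_entry _ _ _) _; apply: le_trans (hC i Ji n) _.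
    rewrite expRD ler_wpM2l ?expR_ge0 // /S (bigD1 i) //= lerDl.
    by apply: sumr_ge0 => k _; exact: expR_ge0.
  have e0 : 0 <= expR (c * n%:R) * S by rewrite mulr_ge0 ?expR_ge0.
  have h1 := qm_small_rows cJ e0 eJ.
  apply: le_trans (ler_wpM2l (qm_ge0 _ _) h1) _.
  have h2 : qm q (P *m M n) <= qm q P * qm q (M n) by exact: qmM.
  apply: (@le_trans _ _ (qm q.+1 (invmx P) * (qcst R q.+1 m m * (q.+1%:R *
     (expR (c * n%:R) * S * (q`!%:R * (qm q P * qm q (M n)))))))).
    by rewrite !ler_wpM2l ?qm_ge0.
  have -> : qm q.+1 (invmx P) * (qcst R q.+1 m m * (q.+1%:R *
     (expR (c * n%:R) * S * (q`!%:R * (qm q P * qm q (M n)))))) =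
     expR (c * n%:R) * qm q (M n) * (D - 1) by rewrite /D; ring.
  by rewrite ler_wpM2l ?mulr_ge0 ?expR_ge0 ?qm_ge0 // gerBl.
have q0 := qp q n (ltnW qm_lt); have e0 := expR_gt0 (c * n%:R).
have : ln (qm q.+1 (M n)) <= ln (expR (c * n%:R) * qm q (M n) * D).
  by rewrite ler_ln ?posrE ?qp // !mulr_gt0.
by move/le_trans; apply; rewrite !lnM ?posrE ?mulr_gt0 // expRK.
Qed.

Lemma rank_of_meets q (V : 'M[R]_m) :
  (forall U : 'M[R]_m, (q < \rank U)%N ->
     exists u : 'rV_m, [/\ u != 0, (u <= U)%MS & (u <= V)%MS]) ->
  (m <= q + \rank V)%N.
Proof.
move=> h; rewrite leqNgt; apply/negP => lt.
have [|u [u0 uU uV]] := h (V^C)%MS.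
  by rewrite mxrank_compl; lia.
move/negP: u0; apply; rewrite -submx0 -(capmx_compl V) sub_capmx uV uU //.
Qed.

Variables (r : nat) (chi : 'I_r -> R) (G : 'I_r -> 'M[R]_m).
Hypothesis chi_lt : forall i j : 'I_r, (i < j)%N -> chi i < chi j.
Hypothesis Gsplit : splitting G.
Hypothesis Gexp : forall i (v : 'rV[R]_m), v != 0 -> (v <= G i)%MS ->
  (fun n : nat => n%:R^-1 * ln (mxnorm (v *m M n))) @ \oo --> chi i.

Definition slow_space c := (\sum_(i < r | (chi i <= c)%R) G i)%MS.

Lemma rank_slow_space c :
  \rank (slow_space c) = (\sum_(i < r | (chi i <= c)%R) \rank (G i))%N.
Proof.
have [dir _] := Gsplit; apply/eqP; rewrite eqn_leq mxrank_sum_leqif.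
have /eqP := dir; rewrite /= => E.
pose W := (\sum_(i < r | ~~ (chi i <= c)%R) G i)%MS.
have hW : (\rank W <= \sum_(i < r | ~~ (chi i <= c)%R) \rank (G i))%N.
  by rewrite mxrank_sum_leqif.
have hS : (\sum_(i < r) \rank (G i) <= \rank (slow_space c) + \rank W)%N.
  rewrite -E [in leqLHS](bigID (fun i => chi i <= c)) /= mxrank_adds_leqif //.
move: hS; rewrite (bigID (fun i => chi i <= c)) /= => hS.
by rewrite -(leq_add2r (\rank W)); apply: leq_trans hS; rewrite leq_add2l.
Qed.

Let chi_inj i j : chi i = chi j -> i = j.
Proof.
move=> E; apply: val_inj; case: (ltngtP i j) => // /chi_lt; by rewrite E ltxx.
Qed.

Lemma slow_space_growth c (v : 'rV[R]_m) e : 0 < e -> (v <= slow_space c)%MS ->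
  exists C, forall n, nrm (v *m M n) <= expR ((c + e) * n%:R + C).
Proof.
move=> e0 /sub_sumsmxP[u ->].
have /choice[C hC] i : exists C, chi i <= c -> forall n,
    nrm (u i *m G i *m M n) <= expR ((c + e) * n%:R + C).
  have [v0|v0] := eqVneq (u i *m G i) 0.
    by exists 0 => _ n; rewrite v0 mul0mx nrm0 expR_ge0.
  have [C hC] := exponent_bounds v0 e0 (Gexp v0 (submxMl _ _)).
  exists C => ci n; have [_ h] := hC n.
  apply: le_expR_of_ln; first exact: mulM_gt0.
  apply: le_trans h _; rewrite lerD2r ler_wpM2r //; lra.
exists (ln (\sum_i expR (C i) + 1)) => n.
have S0 : 0 <= \sum_i expR (C i) by apply: sumr_ge0 => i _; exact: expR_ge0.
rewrite expRD lnK ?posrE ?ltr_wpDl // mulmx_suml.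
apply: (@le_trans _ _ (\sum_(i < r | chi i <= c) nrm (u i *m G i *m M n))).
  elim/big_ind2 : _ => [|x1 x2 y1 y2 h1 h2|//]; first by rewrite nrm0.
  by apply: le_trans (ler_nrmD _ _) _; apply: lerD.
apply: (@le_trans _ _ (\sum_(i < r | chi i <= c) expR ((c + e) * n%:R) * expR (C i))).
  by apply: ler_sum => i ci; rewrite -expRD hC.
rewrite -mulr_sumr ler_wpM2l ?expR_ge0 //.
rewrite [in leRHS](bigID (fun i => chi i <= c)) /= -addrA lerDl addr_ge0 //.
by apply: sumr_ge0 => i _; exact: expR_ge0.
Qed.

Lemma slow_space_of_growth (L : nat -> Prop) c C (u : 'rV[R]_m) :
  (forall N, exists2 n, (N <= n)%N & L n) ->
  (forall n, L n -> nrm (u *m M n) <= expR (c * n%:R + C)) ->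
  (u <= slow_space c)%MS.
Proof.
move=> Linf hu; have [_ /andP[_ full]] := Gsplit.
have /sub_sumsmxP[w uE] : (u <= \sum_(i < r) G i)%MS by apply: submx_trans full; exact: submx1.
pose v i := w i *m G i.
have {}uE : u = \sum_i v i by [].
have vG i : (v i <= G i)%MS by exact: submxMl.
have [/existsP[i1 /andP[v1 c1]]|/existsPn none] :=
  boolP [exists i, (v i != 0) && ~~ (chi i <= c)]; last first.
  rewrite uE; apply: summx_sub => i _.
  have := none i; rewrite negb_and !negbK => /orP[/eqP ->|ci]; first exact: sub0mx.
  by apply: submx_trans (vG i) _; rewrite /slow_space (sumsmx_sup i).
exfalso.
pose i0 := [arg max_(i > i1 | v i != 0) chi i]%O.
have [v0 imax] : v i0 != 0 /\ forall j, v j != 0 -> chi j <= chi i0.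
  by rewrite /i0; case: arg_maxP.
have c0 : c < chi i0 by apply: lt_le_trans (imax i1 v1); rewrite ltNge.
pose Pj (j : option 'I_r) := if j is Some k then (v k != 0) && (k != i0) else true.
pose F (j : option 'I_r) := if j is Some k then chi i0 - chi k else chi i0 - c.
have [e e0 he] : exists2 e, 0 < e & forall j, Pj j -> e <= F j.
  apply: finite_pos_lower_bound => -[k|_] /=; last by rewrite subr_gt0.
  move=> /andP[vk ki]; rewrite subr_gt0 lt_neqAle imax // andbT.
  by apply: contraNneq ki => /chi_inj ->.
pose e' := e / 3; have e'0 : 0 < e' by rewrite divr_gt0.
have [C0 h0] := exponent_bounds v0 e'0 (Gexp v0 (vG i0)).
have /choice[D hD] k : exists D, k != i0 -> forall n,
    nrm (v k *m M n) <= expR ((chi i0 - 2 * e') * n%:R + D).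
  have [vk|vk] := eqVneq (v k) 0.
    by exists 0 => _ n; rewrite vk mul0mx nrm0 expR_ge0.
  have [D hD] := exponent_bounds vk e'0 (Gexp vk (vG k)); exists D => ki n.
  have [_ h] := hD n; apply: le_expR_of_ln; first exact: mulM_gt0.
  apply: le_trans h _; rewrite lerD2r ler_wpM2r //.
  by have := he (Some k); rewrite /= vk ki => /(_ isT); rewrite /e'; lra.
pose S := expR C + \sum_k expR (D k).
have S0 : 0 < S by rewrite ltr_wpDr ?expR_gt0 // sumr_ge0 // => k _; exact: expR_ge0.
have main n : L n -> ln (nrm (v i0 *m M n)) <= (chi i0 - 2 * e') * n%:R + ln S.
  move=> Ln; rewrite -[leRHS]expRK ler_ln ?posrE ?expR_gt0 ?mulM_gt0 //.
  have -> : v i0 = u - \sum_(k | k != i0) v k by rewrite uE (bigD1 i0) //= addrK.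
  rewrite mulmxBl; apply: le_trans (ler_nrmD _ _) _; rewrite nrmN.
  rewrite expRD lnK ?posrE // /S mulrDr; apply: lerD.
    apply: le_trans (hu n Ln) _; rewrite -expRD ler_expR lerD2r ler_wpM2r //.
    by have := he None isT; rewrite /= /e'; lra.
  rewrite mulmx_suml.
  apply: (@le_trans _ _ (\sum_(k | k != i0) nrm (v k *m M n))).
    elim/big_ind2 : _ => [|x1 x2 y1 y2 h1 h2|//]; first by rewrite nrm0.
    by apply: le_trans (ler_nrmD _ _) _; apply: lerD.
  apply: (@le_trans _ _ (\sum_(k | k != i0) expR ((chi i0 - 2 * e') * n%:R) * expR (D k))).
    by apply: ler_sum => k ki; rewrite -expRD hD.
  rewrite -mulr_sumr ler_wpM2l ?expR_ge0 //.
  by rewrite [in leRHS](bigD1 i0) //= lerDr expR_ge0.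
have [n nN Ln] := Linf (Num.truncn ((ln S + C0) / e')).+1.
have [h1 _] := h0 n; have := le_trans h1 (main n Ln).
have : (ln S + C0) / e' < n%:R.
  apply: lt_le_trans (truncnS_gt _) _; by rewrite ler_nat.
by rewrite ltr_pdivrMr //; nra.
Qed.

Lemma full_slow_space (L : nat -> Prop) c C :
  (forall N, exists2 n, (N <= n)%N & L n) ->
  (forall n, L n -> qm 1 (M n) <= expR (c * n%:R + C)) ->
  (m <= \rank (slow_space c))%N.
Proof.
move=> Linf h; rewrite -[X in (_ <= X)%N]add0n; apply: rank_of_meets => U rU.
have /rowV0Pn[u uU u0] : U != 0 by rewrite -mxrank_eq0 -lt0n.
exists u; split => //.
pose D := nrm u * (m * m)%:R + 1.
have D0 : 0 < D by rewrite ltr_wpDl // mulr_ge0 ?nrm_ge0.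
apply: (@slow_space_of_growth L c (C + ln D)) => // n Ln.
rewrite addrA expRD lnK ?posrE // mulrC.
apply: le_trans (nrmM _ _) _; rewrite /D mulrDl mul1r.
apply: (@le_trans _ _ (nrm u * (m * m)%:R * expR (c * n%:R + C))); last by rewrite lerDl expR_ge0.
rewrite -mulrA ler_wpM2l ?nrm_ge0 //; apply: le_trans (nrm_le_qm1 _) _.
by rewrite ler_wpM2l // h.
Qed.

End Exponents.

(** * Growth rates and exponentially shadowing orbits *)

Lemma eventually_gt_nat (R : realType) (x : R) :
  exists N : nat, forall n, (N <= n)%N -> x < n%:R.
Proof.
exists (Num.truncn x).+1 => n h; apply: lt_le_trans (truncnS_gt _) _.
by rewrite ler_nat.
Qed.

Section GrowthRate.
Variables (R : realType) (X : Type) (f : X -> X) (l : X -> nat -> R) (K l0 : R).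
Hypothesis K0 : 0 <= K.
Hypothesis l_sub : forall x n k, l x (n + k) <= l x n + l (iter n f x) k.
Hypothesis l_ge : forall x n, l0 - K * n%:R <= l x n.
Hypothesis l_le : forall x n, l x n <= K * n%:R + l0.

Definition growth_rate b :=
  (forall e, 0 < e -> exists C, forall x n, l x n <= (b + e) * n%:R + C) /\
  (forall n, (0 < n)%N -> exists x, b * n%:R - 1 <= l x n).

Lemma exists_growth_rate : X -> exists b, growth_rate b.
Proof.
move=> x0.
pose S := [set b : R | exists C, forall x n, l x n <= b * n%:R + C].
have SK : S K by exists l0.
have lbS : lbound S (- K).
  move=> b [C hC]; rewrite leNgt; apply/negP => bK.
  have [N hN] := eventually_gt_nat ((C - l0) / (- K - b)).
  have := hN N (leqnn _); rewrite ltr_pdivrMr ?subr_gt0 //.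
  by have := hC x0 N; have := l_ge x0 N; lra.
have infS : has_inf S by split; [exists K | exists (- K)].
exists (inf S); split=> [e e0|n n0].
  have [b [C hC] bS] := inf_adherent e0 infS.
  exists C => x n; apply: le_trans (hC x n) _; rewrite lerD2r ler_wpM2r //.
  exact: ltW.
apply: contrapT => h.
have {}h x : l x n <= inf S * n%:R - 1.
  by apply: contrapT => hx; apply: h; exists x; apply/ltW; rewrite ltNge; apply/negP.
pose b := inf S - n%:R^-1.
have n0R : 0 < n%:R :> R by rewrite ltr0n.
have bn : b * n%:R = inf S * n%:R - 1 by rewrite mulrBl mulVf // gt_eqF.
suff Sb : S b.
  have := inf_lbound infS.2 Sb; rewrite /b lerBrDr gerDl invr_le0.
  by rewrite leNgt n0R.
have step c x r : l x (c * n + r)%N <= b * (c * n)%:R + K * r%:R + l0.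
  elim: c x => [|c IH] x; first by rewrite mul0n mulr0 add0r; exact: l_le.
  rewrite mulSn -addnA; apply: le_trans (l_sub _ _ _) _.
  have := IH (iter n f x); have := h x; rewrite natrD mulrDr bn; lra.
exists ((K + `|b|) * n%:R + l0) => x N.
rewrite {1}(divn_eq N n); apply: le_trans (step _ _ _) _.
have rn : (N %% n)%:R <= n%:R :> R by rewrite ler_nat ltnW // ltn_mod.
have E : N%:R = (N %/ n * n)%:R + (N %% n)%:R :> R by rewrite -natrD -divn_eq.
have r0 : 0 <= (N %% n)%:R :> R by [].
rewrite E; move: ((N %/ n * n)%:R : R) ((N %% n)%:R : R) rn r0 => A r rn r0.
have h1 : K * r <= K * n%:R by rewrite ler_wpM2l.
have h2 : - (b * r) <= `|b| * n%:R.
  apply: le_trans (ler_norm _) _; rewrite normrN normrM (ger0_norm r0).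
  by rewrite ler_wpM2l.
lra.
Qed.

End GrowthRate.

Section Cocycles.
Variables (R : realType) (X : Type) (d : X -> X -> R).
Hypothesis hd : is_metric d.
Hypothesis hcomp : d_compact d.
Variables (f : X -> X) (m : nat) (A : X -> 'M[R]_m).
Hypothesis hA : holder_GL d A.

Let d_ge0 x y : 0 <= d x y. Proof. by case: hd. Qed.
Let d_sym x y : d x y = d y x. Proof. by case: hd. Qed.
Let d_tri x y z : d x z <= d x y + d y z. Proof. by case: hd. Qed.
Let d_xx x : d x x = 0. Proof. by case: hd => _ h _ _; apply/h. Qed.
Let Aunit x : A x \in unitmx. Proof. by case: hA. Qed.

Local Notation coc := (cocycle f A).

Lemma cocycleD x n k : coc x (n + k) = coc (iter n f x) k *m coc x n.
Proof.
elim: k => [|k IH]; first by rewrite addn0 /= mul1mx.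
by rewrite addnS /= IH mulmxA -iterD addnC.
Qed.

Lemma cocycle_unit x n : coc x n \in unitmx.
Proof. by elim: n => [|n IH] /=; rewrite ?unitmx1 // unitmx_mul Aunit. Qed.

Lemma holder_nrm : exists C alpha : R, [/\ 0 <= C, 0 < alpha &
  forall x y, nrm (A x - A y) <= C * d x y `^ alpha].
Proof.
have [_ [C [al [al0 h]]]] := hA.
exists ((m * m)%:R * `|C|), al; split => // x y.
apply: le_trans (nrm_le_mxnorm _) _; rewrite -mulrA ler_wpM2l //.
apply: le_trans (h x y) _; rewrite ler_wpM2r ?powR_ge0 //; exact: ler_norm.
Qed.

Lemma nrm_invmx_near (M N : 'M[R]_m) : M \in unitmx -> N \in unitmx ->
  nrm (M - N) * nrm (invmx M) <= 1 / 2 -> nrm (invmx N) <= 2 * nrm (invmx M).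
Proof.
move=> Mu Nu h.
have E : invmx N = invmx M + invmx M *m (M - N) *m invmx N.
  by rewrite mulmxBr mulVmx // mulmxBl mul1mx -mulmxA mulmxV // mulmx1 addrC subrK.
have h1 : nrm (invmx N) <= nrm (invmx M) + nrm (M - N) * nrm (invmx M) * nrm (invmx N).
  rewrite {1}E; apply: le_trans (ler_nrmD _ _) _; rewrite lerD2l.
  apply: le_trans (nrmM _ _) _; rewrite ler_wpM2r ?nrm_ge0 //.
  by rewrite mulrC; exact: nrmM.
have := ler_wpM2r (nrm_ge0 (invmx N)) h; lra.
Qed.

Lemma cocycle_bounded : exists K, forall x, nrm (A x) <= K /\ nrm (invmx (A x)) <= K.
Proof.
have [C [al [C0 al0 hold]]] := holder_nrm.
pose U (i : nat) := [set x : X | exists2 r, 0 < r & forall y, d x y < r ->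
   nrm (A y) <= i%:R /\ nrm (invmx (A y)) <= i%:R].
have Uo i : d_open d (U i).
  move=> x [r r0 h]; exists (r / 2); first by rewrite divr_gt0.
  move=> y xy; exists (r / 2); first by rewrite divr_gt0.
  by move=> z yz; apply: h; have := d_tri x y z; lra.
have Uc x : exists i, U i x.
  pose I := nrm (invmx (A x)); have I0 : 0 <= I by exact: nrm_ge0.
  pose e := (2 * (I + 1))^-1.
  have e0 : 0 < e by rewrite invr_gt0 mulr_gt0 // ltr_wpDl.
  pose c := e / (C + 1); have c0 : 0 < c by rewrite divr_gt0 // ltr_wpDl.
  have [N hN] := eventually_gt_nat (nrm (A x) + e + 2 * I).
  exists N; exists (c `^ al^-1); first exact: powR_gt0.
  move=> y xy.
  have dxy : d x y `^ al <= c.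
    have := ge0_ler_powR (ltW al0) _ _ (ltW xy); rewrite -powRrM mulVf ?gt_eqF //.
    by rewrite powRr1 ?(ltW c0) //; apply; rewrite nnegrE ?powR_ge0.
  have nAe : nrm (A x - A y) <= e.
    apply: le_trans (hold x y) _; apply: le_trans (ler_wpM2l C0 dxy) _.
    rewrite /c mulrA ler_pdivrMr ?ltr_wpDl // mulrC ler_wpM2l ?(ltW e0) //.
    by rewrite lerDl.
  have hNN := hN N (leqnn _).
  have y1 : nrm (A y) <= nrm (A x) + e.
    have -> : A y = A x - (A x - A y) by rewrite opprB addrCA subrr addr0.
    by apply: le_trans (ler_nrmD _ _) _; rewrite nrmN lerD2l.
  have y2 : nrm (invmx (A y)) <= 2 * I.
    apply: nrm_invmx_near => //.
    apply: le_trans (ler_wpM2r I0 nAe) _; rewrite /e invfM -mulrA.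
    by rewrite div1r ler_piMr ?invr_ge0 // mulrC ler_pdivrMr ?mul1r ?lerDl ?ltr_wpDl.
  by split; have := nrm_ge0 (A x); lra.
have [n [g hg]] := hcomp Uo Uc.
exists (\sum_j (g j)%:R) => x; have [j [r r0 h]] := hg x.
have [h1 h2] := h x ltac:(by rewrite d_xx).
have gs : (g j)%:R <= \sum_j (g j)%:R :> R by rewrite (bigD1 j) //= lerDl sumr_ge0.
by split; apply: le_trans gs.
Qed.

Lemma holder_compound t : exists C alpha : R, [/\ 0 <= C, 0 < alpha &
  forall x y, nrm (compound t (A x) - compound t (A y)) <= C * d x y `^ alpha].
Proof.
have [C [al [C0 al0 hold]]] := holder_nrm.
have [K hK] := cocycle_bounded.
have [C' C'0 h] := @compound_lipschitz R t m m K.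
exists (C' * C), al; split => //; first exact: mulr_ge0.
move=> x y; have [Kx _] := hK x; have [Ky _] := hK y.
by apply: le_trans (h _ _ Kx Ky) _; rewrite -mulrA ler_wpM2l.
Qed.

Definition lq t x n : R := ln (qm t (coc x n)).
Definition lq0 t : R := ln (qm t (1%:M : 'M[R]_m)).

Section Level.
Variable t : nat.
Hypothesis tm : (t <= m)%N.

Lemma qmc_gt0 x n : 0 < qm t (coc x n).
Proof. by apply: qm_gt0 => //; exact: cocycle_unit. Qed.

Lemma lqD x n k : lq t x (n + k) <= lq t x n + lq t (iter n f x) k.
Proof.
rewrite /lq -lnM ?posrE ?qmc_gt0 // ler_ln ?posrE ?mulr_gt0 ?qmc_gt0 //.
by rewrite cocycleD mulrC qmM.
Qed.

Lemma lq_step : exists2 K, 0 <= K & [/\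
  forall x n k, lq t x n <= lq t x (n + k) + K * k%:R,
  forall x n k, lq t (iter n f x) k <= lq t x (n + k) + K * n%:R,
  forall x n, lq0 t - K * n%:R <= lq t x n &
  forall x n, lq t x n <= K * n%:R + lq0 t].
Proof.
have [Kn hKn] := cocycle_bounded.
have [C hC] := @qm_bounded R t m m Kn.
pose K := ln (Num.max 1 C).
have K1 : 0 < Num.max 1 C by rewrite lt_max ltr01.
have hq (M : 'M[R]_m) : nrm M <= Kn -> qm t M <= expR K.
  by move=> /hC h; rewrite /K lnK ?posrE // le_max h orbT.
have K0 : 0 <= K by rewrite ln_ge0 // le_max lexx.
have a1 (x : X) (M : 'M[R]_m) : M \in unitmx ->
    ln (qm t M) <= ln (qm t (A x *m M)) + K.
  move=> Mu; have qM : 0 < qm t M by exact: qm_gt0.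
  have qAM : 0 < qm t (A x *m M) by apply: qm_gt0; rewrite // unitmx_mul Aunit.
  rewrite -[K]expRK -lnM ?posrE ?expR_gt0 // ler_ln ?posrE ?mulr_gt0 ?expR_gt0 //.
  rewrite -{1}(mulKmx (Aunit x) M); apply: le_trans (qmM _ _ _) _.
  by rewrite mulrC ler_wpM2l ?qm_ge0 // hq //; case: (hKn x).
have a2 (x : X) (M : 'M[R]_m) : M \in unitmx -> ln (qm t M) <= ln (qm t (M *m A x)) + K.
  move=> Mu; have qM : 0 < qm t M by exact: qm_gt0.
  have qAM : 0 < qm t (M *m A x) by apply: qm_gt0; rewrite // unitmx_mul Aunit Mu.
  rewrite -[K]expRK -lnM ?posrE ?expR_gt0 // ler_ln ?posrE ?mulr_gt0 ?expR_gt0 //.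
  rewrite -{1}(mulmxK (Aunit x) M); apply: le_trans (qmM _ _ _) _.
  by rewrite ler_wpM2l ?qm_ge0 // hq //; case: (hKn x).
have b1 x n k : lq t x n <= lq t x (n + k) + K * k%:R.
  elim: k => [|k IH]; first by rewrite addn0 mulr0 addr0.
  have := a1 (iter (n + k) f x) _ (cocycle_unit x (n + k)).
  by rewrite addnS -natr1 /lq /= in IH *; lra.
exists K => //; split => //.
- move=> x n; elim: n x => [|n IH] x k; first by rewrite add0n mulr0 addr0.
  rewrite iterSr; apply: le_trans (IH _ _) _.
  have := a2 x _ (cocycle_unit (f x) (n + k)).
  have -> : coc (f x) (n + k) *m A x = coc x (n.+1 + k).
    by rewrite -[RHS]/(coc x (1 + (n + k))) (cocycleD x 1) /= mulmx1.
  by rewrite /lq -natr1; lra.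
- by move=> x n; have := b1 x 0%N n; rewrite add0n {1}/lq /= -/(lq0 t); lra.
- move=> x; elim=> [|n IH]; first by rewrite mulr0 add0r /lq /=.
  have q1 : qm t (A (iter n f x)) <= expR K by apply: hq; case: (hKn (iter n f x)).
  have : lq t x n.+1 <= K + lq t x n.
    rewrite /lq -{1}[K]expRK -lnM ?posrE ?expR_gt0 ?qmc_gt0 //.
    rewrite ler_ln ?posrE ?mulr_gt0 ?expR_gt0 ?qmc_gt0 //=.
    by apply: le_trans (qmM _ _ _) _; rewrite ler_wpM2r ?qm_ge0.
  by move: IH; rewrite -natr1; lra.
Qed.

Lemma exists_lq_growth_rate : X -> exists b, growth_rate (lq t) b.
Proof.
have [K K0 [_ _ h1 h2]] := lq_step.
exact: (exists_growth_rate K0 lqD h1 h2).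
Qed.

Definition shadows (delta lambda : R) x y n := forall i, (i <= n)%N ->
  d (iter i f x) (iter i f y) <= delta * expR (- lambda * (minn i (n - i))%:R).

Lemma shadows_sym delta lambda x y n :
  shadows delta lambda x y n -> shadows delta lambda y x n.
Proof. by move=> h i /h; rewrite d_sym. Qed.

Lemma compound_diff_le C b eta x y n : 0 <= eta ->
  (forall z k, qm t (coc z k) <= expR (b * k%:R + C)) ->
  (forall i, (i < n)%N ->
     nrm (compound t (A (iter i f y)) - compound t (A (iter i f x))) <= eta) ->
  nrm (compound t (coc y n) - compound t (coc x n)) <=
  n%:R * (eta * expR (b * (n%:R - 1) + 2 * C)).
Proof.
move=> eta0 hq hd'.
pose W i := compound t (coc (iter i f y) (n - i)) *m compound t (coc x i).
have W0 : compound t (coc y n) = W 0%N.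
  by rewrite /W subn0 /= -compoundM mulmx1.
have Wn : compound t (coc x n) = W n.
  by rewrite /W subnn /= -compoundM mul1mx.
rewrite W0 Wn -opprB -telescope_sumr // nrmN.
apply: (@le_trans _ _ (\sum_(0 <= i < n) nrm (W i.+1 - W i))).
  elim/big_ind2 : _ => [|x1 x2 y1 y2 h1 h2|//]; first by rewrite nrm0.
  by apply: le_trans (ler_nrmD _ _) _; apply: lerD.
apply: (@le_trans _ _ (\sum_(0 <= i < n) eta * expR (b * (n%:R - 1) + 2 * C))); last first.
  by rewrite sumr_const_nat subn0 -[leLHS]mulr_natl.
rewrite big_nat_cond [leRHS]big_nat_cond; apply: ler_sum => i; rewrite andbT /= => iltn.
have -> : W i.+1 - W i = compound t (coc (iter i.+1 f y) (n - i.+1)) *m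
   (compound t (A (iter i f x)) - compound t (A (iter i f y))) *m compound t (coc x i).
  rewrite mulmxBr mulmxBl /W; congr (_ - _).
    by rewrite /= compoundM mulmxA.
  have -> : (n - i)%N = (1 + (n - i.+1))%N by lia.
  by rewrite cocycleD /= mulmx1 compoundM.
apply: le_trans (nrmM _ _) _.
have h1 := hq (iter i.+1 f y) (n - i.+1)%N; have h2 := hq x i.
have h3 := hd' i iltn; rewrite -nrmN opprB in h3.
apply: (@le_trans _ _ ((expR (b * (n - i.+1)%:R + C) * eta) * expR (b * i%:R + C))).
  apply: ler_pM; rewrite ?nrm_ge0 //.
  by apply: le_trans (nrmM _ _) _; apply: ler_pM; rewrite ?nrm_ge0.
rewrite mulrAC -expRD mulrC ler_wpM2l // ler_expR natrB // -natr1.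
lra.
Qed.

(* Only the middle part of the segment is compared, after cutting off a
   proportion [1 / D] at both ends: there the orbits are exponentially close in
   [n], which beats the subexponential loss in the telescoping sum because [b]
   is the maximal growth rate. *)
Lemma shadow_growth lambda b : 0 < lambda -> growth_rate (lq t) b ->
  forall e, 0 < e -> exists g C : R, [/\ 0 < g, 0 < C & forall delta x y n,
    delta <= 1 -> shadows delta lambda x y n ->
    qm t (coc y n) <= C * (expR (e * n%:R) * qm t (coc x n) + expR ((b - g) * n%:R))].
Proof.
move=> lam0 [hb _] e e0.
have [Ch [al [Ch0 al0 hold]]] := holder_compound t.
have [K K0 [Ka Kb _ _]] := lq_step.
pose th := lambda * al; have th0 : 0 < th by rewrite mulr_gt0.
have [D' hD'] := eventually_gt_nat ((2 * `|b| + 2 + 2 * K) / e).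
pose D := (D' + 2)%N.
have D0 : 0 < D%:R :> R by rewrite ltr0n /D addn2.
have hD : 2 * `|b| + 2 + 2 * K <= e * D%:R.
  have := hD' D (leq_addr _ _); rewrite ltr_pdivrMr // => /ltW.
  by rewrite [e * _]mulrC.
have D2 : (2 <= D)%N by rewrite /D addn2.
clearbody D.
pose g := th / (4 * D%:R); have g0 : 0 < g by rewrite divr_gt0 // mulr_gt0.
pose e' := Num.min 1 g.
have e'0 : 0 < e' by rewrite lt_min ltr01.
have e'1 : e' <= 1 by rewrite ge_min lexx.
have e'g : e' <= g by rewrite ge_min lexx orbT.
have [Ce hCe] := hb e' e'0.
have hq z k : qm t (coc z k) <= expR ((b + e') * k%:R + Ce).
  by apply: le_expR_of_ln; [exact: qmc_gt0 | exact: hCe].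
pose C1 := expR (2 * Ce).
pose C2 := Ch * expR (- (b + e') + 4 * Ce + th) / e'.
have C20 : 0 <= C2 by rewrite !mulr_ge0 ?expR_ge0 ?invr_ge0 // ltW.
exists g, (C1 + C2); split => //; first by rewrite ltr_wpDr // expR_gt0.
move=> delta x y n d1 sh.
pose L := (n %/ D)%N.
have LD : (L * D <= n)%N by exact: leq_trunc_div.
have nL : (n < L.+1 * D)%N by apply: ltn_ceil; apply: leq_trans D2.
have L2 : (2 * L <= n)%N by apply: leq_trans LD; rewrite mulnC leq_mul2l D2 orbT.
clearbody L.
pose n' := (n - 2 * L)%N.
have nE : n = (L + (n' + L))%N.
  by rewrite addnA addnAC addnn -mul2n subnKC.
have LR : L%:R * D%:R <= n%:R :> R by rewrite -natrM ler_nat.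
have nR : n%:R <= (L%:R + 1) * D%:R :> R by rewrite natr1 -natrM ler_nat ltnW.
pose xL := iter L f x; pose yL := iter L f y.
pose eta := Ch * expR (- th * L%:R).
have eta0 : 0 <= eta by rewrite mulr_ge0 ?expR_ge0.
have near i : (i < n')%N ->
   nrm (compound t (A (iter i f yL)) - compound t (A (iter i f xL))) <= eta.
  move=> ilt; apply: le_trans (hold _ _) _; rewrite ler_wpM2l //.
  have -> : - th * L%:R = (- lambda * L%:R) * al by rewrite /th; ring.
  rewrite expRM; apply: ge0_ler_powR; rewrite ?(ltW al0) ?nnegrE ?expR_ge0 //.
  rewrite -!iterD d_sym; apply: le_trans (sh _ _) _; first by move: ilt L2; rewrite /n'; clear; lia.
  apply: le_trans (ler_wpM2r (expR_ge0 _) d1) _; rewrite mul1r ler_expR.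
  rewrite !mulNr lerN2 ler_wpM2l ?(ltW lam0) // ler_nat leq_min.
  by move: ilt L2; rewrite /n'; clear; lia.
have diff := compound_diff_le eta0 hq near.
have qyL : qm t (coc yL n') <= qm t (coc xL n') +
    n'%:R * (eta * expR ((b + e') * (n'%:R - 1) + 2 * Ce)).
  rewrite /qm -lerBlDl; apply: le_trans diff.
  rewrite lerBlDl; apply: le_trans (ler_nrmD _ _).
  by rewrite addrCA subrr addr0.
have qxL : qm t (coc xL n') <= expR (2 * K * L%:R) * qm t (coc x n).
  have h1 := Kb x L n'; have h2 := Ka x (L + n')%N L.
  rewrite -addnA -nE in h2.
  have : lq t xL n' <= 2 * K * L%:R + lq t x n by rewrite /xL; lra.
  rewrite {2}/lq -{1}[2 * K * L%:R]expRK -lnM ?posrE ?expR_gt0 ?qmc_gt0 //.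
  by rewrite ler_ln ?posrE ?mulr_gt0 ?expR_gt0 ?qmc_gt0.
have qy : qm t (coc y n) <= expR ((b + e') * (2 * L%:R) + 2 * Ce) * qm t (coc yL n').
  rewrite nE cocycleD; apply: le_trans (qmM _ _ _) _.
  rewrite cocycleD.
  have h1 := hq y L; have h2 := hq (iter n' f (iter L f y)) L.
  apply: (@le_trans _ _ ((expR ((b + e') * L%:R + Ce) * qm t (coc yL n')) *
     expR ((b + e') * L%:R + Ce))).
    apply: ler_pM; rewrite ?qm_ge0 //.
    by apply: le_trans (qmM _ _ _) _; rewrite ler_wpM2r ?qm_ge0.
  rewrite mulrAC -expRD ler_wpM2r ?qm_ge0 // ler_expR; lra.
have n'n : n'%:R = n%:R - 2 * L%:R :> R by rewrite /n' natrB // natrM.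
apply: le_trans qy _.
apply: le_trans (ler_wpM2l (expR_ge0 _) qyL) _; rewrite mulrDr.
have t1 : expR ((b + e') * (2 * L%:R) + 2 * Ce) * qm t (coc xL n') <=
   C1 * (expR (e * n%:R) * qm t (coc x n)).
  apply: le_trans (ler_wpM2l (expR_ge0 _) qxL) _.
  rewrite !mulrA -!expRD ler_wpM2r ?qm_ge0 // ler_expR.
  have : (2 * b + 2 * e' + 2 * K) * L%:R <= e * n%:R.
    apply: le_trans (_ : e * D%:R * L%:R <= _); last first.
      by rewrite -mulrA ler_wpM2l ?(ltW e0) // mulrC.
    rewrite ler_wpM2r //; apply: le_trans hD; have := ler_norm b; lra.
  lra.
have t2 : expR ((b + e') * (2 * L%:R) + 2 * Ce) *
     (n'%:R * (eta * expR ((b + e') * (n'%:R - 1) + 2 * Ce))) <=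
   C2 * expR ((b - g) * n%:R).
  have nexp : n'%:R <= e'^-1 * expR (e' * n%:R) :> R.
    rewrite ler_pdivlMl //; apply: le_trans (_ : e' * n%:R <= _).
      by rewrite ler_wpM2l ?(ltW e'0) // n'n gerBl mulr_ge0.
    by apply: le_trans (expR_ge1Dx _); rewrite lerDr.
  apply: (@le_trans _ _ (expR ((b + e') * (2 * L%:R) + 2 * Ce) *
    (e'^-1 * expR (e' * n%:R) * (eta * expR ((b + e') * (n'%:R - 1) + 2 * Ce))))).
    by rewrite ler_wpM2l ?expR_ge0 // ler_wpM2r // mulr_ge0 ?expR_ge0.
  have -> : expR ((b + e') * (2 * L%:R) + 2 * Ce) *
    (e'^-1 * expR (e' * n%:R) * (eta * expR ((b + e') * (n'%:R - 1) + 2 * Ce))) =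
    (Ch / e') * (expR ((b + e') * (2 * L%:R) + 2 * Ce) * expR (e' * n%:R) *
      expR (- th * L%:R) * expR ((b + e') * (n'%:R - 1) + 2 * Ce)).
    by rewrite /eta; ring.
  have -> : C2 * expR ((b - g) * n%:R) =
    (Ch / e') * (expR (- (b + e') + 4 * Ce + th) * expR ((b - g) * n%:R)).
    by rewrite /C2; ring.
  rewrite ler_wpM2l ?divr_ge0 ?(ltW e'0) // -!expRD ler_expR n'n.
  have h1 : 4 * g * n%:R <= th * L%:R + th.
    have -> : 4 * g = th / D%:R by rewrite /g; field; rewrite gt_eqF.
    rewrite mulrAC ler_pdivrMr //.
    have -> : (th * L%:R + th) * D%:R = th * ((L%:R + 1) * D%:R) by ring.
    by rewrite ler_wpM2l ?(ltW th0).
  have h2 : e' * n%:R <= g * n%:R by rewrite ler_wpM2r.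
  have h3 : 0 <= g * n%:R by rewrite mulr_ge0 // ltW.
  lra.
have p1 : 0 <= C1 * expR ((b - g) * n%:R) by rewrite /C1 mulr_ge0 ?expR_ge0.
have p2 : 0 <= C2 * (expR (e * n%:R) * qm t (coc x n)).
  by apply: mulr_ge0 => //; rewrite mulr_ge0 ?expR_ge0 ?qm_ge0.
apply: le_trans (lerD t1 t2) _; move: p1 p2; clear; clearbody C1 C2.
move: (_ * qm _ _) (expR ((b - g) * _)) => P Q; nra.
Qed.

End Level.
End Cocycles.

(** * Consequences of exponential specification *)

Lemma alternating_blocks N n j :
  (j./2 * (n + 2 * N) + odd j * N + (if odd j then n else 0) + N <=
   j.+1./2 * (n + 2 * N) + odd j.+1 * N)%N.
Proof. by rewrite /= uphalf_half; case: (odd j) => /=; lia. Qed.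

Section Specification.
Variables (R : realType) (X : Type) (d : X -> X -> R).
Hypothesis hd : is_metric d.
Hypothesis hcomp : d_compact d.
Variable f : X -> X.
Hypothesis fcont : d_continuous d f.
Variable lam : R.
Hypothesis spec : forall delta : R, 0 < delta -> exists2 N : nat, (0 < N)%N &
  forall (k : nat) (xs : nat -> X) (Ns Ms : nat -> nat),
    (1 <= k)%N -> Ns 0%N = 0%N ->
    (forall j, (1 <= j < k)%N -> (Ns j.-1 + Ms j.-1 + N <= Ns j)%N) ->
    exists y : X, forall i, (i < k)%N ->
      expBall d f (xs i) delta lam (Ms i) (iter (Ns i) f y).

Let d_ge0 x y : 0 <= d x y. Proof. by case: hd. Qed.
Let d_sym x y : d x y = d y x. Proof. by case: hd. Qed.
Let d_tri x y z : d x z <= d x y + d y z. Proof. by case: hd. Qed.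
Let d_xx x : d x x = 0. Proof. by case: hd => _ h _ _; apply/h. Qed.
Let d_gt0 x y : x <> y -> 0 < d x y.
Proof.
move=> xy; rewrite lt_def d_ge0 andbT; apply/eqP => h; apply: xy.
by case: hd => _ hh _ _; apply/hh.
Qed.

Lemma iter_continuous n : d_continuous d (iter n f).
Proof.
elim: n => [|n IH] x e e0; first by exists e.
have [r r0 h] := fcont (iter n f x) e0.
have [r' r'0 h'] := IH x r r0.
by exists r' => // y xy /=; apply/h/h'.
Qed.

Lemma orbit_continuous n x e : 0 < e -> exists2 r : R, 0 < r &
  forall y, d x y < r -> forall s, (s <= n)%N -> d (iter s f x) (iter s f y) < e.
Proof.
move=> e0; elim: n => [|n [r r0 h]].
  by exists e => // y xy s; rewrite leqn0 => /eqP ->.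
have [r' r'0 h'] := iter_continuous n.+1 x e0.
exists (Num.min r r'); first by rewrite lt_min r0.
move=> y; rewrite lt_min => /andP[xr xr'] s; rewrite leq_eqVlt => /orP[/eqP ->|].
  exact: h'.
exact: h.
Qed.

Lemma infinite_specification delta : 0 < delta -> exists2 N : nat, (0 < N)%N &
  forall (xs : nat -> X) (Ns Ms : nat -> nat), Ns 0%N = 0%N ->
    (forall j, (Ns j + Ms j + N <= Ns j.+1)%N) ->
    exists y, forall i, shadows d f delta lam (xs i) (iter (Ns i) f y) (Ms i).
Proof.
move=> delta0; have [N N0 hN] := spec delta0.
exists N => // xs Ns Ms Ns0 hNs; apply: contrapT => none.
pose b (p : nat * nat) := delta * expR (- lam * (minn p.2 (Ms p.1 - p.2))%:R).
pose g (p : nat * nat) y := d (iter p.2 f (xs p.1)) (iter p.2 f (iter (Ns p.1) f y)).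
pose U p := [set y | (p.2 <= Ms p.1)%N /\ b p < g p y].
have Uo p : d_open d (U p).
  move=> y [pM hy].
  have [r r0 hr] := iter_continuous (p.2 + Ns p.1) y (e := g p y - b p) ltac:(by rewrite subr_gt0).
  exists r => // y' /hr h; split => //; move: h; rewrite !iterD.
  have := d_tri (iter p.2 f (xs p.1)) (iter p.2 f (iter (Ns p.1) f y'))
     (iter p.2 f (iter (Ns p.1) f y)).
  by rewrite -!/(g p _) [d (iter _ _ (iter _ _ y')) _]d_sym; lra.
have Uc y : exists p, U p y.
  apply: contrapT => h; apply: none; exists y => i j jM.
  by rewrite leNgt; apply/negP => hh; apply: h; exists (i, j).
have [n [G hG]] := hcomp Uo Uc.
pose k := (\sum_j (G j).1).+1.
have [y hy] := hN k xs Ns Ms isT Ns0 ltac:(by move=> [//|j] _; apply: hNs).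
have [j [jM hj]] := hG y.
have jk : ((G j).1 < k)%N by rewrite ltnS (bigD1 j) //= leq_addr.
by have := hy _ jk _ jM; rewrite -/(g (G j) y) -/(b (G j)) ltNge (ltW hj).
Qed.

Lemma singleton_of_identity : (forall x, f x = x) -> forall x y : X, x = y.
Proof.
move=> fid x y; apply: contrapT => /d_gt0 xy.
have [N N0 hN] := spec (divr_gt0 xy (ltr0n R 2)).
pose xs i := if i == 0%N then x else y.
have [u hu] := hN 2%N xs (fun i => (i * N)%N) (fun=> 0%N) isT (mul0n _) ltac:(
  by move=> [|[|j]] //= _; rewrite mul0n mul1n).
have iterid n : iter n f u = u by elim: n => //= n ->.
have h0 := hu 0%N isT 0%N isT; have h1 := hu 1%N isT 0%N isT.
move: h0 h1; rewrite /xs !iterid /= min0n mulr0 expR0 !mulr1.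
have := d_tri x u y; rewrite [d u y]d_sym; lra.
Qed.

Lemma displacement_lower_bound P rho : 0 < rho -> exists2 t0 : R, 0 < t0 &
  forall x s, (s <= P)%N -> rho <= d (iter s f x) (iter s.+1 f x) -> t0 <= d x (f x).
Proof.
move=> rho0.
pose Q (n : nat) y := n.+1%:R^-1 < d y (f y) \/
  forall s, (s <= P)%N -> d (iter s f y) (iter s.+1 f y) < rho.
pose U n := [set x | exists2 r : R, 0 < r & forall y, d x y < r -> Q n y].
have Uo n : d_open d (U n).
  move=> x [r r0 h]; exists (r / 2); first by rewrite divr_gt0.
  move=> y xy; exists (r / 2); first by rewrite divr_gt0.
  by move=> z yz; apply: h; have := d_tri x y z; lra.
have Uc x : exists n, U n x.
  have [fx|fx] := pselect (f x = x).
    exists 0%N.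
    have [r r0 hr] := orbit_continuous P.+1 x (divr_gt0 rho0 (ltr0n R 2)).
    exists r => // y xy; right => s sP.
    have iterid n : iter n f x = x by elim: n => //= n ->.
    have := hr y xy s (leqW sP); have := hr y xy s.+1 sP; rewrite !iterid.
    have := d_tri (iter s f y) x (iter s.+1 f y); rewrite [d _ x]d_sym; lra.
  have dx : 0 < d x (f x) by apply: d_gt0 => h; apply: fx.
  have [N hN] := eventually_gt_nat (2 / d x (f x)).
  have [r r0 hr] := orbit_continuous 1%N x (divr_gt0 dx (ltr0n R 4)).
  exists N, r => // y xy; left.
  have h0 := hr y xy 0%N isT; have h1 := hr y xy 1%N isT.
  have h2 : d x (f x) / 2 <= d y (f y).
    have := d_tri x y (f x); have := d_tri y (f y) (f x).
    by move: h0 h1 => /=; rewrite [d (f y) _]d_sym; lra.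
  apply: lt_le_trans h2; have := hN N.+1 (leqnSn _).
  by rewrite -[d x (f x) / 2]invrK ltf_pV2 ?posrE ?invr_gt0 ?divr_gt0 // invfM invrK mulrC.
have [n [G hG]] := hcomp Uo Uc.
exists ((\sum_j (G j)).+1%:R^-1); first by rewrite invr_gt0 ltr0n.
move=> x s sP hs; have [j [r r0 hr]] := hG x.
have [h|h] := hr x ltac:(by rewrite d_xx); last by have := h s sP; lra.
apply: ltW; apply: le_lt_trans h.
rewrite lef_pV2 ?posrE ?ltr0n // ler_nat ltnS (bigD1 j) //= leq_addr //.
Qed.

Lemma shadowsW delta lambda x y n n' : 0 <= delta -> 0 < lambda -> (n' <= n)%N ->
  shadows d f delta lambda x y n -> shadows d f delta lambda x y n'.
Proof.
move=> delta0 lam0 nn h i i_le; apply: le_trans (h i (leq_trans i_le nn)) _.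
rewrite ler_wpM2l // ler_expR !mulNr lerN2 ler_wpM2l ?(ltW lam0) // ler_nat.
by rewrite leq_min geq_minl (leq_trans (geq_minr _ _)) // leq_sub2r.
Qed.

Variables (m : nat) (A : X -> 'M[R]_m).
Hypothesis hA : holder_GL d A.
Hypothesis lam0 : 0 < lam.
Variable t : nat.
Hypothesis tm : (t <= m)%N.
Variable b : R.
Hypothesis hb : growth_rate (lq f A t) b.

Local Notation l := (lq f A t).

Lemma shadow_low k C : 0 < k -> exists2 k' : R, 0 < k' & exists C', forall delta x y n,
  delta <= 1 -> shadows d f delta lam x y n ->
  l x n <= (b - k) * n%:R + C -> l y n <= (b - k') * n%:R + C'.
Proof.
move=> k0; have [g [Cg [g0 Cg0 h]]] :=
  shadow_growth hd hcomp hA tm lam0 hb (divr_gt0 k0 (ltr0n R 2)).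
pose k' := Num.min (k / 2) g.
have k'0 : 0 < k' by rewrite lt_min divr_gt0.
have k'k : k' <= k / 2 by rewrite ge_min lexx.
have k'g : k' <= g by rewrite ge_min lexx orbT.
exists k' => //; exists (ln (Cg * (expR C + 1))) => delta x y n d1 sh lx.
rewrite -[leRHS]expRK ler_ln ?posrE ?expR_gt0 //; last exact: (qmc_gt0 f hA tm).
have qx : qm t (cocycle f A x n) <= expR ((b - k) * n%:R + C).
  by apply: le_expR_of_ln => //; exact: (qmc_gt0 f hA tm).
apply: le_trans (h _ _ _ _ d1 sh) _.
have D0 : 0 < Cg * (expR C + 1) by rewrite mulr_gt0 // ltr_wpDl // expR_ge0.
rewrite expRD lnK ?posrE //.
have -> : expR ((b - k') * n%:R) * (Cg * (expR C + 1)) =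
  Cg * (expR ((b - k') * n%:R) * expR C + expR ((b - k') * n%:R)) by ring.
rewrite ler_wpM2l ?(ltW Cg0) // lerD //.
  apply: le_trans (ler_wpM2l (expR_ge0 _) qx) _.
  rewrite -!expRD ler_expR; have : k' * n%:R <= (k / 2) * n%:R by rewrite ler_wpM2r.
  lra.
by rewrite ler_expR ler_wpM2r // lerD2l lerN2.
Qed.

Lemma shadow_high e : 0 < e -> exists C, forall delta x y n,
  delta <= 1 -> shadows d f delta lam x y n ->
  b * n%:R - 1 <= l x n -> (b - e) * n%:R - C <= l y n.
Proof.
move=> e0; have [g [Cg [g0 Cg0 h]]] := shadow_growth hd hcomp hA tm lam0 hb e0.
have [K K0 [_ _ lge _]] := lq_step hd hcomp f hA tm.
have [n1 hn1] := eventually_gt_nat ((ln (2 * Cg) + 1) / g).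
pose C1 := ln (2 * Cg) + 1.
have [C2 hC2] : exists C2, forall n, (n < n1)%N ->
    (b - e) * n%:R - C2 <= lq0 R m t - K * n%:R.
  exists (\sum_(i < n1) `|(b - e) * i%:R - (lq0 R m t - K * i%:R)|) => n nn.
  rewrite (bigD1 (Ordinal nn)) //=.
  set S := \sum_(_ | _) _; have : 0 <= S by apply: sumr_ge0.
  have := ler_norm ((b - e) * n%:R - (lq0 R m t - K * n%:R)); lra.
exists (`|C1| + `|C2|) => delta x y n d1 sh lx.
have [nn|nn] := ltnP n n1.
  apply: le_trans (lge y n); have := hC2 n nn.
  have := ler_norm C2; have := normr_ge0 C1; lra.
have qx0 : 0 < qm t (cocycle f A x n) by exact: (qmc_gt0 f hA tm).
have qy0 : 0 < qm t (cocycle f A y n) by exact: (qmc_gt0 f hA tm).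
have hq := h _ _ _ _ d1 (shadows_sym hd sh).
have small : Cg * expR ((b - g) * n%:R) <= 1 / 2 * qm t (cocycle f A x n).
  have qx : expR (b * n%:R - 1) <= qm t (cocycle f A x n) by apply: expR_le_of_ln.
  have h2 : 2 * Cg * expR ((b - g) * n%:R) <= expR (b * n%:R - 1).
    rewrite -[X in X * _](@lnK _ (2 * Cg)) ?posrE ?mulr_gt0 //.
    rewrite -expRD ler_expR.
    have := hn1 n nn; rewrite ltr_pdivrMr //; lra.
  have := le_trans h2 qx; lra.
have main : qm t (cocycle f A x n) <= 2 * Cg * (expR (e * n%:R) * qm t (cocycle f A y n)).
  by rewrite -mulrA; move: hq small; rewrite mulrDr; lra.
have h2 : l x n <= ln (2 * Cg) + (e * n%:R + l y n).
  rewrite /lq -[e * n%:R]expRK -!lnM ?posrE ?mulr_gt0 ?expR_gt0 //.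
  by rewrite ler_ln ?posrE ?mulr_gt0 ?expR_gt0.
have := ler_norm C1; have := normr_ge0 C2; rewrite /C1; lra.
Qed.

Hypothesis nonuniform : exists2 k, 0 < k & forall C, exists x n, l x n < (b - k) * n%:R - C.

(* The orbit periodically shadows a slow segment and, in between, a non-fixed
   point [w]; the latter keeps it away from the fixed points of [f]. *)
Lemma exists_low_point : exists z (k C t0 : R), [/\ 0 < k, 0 < t0,
  forall i n, l (iter i f z) n <= (b - k) * n%:R + C &
  forall i, t0 <= d (iter i f z) (iter i.+1 f z)].
Proof.
have [k k0 hk] := nonuniform.
have [K K0 [Ka Kb lge lle]] := lq_step hd hcomp f hA tm.
set L0 := lq0 R m t in lge lle.
have low_long n0 : exists x n, (n0 < n)%N /\ l x n < (b - k) * n%:R.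
  pose C := (K + `|b| + k + 1) * n0%:R + `|L0|.
  have [x [n h]] := hk C; exists x, n.
  have C0 : 0 <= C by rewrite addr_ge0 // mulr_ge0 // !addr_ge0 // ltW.
  split; last by lra.
  rewrite -(ltr_nat R) ltNge; apply/negP => nn.
  have := lge x n; have := ler_norm (- L0); rewrite normrN.
  have b1 : (b - k) * n%:R <= `|b| * n0%:R.
    apply: le_trans (_ : `|b| * n%:R <= _); last by rewrite ler_wpM2l.
    rewrite ler_wpM2r //; have := ler_norm b; lra.
  have b2 : K * n%:R <= K * n0%:R by rewrite ler_wpM2l.
  have b3 : 0 <= (k + 1) * n0%:R by rewrite mulr_ge0 // addr_ge0 // ltW.
  rewrite /C in h; lra.
have [w fw] : exists w, f w <> w.
  apply: contrapT => none.
  have fid x : f x = x by apply: contrapT => h; apply: none; exists x.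
  have [x [n h]] := hk (1 + `|L0|).
  have n_gt0 : (0 < n)%N.
    rewrite lt0n; apply/eqP => n0'; move: h; rewrite n0' mulr0 add0r.
    have := lge x 0%N; rewrite mulr0 subr0; have := ler_norm (- L0); rewrite normrN; lra.
  have [_ /(_ n n_gt0)[x' hx']] := hb.
  move: hx'; rewrite (singleton_of_identity fid x' x).
  have : 0 <= k * n%:R by rewrite mulr_ge0 // ltW.
  have := normr_ge0 L0; lra.
pose rho := d w (f w); have rho0 : 0 < rho by apply: d_gt0 => h; apply: fw.
have [r r0 hr] := fcont w (e := rho / 8) ltac:(by rewrite divr_gt0).
pose delta := Num.min 1 (Num.min (r / 2) (rho / 8)).
have delta0 : 0 < delta by rewrite !lt_min ltr01 !divr_gt0.
have delta1 : delta <= 1 by rewrite ge_min lexx.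
have deltar : delta <= r / 2 by rewrite !ge_min lexx orbT.
have deltarho : delta <= rho / 8 by rewrite !ge_min lexx !orbT.
have moved v : d w v <= delta -> rho / 2 <= d v (f v).
  move=> wv; have fv : d (f w) (f v) < rho / 8 by apply: hr; lra.
  have := d_tri w v (f w); have := d_tri v (f v) (f w).
  rewrite [d (f v) _]d_sym -/rho; lra.
have [N N0 hN] := infinite_specification delta0.
have [k1 k10 [C1 hC1]] := shadow_low 0 k0.
pose k2 := k1 / 2; have k20 : 0 < k2 by rewrite divr_gt0.
have [n0 hn0] := eventually_gt_nat
  ((2 * (K * N%:R + L0) + C1 - (b - k2) * (2 * N%:R)) / k2).
have [x [n [nn hx]]] := low_long n0.
pose P := (n + 2 * N)%N.
have P0 : (0 < P)%N by rewrite /P addn_gt0 muln_gt0 N0 orbT.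
pose xs i := if odd i then x else w.
pose Ns i := (i./2 * P + odd i * N)%N.
pose Ms i := if odd i then n else 0%N.
have [z hz] := hN xs Ns Ms erefl (alternating_blocks N n).
have mark j : rho / 2 <= d (iter (j * P) f z) (iter (j * P).+1 f z).
  apply: moved; have := hz j.*2 0%N (leq0n _).
  rewrite /xs /Ns /Ms odd_double doubleK mul0n addn0 /= min0n mulr0 expR0 mulr1.
  by [].
have lowP j : l (iter (j * P) f z) P <= (b - k2) * P%:R.
  have sh := hz j.*2.+1; rewrite /xs /Ns /Ms /= odd_double /= uphalf_double mul1n in sh.
  have h1 : l (iter (j * P + N) f z) n <= (b - k1) * n%:R + C1.
    by apply: hC1 delta1 sh _; rewrite addr0 ltW.
  have := lqD f hA tm (iter (j * P) f z) N (n + N).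
  have := lqD f hA tm (iter N f (iter (j * P) f z)) n N.
  have PE : (N + (n + N))%N = P by rewrite addnCA addnn -mul2n.
  rewrite PE -!iterD [(N + j * P)%N]addnC.
  have := lle (iter (j * P) f z) N; have := lle (iter (n + (j * P + N)) f z) N.
  have := hn0 n (ltnW nn); rewrite ltr_pdivrMr //.
  have -> : P%:R = n%:R + 2 * N%:R :> R by rewrite /P natrD natrM.
  have k1E : k1 = 2 * k2 by rewrite /k2; field.
  rewrite k1E in h1; lra.
have lowcP j c : l (iter (j * P) f z) (c * P) <= (b - k2) * (c * P)%:R + L0.
  elim: c j => [|c IH] j.
    by rewrite mul0n mulr0 add0r; have := lle (iter (j * P) f z) 0%N; rewrite mulr0 add0r.
  rewrite mulSn; apply: le_trans (lqD f hA tm _ _ _) _.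
  rewrite -iterD -mulSn; have := IH j.+1; have := lowP j.
  by rewrite [(P + _)%:R]natrD mulrDr; lra.
have lowj j n' : l (iter (j * P) f z) n' <=
    (b - k2) * n'%:R + (2 * L0 + (K + `|b - k2|) * P%:R).
  rewrite {1}(divn_eq n' P); apply: le_trans (lqD f hA tm _ _ _) _.
  have h1 := lowcP j (n' %/ P)%N.
  have h2 := lle (iter (n' %/ P * P) f (iter (j * P) f z)) (n' %% P)%N.
  have rP : (n' %% P)%:R <= P%:R :> R by rewrite ler_nat ltnW // ltn_mod.
  have E : n'%:R = (n' %/ P * P)%:R + (n' %% P)%:R :> R by rewrite -natrD -divn_eq.
  rewrite E; move: h1 h2 rP; move: ((n' %/ P * P)%:R : R) => u.
  have : 0 <= (n' %% P)%:R :> R by [].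
  move: ((n' %% P)%:R : R) (P%:R : R) => r1 p r10 h1 h2 rp.
  have h3 : K * r1 <= K * p by rewrite ler_wpM2l.
  have h4 : - ((b - k2) * r1) <= `|b - k2| * p.
    apply: le_trans (ler_norm _) _; rewrite normrN normrM (ger0_norm r10).
    by rewrite ler_wpM2l.
  lra.
have [t0 t00 ht0] := displacement_lower_bound P (divr_gt0 rho0 (ltr0n R 2)).
exists z, k2, (2 * L0 + (K + `|b - k2|) * P%:R + (`|b - k2| + K) * P%:R), t0; split => //.
- move=> i n'; rewrite {1}(divn_eq i P) addnC iterD.
  apply: le_trans (Kb _ _ _) _.
  have := lowj (i %/ P)%N (i %% P + n')%N; rewrite natrD.
  have rP : (i %% P)%:R <= P%:R :> R by rewrite ler_nat ltnW // ltn_mod.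
  have r10 : 0 <= (i %% P)%:R :> R by [].
  move: rP r10; move: ((i %% P)%:R : R) (P%:R : R) => r1 p rp r10.
  have h3 : K * r1 <= K * p by rewrite ler_wpM2l.
  have h4 : (b - k2) * r1 <= `|b - k2| * p.
    by apply: le_trans (ler_norm _) _; rewrite normrM (ger0_norm r10) ler_wpM2l.
  lra.
- move=> i; pose j := (i %/ P).+1.
  have ij : (i <= j * P)%N by apply/ltnW/ltn_ceil.
  apply: (ht0 _ (j * P - i)%N).
    by rewrite leq_subLR /j mulSn addnC leq_add2r leq_trunc_div.
  by rewrite -!iterD addSn subnK.
Qed.

End Specification.

(** * A criterion for irregularity *)

Section Irregularity.
Variables (R : realType) (X : Type) (d : X -> X -> R).
Hypothesis hd : is_metric d.
Hypothesis hcomp : d_compact d.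
Variables (f : X -> X) (m : nat) (A : X -> 'M[R]_m).
Hypothesis hA : holder_GL d A.

Definition uniform_level t b := growth_rate (lq f A t) b /\
  forall e, 0 < e -> exists C, forall x n, (b - e) * n%:R - C <= lq f A t x n.

Lemma growth_rate_concave q b0 b1 b2 : (q.+2 <= m)%N ->
  uniform_level q b0 -> growth_rate (lq f A q.+1) b1 ->
  growth_rate (lq f A q.+2) b2 -> b2 + b0 <= 2 * b1.
Proof.
move=> qm2 [_ h0] [h1 _] [_ h2]; rewrite leNgt; apply/negP => lt.
pose e := (b2 + b0 - 2 * b1) / 5; have e0 : 0 < e by rewrite divr_gt0 // subr_gt0.
have [C0 hC0] := h0 e e0; have [C1 hC1] := h1 e e0.
have [C Cpos hC] := @qm_concave R q m m.
have [N hN] := eventually_gt_nat ((1 + C0 + ln C + 2 * C1) / (2 * e)).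
have [x hx] := h2 N.+1 isT.
have k0 := hC0 x N.+1; have k1 := hC1 x N.+1.
have p0 : 0 < qm q (cocycle f A x N.+1) by apply: (qmc_gt0 f hA); lia.
have p1 : 0 < qm q.+1 (cocycle f A x N.+1) by apply: (qmc_gt0 f hA); lia.
have p2 : 0 < qm q.+2 (cocycle f A x N.+1) by apply: (qmc_gt0 f hA).
have : lq f A q.+2 x N.+1 + lq f A q x N.+1 <= ln C + (lq f A q.+1 x N.+1 + lq f A q.+1 x N.+1).
  rewrite /lq -!lnM ?posrE ?mulr_gt0 // ler_ln ?posrE ?mulr_gt0 //.
  by have := hC _ p0; rewrite expr2.
have e2 : 0 < 2 * e by lra.
have := hN N.+1 (leqnSn _); rewrite ltr_pdivrMr //.
have b2E : b2 = 5 * e + 2 * b1 - b0 by rewrite /e; field.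
rewrite b2E in hx; lra.
Qed.

Variable y : X.
Let M n := (cocycle f A y n)^T.
Let B n k := (cocycle f A (iter n f y) k)^T.

Lemma trcocycle_unit n : M n \in unitmx.
Proof. by rewrite unitmx_tr; exact: (cocycle_unit f hA). Qed.

Lemma trcocycleD n k : M (n + k)%N = M n *m B n k.
Proof. by rewrite /M cocycleD trmx_mul. Qed.

Lemma trcocycle_step : exists K, forall n (v : 'rV_m),
  nrm (v *m M n) <= K * nrm (v *m M n.+1).
Proof.
have [K hK] := cocycle_bounded hd hcomp hA; exists K => n v.
have Au : A (iter n f y) \in unitmx by case: hA.
have -> : v *m M n = v *m M n.+1 *m (invmx (A (iter n f y)))^T.
  by rewrite /M /= trmx_mul -!mulmxA -trmx_mul mulVmx // trmx1 mulmx1.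
apply: le_trans (nrmM _ _) _; rewrite mulrC ler_wpM2r ?nrm_ge0 // nrm_tr.
by case: (hK (iter n f y)).
Qed.

Variables (r : nat) (chi : 'I_r -> R) (G : 'I_r -> 'M[R]_m).
Hypothesis chi_lt : forall i j : 'I_r, (i < j)%N -> chi i < chi j.
Hypothesis Gsplit : splitting G.
Hypothesis Gexp : forall i (v : 'rV[R]_m), v != 0 -> (v <= G i)%MS ->
  fwd_exponent f A y v (chi i).

Lemma rank_slow_space_of_low q b0 b1 a s C4 (L : nat -> Prop) e : (q.+2 <= m)%N ->
  uniform_level q b0 -> uniform_level q.+1 b1 -> 0 < s -> 0 < e ->
  (forall N, exists2 n, (N <= n)%N & L n) ->
  (forall n, L n -> forall j, (n <= j)%N ->
    lq f A q.+2 y j <= (2 * b1 - b0) * j%:R - a * n%:R - s * (j - n)%:R + C4) ->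
  (m <= q.+1 + \rank (slow_space chi G (b1 - b0 - a + e)%R))%N.
Proof.
move=> qm2 [[u0 _] _] [[u1 _] l1] s0 e0 Linf low.
have [K hK] := trcocycle_step.
have gB e' : 0 < e' -> exists C, forall n k, ln (qm q (B n k)) <= (b0 + e') * k%:R + C.
  by move=> /u0[C hC]; exists C => n k; rewrite qm_tr; exact: hC.
have gM e' : 0 < e' -> exists C, forall n, `|ln (qm q.+1 (M n)) - b1 * n%:R| <= e' * n%:R + C.
  move=> e'0; have [C hC] := u1 e' e'0; have [C' hC'] := l1 e' e'0.
  exists (`|C| + `|C'|) => n; rewrite qm_tr ler_norml.
  have := hC y n; have := hC' y n; rewrite /lq.
  have := ler_norm C; have := ler_norm C'; have := normr_ge0 C; have := normr_ge0 C'.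
  by move=> *; apply/andP; split; lra.
have lM n : L n -> forall j, (n <= j)%N ->
    ln (qm q.+2 (M j)) <= (2 * b1 - b0) * j%:R - a * n%:R - s * (j - n)%:R + C4.
  by move=> Ln j nj; rewrite qm_tr; exact: low.
apply: rank_of_meets => U rU.
have M0 : M 0%N = 1%:M by rewrite /M /= trmx1.
have [u [u_neq0 uU [C hu]]] :=
  slow_vector trcocycle_unit M0 trcocycleD hK qm2 gB gM s0 lM e0 rU.
by exists u; split => //; apply: (slow_space_of_growth trcocycle_unit chi_lt Gsplit Gexp Linf hu).
Qed.

Lemma lq_le_of_slow_space q c e : (q.+1 <= m)%N -> 0 < e ->
  (m <= q + \rank (slow_space chi G c))%N ->
  exists C, forall n, lq f A q.+1 y n <= (c + e) * n%:R + lq f A q y n + C.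
Proof.
move=> qm1 e0 rk.
have [C hC] := qm_of_slow_subspace trcocycle_unit qm1 rk
   (fun v hv => slow_space_growth trcocycle_unit Gexp e0 hv).
by exists C => n; have := hC n; rewrite /M !qm_tr.
Qed.

Lemma irregular_growth t b k s C4 C5 (L H : nat -> Prop) (bs : nat -> R) :
  (0 < t <= m)%N -> growth_rate (lq f A t) b ->
  (forall i, (i < t)%N -> uniform_level i (bs i)) ->
  0 < k -> 0 < s ->
  (forall N, exists2 n, (N <= n)%N & L n) ->
  (forall N, exists2 n, (N <= n)%N & H n) ->
  (forall n, L n -> forall j, (n <= j)%N ->
    lq f A t y j <= b * j%:R - 3 / 4 * k * n%:R - s * (j - n)%:R + C4) ->
  (forall n, H n -> (b - k / 4) * n%:R - C5 <= lq f A t y n) -> False.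
Proof.
move=> /andP[t0 tm] hb hbs k0 s0 Linf Hinf low high.
have k8 : 0 < k / 8 by rewrite divr_gt0.
suff [C hC] : exists C, forall n, lq f A t y n <= (b - 3 / 8 * k) * n%:R + C.
  have [N hN] := eventually_gt_nat ((C + C5) / (k / 8)).
  have [n nN Hn] := Hinf N; have := le_trans (high n Hn) (hC n).
  by have := hN n nN; rewrite ltr_pdivrMr //; lra.
case: t t0 tm hb hbs low high => // -[|q] _ tm hb hbs low high.
  have rk : (m <= 0 + \rank (slow_space chi G (b - 3 / 4 * k)%R))%N.
    rewrite add0n.
    apply: (@full_slow_space _ _ _ trcocycle_unit _ _ _ chi_lt Gsplit Gexp L _ C4) => // n Ln.
    rewrite qm_tr; apply: le_expR_of_ln; first exact: (qmc_gt0 f hA).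
    by have := low n Ln n (leqnn n); rewrite subnn mulr0 /lq; lra.
  have [C hC] := lq_le_of_slow_space tm k8 rk.
  exists C => n; have := hC n; rewrite {2}/lq qm0 ln1.
  have : 0 <= k * n%:R by rewrite mulr_ge0 // ltW.
  lra.
have u0 := hbs q (leqW (ltnSn q)); have u1 := hbs q.+1 (ltnSn _).
have conc := growth_rate_concave tm u0 u1.1 hb.
pose a := 2 * bs q.+1 - bs q - b + 3 / 4 * k.
have rk : (m <= q.+1 + \rank (slow_space chi G (bs q.+1 - bs q - a + k / 8)%R))%N.
  apply: (rank_slow_space_of_low (s := s) (C4 := C4) tm u0 u1 s0 k8 Linf) => n Ln j nj.
  apply: le_trans (low n Ln j nj) _.
  have : (2 * bs q.+1 - bs q - b) * n%:R <= (2 * bs q.+1 - bs q - b) * j%:R.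
    by rewrite ler_wpM2l ?ler_nat //; lra.
  by rewrite /a; lra.
have [C hC] := lq_le_of_slow_space tm k8 rk.
have [[u _] _] := u1; have [C' hC'] := u _ k8.
exists (C + C') => n; have := hC n; have := hC' y n; rewrite /a; lra.
Qed.

End Irregularity.

Section BlockGrowth.
Variables (R : realType) (N Cn : nat).
Hypothesis N0 : (0 < N)%N.

(* Even blocks are slow and superlong; odd blocks have maximal growth and are
   only comparable to their starting time, so that the gap survives them. *)
Definition len j T := if odd j then (Cn * T)%N else (j.+1 * (T + N + 1))%N.
Fixpoint start j := if j is j'.+1 then (start j' + len j' (start j') + N)%N else 0%N.
Definition dur j := len j (start j).
Definition stop j := (start j + dur j)%N.

Lemma startS j : start j.+1 = (stop j + N)%N. Proof. by []. Qed.

Lemma leq_start j : (j <= start j)%N.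
Proof. by elim: j => // j IH; rewrite startS /stop; lia. Qed.

Lemma dur_even k : dur k.*2 = (k.*2.+1 * (start k.*2 + N + 1))%N.
Proof. by rewrite /dur /len odd_double. Qed.

Lemma dur_odd k : dur k.*2.+1 = (Cn * start k.*2.+1)%N.
Proof. by rewrite /dur /len /= odd_double. Qed.

Lemma leq_stopS j : (stop j <= stop j.+1)%N.
Proof. by rewrite {2}/stop startS -addnA leq_addr. Qed.

Lemma leq_stop_double a b : (a <= b)%N -> (stop a.*2 <= stop b.*2)%N.
Proof.
apply: (homo_leq (f := fun j => stop j.*2) (r := leq)) => // [x y z|j].
  exact: leq_trans.
by rewrite doubleS; apply: leq_trans (leq_stopS _) (leq_stopS _).
Qed.

Lemma leq_stop j : (j <= stop j)%N.
Proof. exact: leq_trans (leq_start j) (leq_addr _ _). Qed.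

Variables (L : nat -> nat -> R) (b k C1 : R).
Local Notation l := (L 0%N).
Hypothesis k0 : 0 < k.
Hypothesis L_sub : forall n i, l (n + i)%N <= l n + L n i.
Hypothesis L_up : forall e, 0 < e -> exists C, forall n i, L n i <= (b + e) * i%:R + C.
Hypothesis L_low : forall j i, (i <= dur j.*2)%N -> L (start j.*2) i <= (b - k) * i%:R + C1.

Lemma stop_low : exists k1, forall j, (k1 <= j)%N ->
  l (stop j.*2) <= (b - 7 / 8 * k) * (stop j.*2)%:R.
Proof.
have k_gt0 := k0.
have [Cu hCu] := L_up ltr01.
pose Z : R := `|Cu + C1|; have Z0 : 0 <= Z := normr_ge0 _.
have hZ : Cu + C1 <= Z := ler_norm _.
pose E : R := k + 1 + Z.
clearbody Z.
have E0 : 0 <= E by rewrite !addr_ge0 // ltW.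
have [k1 hk1] := eventually_gt_nat (8 * E / k).
exists k1 => j kj.
have h1 := L_sub (start j.*2) (dur j.*2); rewrite -/(stop _) in h1.
have h2 := L_low (leqnn (dur j.*2)); have h3 := hCu 0%N (start j.*2).
have sE : (stop j.*2)%:R = (start j.*2)%:R + (dur j.*2)%:R :> R by rewrite natrD.
have dE : (j%:R) * ((start j.*2)%:R + 1) <= (dur j.*2)%:R :> R.
  rewrite natr1 -natrM ler_nat dur_even.
  by apply: leq_mul; rewrite -?addnn; lia.
have := hk1 j kj; rewrite ltr_pdivrMr // => jk.
rewrite sE; move: dE h1 h2 h3.
set T := (start _)%:R; set D := (dur _)%:R; have T0 : 0 <= T :> R by [].
move=> dE h1 h2 h3.
have key : 8 * E * (T + 1) <= k * D.
  apply: le_trans (_ : k * (j%:R * (T + 1)) <= _); last by rewrite ler_wpM2l // ltW.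
  rewrite mulrA ler_wpM2r ?addr_ge0 //; lra.
rewrite /E in key.
have kT : 0 <= k * T by rewrite mulr_ge0 // ltW.
have ZT : 0 <= Z * T by rewrite mulr_ge0.
lra.
Qed.

Lemma low_blocks : exists k1 s C4, 0 < s /\ forall j, (k1 <= j)%N ->
  forall i, (stop j.*2 <= i)%N ->
  l i <= b * i%:R - 3 / 4 * k * (stop j.*2)%:R - s * (i - stop j.*2)%:R + C4.
Proof.
have k_gt0 := k0.
have [k1 hk1] := stop_low.
pose W : R := 2 * Cn%:R + 3.
have W3 : 3 <= W by rewrite /W lerDr mulr_ge0.
have W0 : 0 < W by apply: lt_le_trans W3.
pose e := k / (8 * W); have e0 : 0 < e by rewrite divr_gt0 // mulr_gt0.
have [Ce hCe] := L_up e0.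
pose c := 3 / 4 * k / W; have c0 : 0 < c by rewrite divr_gt0 // mulr_gt0.
have cW : c * W = 3 / 4 * k by rewrite /c -mulrA mulVf ?mulr1 // gt_eqF.
have eW : e * W = k / 8 by rewrite /e; field; rewrite gt_eqF.
have ck : c <= k.
  by rewrite /c ler_pdivrMr //; have := ler_wpM2l (ltW k0) W3; lra.
pose C6 := Ce + `|C1|.
have seg j i : (k1 <= j)%N -> (stop j.*2 <= i <= stop j.+1.*2)%N ->
    l i <= (b - c) * i%:R + C6.
  move=> kj /andP[ni iN].
  have upto i' : (stop j.*2 <= i' <= start j.+1.*2)%N -> l i' <= (b - c) * i'%:R + Ce.
    move=> /andP[ni' i's].
    have sW : i'%:R <= W * (stop j.*2)%:R.
      have -> : W * (stop j.*2)%:R = ((2 * Cn + 3) * stop j.*2)%:R by rewrite /W natrM natrD natrM.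
      rewrite ler_nat; apply: leq_trans i's _.
      rewrite doubleS startS {1}/stop dur_odd startS.
      have : (N <= stop j.*2)%N by rewrite /stop dur_even; nia.
      by move: (stop j.*2) => n hn; nia.
    have h1 := L_sub (stop j.*2) (i' - stop j.*2)%N; rewrite subnKC // in h1.
    have h2 := hCe (stop j.*2) (i' - stop j.*2)%N.
    have h3 := hk1 j kj.
    rewrite natrB // in h2; move: sW h1 h2 h3.
    set n := (stop _)%:R; have n0 : 0 <= n :> R by [].
    set x := i'%:R => sW h1 h2 h3.
    have h4 := ler_wpM2l (ltW c0) sW; rewrite mulrA cW in h4.
    have h5 := ler_wpM2l (ltW e0) sW; rewrite mulrA eW in h5.
    have h6 : 0 <= e * n by rewrite mulr_ge0 // ltW.
    lra.
  have [iS|Si] := leqP i (start j.+1.*2).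
    by apply: le_trans (upto i _) _; rewrite ?ni ?iS // lerD2l lerDl.
  have nS : (stop j.*2 <= start j.+1.*2)%N.
    by rewrite doubleS startS; apply: leq_trans (leq_stopS _) (leq_addr _ _).
  have h1 := upto (start j.+1.*2); rewrite nS leqnn in h1.
  have h2 := L_sub (start j.+1.*2) (i - start j.+1.*2)%N.
  rewrite subnKC ?(ltnW Si) // in h2.
  have h3 : L (start j.+1.*2) (i - start j.+1.*2)%N <= (b - k) * (i - start j.+1.*2)%:R + C1.
    by apply: L_low; rewrite leq_subLR.
  have h4 : (b - k) * (i - start j.+1.*2)%:R <= (b - c) * (i - start j.+1.*2)%:R.
    by rewrite ler_wpM2r // lerD2l lerN2.
  rewrite natrB ?(ltnW Si) // in h3 h4.
  have := h1 isT; have := ler_norm C1; rewrite /C6; lra.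
have all_i i : (stop k1.*2 <= i)%N -> l i <= (b - c) * i%:R + C6.
  move=> hi; have ex : exists j, (i <= stop j.*2)%N.
    by exists i; apply: leq_trans (leq_stop _); rewrite -addnn leq_addr.
  pose j := ex_minn ex.
  have [ij jmin] : (i <= stop j.*2)%N /\ forall j', (i <= stop j'.*2)%N -> (j <= j')%N.
    by rewrite /j; case: ex_minnP.
  have [jk|kj] := leqP j k1.
    have E : i = stop k1.*2.
      by apply/eqP; rewrite eqn_leq hi andbT; apply: leq_trans ij (leq_stop_double jk).
    rewrite E; apply: (seg k1) => //; rewrite leqnn /=; exact: leq_stop_double.
  case: j kj ij jmin => // j kj ij jmin.
  apply: (seg j) => //; rewrite ij andbT leqNgt; apply/negP => h.
  by have := jmin j (ltnW h); rewrite ltnn.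
(* Interpolate, with weights 7/8 and 1/8, between the estimate from the end of
   the [j]-th slow block and the uniform one. *)
have c14 : 0 < c / 14 by rewrite divr_gt0.
have [C3 hC3] := L_up c14.
exists k1, (c / 16), (7 / 8 * C3 + 1 / 8 * C6); split; first by rewrite divr_gt0.
move=> j kj i ni.
have h1 := L_sub (stop j.*2) (i - stop j.*2)%N; rewrite subnKC // in h1.
have h2 := hC3 (stop j.*2) (i - stop j.*2)%N.
have h3 := hk1 j kj.
have h4 := all_i i (leq_trans (leq_stop_double kj) ni).
rewrite natrB // in h2 *; move: h1 h2 h3 h4.
set n := (stop _)%:R; have n0 : 0 <= n :> R by [].
have ni' : n <= i%:R by rewrite ler_nat.
move: (i%:R : R) ni' (L _ _) (l _) (l _) => x ni' u v w h1 h2 h3 h4.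
have h5 : 0 <= k * n by rewrite mulr_ge0 // ltW.
have h6 : 0 <= c * n by rewrite mulr_ge0 // ltW.
have h7 : c * n <= c * x by rewrite ler_wpM2l // ltW.
lra.
Qed.

Variables (K C2 : R).
Hypothesis L_lo : forall n i, L n i <= l (n + i)%N + K * n%:R.
Hypothesis L_high : forall j,
  (b - k / 8) * (dur j.*2.+1)%:R - C2 <= L (start j.*2.+1) (dur j.*2.+1).
Hypothesis Cn_large : 8 * (K + `|b|) <= k * Cn%:R.

Lemma stop_high j : (b - k / 4) * (stop j.*2.+1)%:R - C2 <= l (stop j.*2.+1).
Proof.
have := L_lo (start j.*2.+1) (dur j.*2.+1); rewrite -/(stop _).
have := L_high j; rewrite dur_odd {2}/stop dur_odd natrD natrM.
set T := (start _)%:R; have T0 : 0 <= T :> R by [].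
have := ler_wpM2r T0 Cn_large; have := ler_wpM2r T0 (ler_norm b).
have : 0 <= k * T by rewrite mulr_ge0 // ltW.
by move: (L _ _) (l _) => u v; lra.
Qed.

End BlockGrowth.

(** * Uniform growth determines the spectrum *)

Section SpectrumSequences.
Variable R : realType.
Implicit Types s : seq (R * nat).

Definition mult_upto s (c : R) := (\sum_(p <- s | (p.1 <= c)%R) p.2)%N.

Definition spectral_seq s := sorted <%R (map fst s) /\ forall p, p \in s -> (0 < p.2)%N.

Lemma mult_upto0 s c : (forall p, p \in s -> c < p.1) -> mult_upto s c = 0%N.
Proof.
move=> h; rewrite /mult_upto big_seq_cond big1 // => p /andP[/h].
by rewrite ltNge => /negbTE ->.
Qed.

Lemma mult_upto_cons p s c :
  mult_upto (p :: s) c = ((if (p.1 <= c)%R then p.2 else 0) + mult_upto s c)%N.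
Proof. by rewrite /mult_upto big_cons; case: ifP. Qed.

Lemma spectral_seq_gap p s : spectral_seq (p :: s) ->
  exists2 e, 0 < e & forall x, x \in s -> p.1 + e < x.1.
Proof.
case: s => [|x0 s] [srt _]; first by exists 1.
move: srt => /= /andP[px0 srt]; exists ((x0.1 - p.1) / 2); first by rewrite divr_gt0 // subr_gt0.
move=> x; rewrite inE => /orP[/eqP ->|xs]; first by lra.
have := order_path_min (@lt_trans _ _) srt => /allP/(_ x.1).
by rewrite map_f // => /(_ isT); lra.
Qed.

Lemma spectral_seq_tail p s : spectral_seq (p :: s) -> spectral_seq s.
Proof.
move=> [srt pos]; split; first exact: path_sorted srt.
by move=> x xs; apply: pos; rewrite inE xs orbT.
Qed.

Lemma mult_upto_head s1 s2 p1 p2 : spectral_seq (p1 :: s1) -> spectral_seq (p2 :: s2) ->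
  (forall c e, 0 < e -> (mult_upto (p1 :: s1) c <= mult_upto (p2 :: s2) (c + e))%N) ->
  p2.1 <= p1.1.
Proof.
move=> g1 g2 h; rewrite leNgt; apply/negP => lt.
have := h p1.1 ((p2.1 - p1.1) / 2) ltac:(by rewrite divr_gt0 // subr_gt0).
rewrite [X in (_ <= X)%N]mult_upto0; last first.
  have [e e0 he] := spectral_seq_gap g2.
  by move=> p; rewrite inE => /orP[/eqP -> |/he]; lra.
rewrite mult_upto_cons lexx.
by have := g1.2 p1 (mem_head _ _); case: p1.2.
Qed.

Lemma mult_upto_inj s1 s2 : spectral_seq s1 -> spectral_seq s2 ->
  (forall c e, 0 < e -> (mult_upto s1 c <= mult_upto s2 (c + e))%N) ->
  (forall c e, 0 < e -> (mult_upto s2 c <= mult_upto s1 (c + e))%N) -> s1 = s2.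
Proof.
elim: s1 s2 => [|p1 s1 IH] [|p2 s2] // g1 g2 h12 h21.
- have := h21 p2.1 1 ltr01; rewrite mult_upto_cons lexx /mult_upto big_nil.
  by have := g2.2 p2 (mem_head _ _); case: p2.2.
- have := h12 p1.1 1 ltr01; rewrite mult_upto_cons lexx /mult_upto big_nil.
  by have := g1.2 p1 (mem_head _ _); case: p1.2.
have E1 : p1.1 = p2.1.
  by apply/eqP; rewrite eq_le (mult_upto_head g2 g1 h21) (mult_upto_head g1 g2 h12).
have mult_le (p q : R * nat) s s' : spectral_seq (p :: s) -> spectral_seq (q :: s') -> p.1 = q.1 ->
    (forall c e, 0 < e -> (mult_upto (p :: s) c <= mult_upto (q :: s') (c + e))%N) ->
    (p.2 <= q.2)%N.
  move=> gp gq E h; have [e e0 he] := spectral_seq_gap gq.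
  have := h p.1 e e0; rewrite !mult_upto_cons lexx.
  rewrite [mult_upto s' _]mult_upto0; last by rewrite E; exact: he.
  by case: ifP => _; lia.
have E2 : p1.2 = p2.2.
  by apply/eqP; rewrite eqn_leq (mult_le _ _ _ _ g1 g2 E1 h12) (mult_le _ _ _ _ g2 g1 (esym E1) h21).
have Ep : p1 = p2 by move: E1 E2; case: (p1) (p2) => a b [c e] /= -> ->.
subst p2; congr (_ :: _); apply: IH; [exact: spectral_seq_tail g1|exact: spectral_seq_tail g2| |].
- move=> c e e0; have [cp|cp] := leP p1.1 c.
    have := h12 c e e0; rewrite !mult_upto_cons cp.
    have -> : p1.1 <= c + e by lra.
    by rewrite leq_add2l.
  have [e1 e10 he] := spectral_seq_gap g1; rewrite mult_upto0 // => x /he; lra.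
- move=> c e e0; have [cp|cp] := leP p1.1 c.
    have := h21 c e e0; rewrite !mult_upto_cons cp.
    have -> : p1.1 <= c + e by lra.
    by rewrite leq_add2l.
  have [e1 e10 he] := spectral_seq_gap g2; rewrite mult_upto0 // => x /he; lra.
Qed.

End SpectrumSequences.

Section UniformLevels.
Variables (R : realType) (X : Type) (d : X -> X -> R).
Hypothesis hd : is_metric d.
Hypothesis hcomp : d_compact d.
Variables (f : X -> X) (m : nat) (A : X -> 'M[R]_m).
Hypothesis hA : holder_GL d A.
Variable bs : nat -> R.
Hypothesis unif : forall i, (i <= m)%N -> uniform_level f A i (bs i).

Lemma linear_slope_le (u v C : R) : (forall n : nat, u * n%:R <= v * n%:R + C) -> u <= v.
Proof.
move=> h; rewrite leNgt; apply/negP => vu; have uv : 0 < u - v by rewrite subr_gt0.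
have [N hN] := eventually_gt_nat (C / (u - v)).
by have := hN N (leqnn _); rewrite ltr_pdivrMr //; have := h N; lra.
Qed.

Definition exponent_splitting (y : X) r (chi : 'I_r -> R) (G : 'I_r -> 'M[R]_m) :=
  [/\ forall i j : 'I_r, (i < j)%N -> chi i < chi j, splitting G &
   forall i (v : 'rV[R]_m), v != 0 -> (v <= G i)%MS -> fwd_exponent f A y v (chi i)].

Lemma rank_slow_space_le y1 y2 r1 r2 (chi1 : 'I_r1 -> R) (chi2 : 'I_r2 -> R) G1 G2 c e :
  exponent_splitting y1 chi1 G1 -> exponent_splitting y2 chi2 G2 -> 0 < e ->
  (\rank (slow_space chi1 G1 c) <= \rank (slow_space chi2 G2 (c + e)%R))%N.
Proof.
move=> [lt1 sp1 ex1] [lt2 sp2 ex2] e0.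
set D := \rank (slow_space chi1 G1 c).
have Dm : (D <= m)%N := rank_leq_row _.
have [->//|D0] := posnP D.
pose q := (m - D)%N.
have qm : (q < m)%N by rewrite /q; lia.
have slope : bs q.+1 - bs q <= c.
  apply/ler_addgt0Pr => e' e'0; have e3 : 0 < e' / 3 by rewrite divr_gt0.
  have rk : (m <= q + \rank (slow_space chi1 G1 c))%N by rewrite -/D /q; lia.
  have [C hC] := lq_le_of_slow_space hA ex1 qm e3 rk.
  have [_ /(_ _ e3)[C1 hC1]] := unif qm.
  have [[/(_ _ e3)[C2 hC2] _] _] := unif (ltnW qm).
  rewrite lerBlDr; apply: (@linear_slope_le _ _ (C + C1 + C2)) => n.
  have := hC n; have := hC1 y1 n; have := hC2 y1 n; lra.
have ex : exists i, (i < m)%N && (bs i.+1 - bs i <= c) by exists q; rewrite qm.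
pose i := ex_minn ex.
have [im islope imin] : [/\ (i < m)%N, bs i.+1 - bs i <= c &
    forall j, (j < m)%N && (bs j.+1 - bs j <= c) -> (i <= j)%N].
  by rewrite /i; case: ex_minnP => k /andP[].
have iq : (i <= q)%N by apply: imin; rewrite qm.
suff : (m <= i + \rank (slow_space chi2 G2 (c + e)%R))%N.
  by move: iq; rewrite /q; lia.
have Linf N : exists2 n, (N <= n)%N & (fun=> True) n by exists N.
clearbody i; case: i im islope imin iq => [|i] im islope imin iq.
  rewrite add0n.
  have b00 : bs 0%N <= 0.
    have [[_ h] _] := unif (leq0n m).
    apply: (@linear_slope_le _ _ (1 + `|bs 0%N|)) => -[|n].
      by rewrite !mulr0 add0r addr_ge0.
    by have [x] := h n.+1 isT; rewrite /lq qm0 ln1; have := normr_ge0 (bs 0%N); lra.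
  have [[/(_ _ e0)[C hC] _] _] := unif im.
  apply: (@full_slow_space _ _ _ (trcocycle_unit f hA y2) _ _ _ lt2 sp2 ex2 (fun=> True) _ C) => // n _.
  rewrite qm_tr; apply: le_expR_of_ln; first exact: (qmc_gt0 f hA).
  apply: le_trans (hC y2 n) _; rewrite lerD2r ler_wpM2r //; lra.
have igap : c < bs i.+1 - bs i.
  rewrite ltNge; apply/negP => h; have := imin i; rewrite h (ltnW im) => /(_ isT).
  by rewrite ltnn.
pose g := (bs i.+1 - bs i) - (bs i.+2 - bs i.+1).
have g0 : 0 < g by rewrite /g; lra.
pose e1 := Num.min g e / 4.
have mn0 : 0 < Num.min g e by rewrite lt_min g0.
have mng : Num.min g e <= g by rewrite ge_min lexx.
have mne : Num.min g e <= e by rewrite ge_min lexx orbT.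
have e10 : 0 < e1 by rewrite /e1; lra.
have e1g : e1 < g by rewrite /e1; lra.
have e1e : e1 < e by rewrite /e1; lra.
have [[/(_ _ e10)[C hC] _] _] := unif im.
have eq0 : 0 < c + e - (bs i.+1 - bs i - (g - e1)) by rewrite /g; lra.
have := @rank_slow_space_of_low _ _ _ hd hcomp f _ _ hA y2 _ _ _ lt2 sp2 ex2 i (bs i) (bs i.+1)
   (g - e1) (g - e1) C (fun=> True) _ im (unif (ltnW (ltnW im))) (unif (ltnW im)) _ eq0 Linf.
rewrite [_ + (_ - _)]addrC subrK; apply; first by rewrite subr_gt0.
move=> n _ j nj; apply: le_trans (hC y2 j) _.
by rewrite natrB // /g; lra.
Qed.

Lemma slow_rank_mult_upto (s : seq (R * nat)) (G : 'I_(size s) -> 'M[R]_m) c :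
  splitting G -> (forall i : 'I_(size s), \rank (G i) = (nth (sdflt R) s i).2) ->
  \rank (slow_space (fun i : 'I_(size s) => (nth (sdflt R) s i).1) G c) = mult_upto s c.
Proof.
move=> sp rk; rewrite rank_slow_space // /mult_upto.
rewrite [RHS](big_nth (sdflt R)) big_mkord; apply: eq_bigr => i _; exact: rk.
Qed.

Lemma spectrum_unique y1 y2 (s1 s2 : seq (R * nat))
    (G1 : 'I_(size s1) -> 'M[R]_m) (G2 : 'I_(size s2) -> 'M[R]_m) :
  sorted <%R (map fst s1) -> sorted <%R (map fst s2) ->
  splitting G1 -> splitting G2 ->
  (forall i : 'I_(size s1), \rank (G1 i) = (nth (sdflt R) s1 i).2 /\
     (0 < (nth (sdflt R) s1 i).2)%N) ->
  (forall i : 'I_(size s2), \rank (G2 i) = (nth (sdflt R) s2 i).2 /\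
     (0 < (nth (sdflt R) s2 i).2)%N) ->
  (forall (i : 'I_(size s1)) (v : 'rV[R]_m), v != 0 -> (v <= G1 i)%MS ->
     fwd_exponent f A y1 v (nth (sdflt R) s1 i).1) ->
  (forall (i : 'I_(size s2)) (v : 'rV[R]_m), v != 0 -> (v <= G2 i)%MS ->
     fwd_exponent f A y2 v (nth (sdflt R) s2 i).1) -> s1 = s2.
Proof.
move=> srt1 srt2 sp1 sp2 rk1 rk2 ex1 ex2.
have incr (s : seq (R * nat)) : sorted <%R (map fst s) ->
    forall i j : 'I_(size s), (i < j)%N -> (nth (sdflt R) s i).1 < (nth (sdflt R) s j).1.
  move=> srt i j ij.
  have := sorted_ltn_nth (@lt_trans _ _) 0 srt; move/(_ i j).
  rewrite !inE !size_map !ltn_ord => /(_ isT isT ij).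
  by rewrite !(nth_map (sdflt R)) ?ltn_ord.
have pos (s : seq (R * nat)) : (forall i : 'I_(size s), (0 < (nth (sdflt R) s i).2)%N) ->
    forall p, p \in s -> (0 < p.2)%N.
  move=> h p /(nthP (sdflt R))[i im <-]; exact: (h (Ordinal im)).
have S1 : exponent_splitting y1 (fun i : 'I_(size s1) => (nth (sdflt R) s1 i).1) G1.
  by split => //; exact: incr.
have S2 : exponent_splitting y2 (fun i : 'I_(size s2) => (nth (sdflt R) s2 i).1) G2.
  by split => //; exact: incr.
have r1 i : \rank (G1 i) = (nth (sdflt R) s1 i).2 by case: (rk1 i).
have r2 i : \rank (G2 i) = (nth (sdflt R) s2 i).2 by case: (rk2 i).
apply: mult_upto_inj; rewrite ?/spectral_seq; try split => //.
- by apply: pos => i; case: (rk1 i).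
- by apply: pos => i; case: (rk2 i).
- move=> c e e0; rewrite -(slow_rank_mult_upto _ sp1 r1) -(slow_rank_mult_upto _ sp2 r2).
  exact: (rank_slow_space_le _ S1 S2 e0).
- move=> c e e0; rewrite -(slow_rank_mult_upto _ sp1 r1) -(slow_rank_mult_upto _ sp2 r2).
  exact: (rank_slow_space_le _ S2 S1 e0).
Qed.

End UniformLevels.

(** * A family of irregular points *)

Section Frequencies.
Variable R : realType.

Lemma limn_sup_eq1 (u : nat -> R) : (forall n, u n <= 1) ->
  (forall e N, 0 < e -> exists2 n, (N <= n)%N & 1 - e <= u n) -> limn_sup u = 1.
Proof.
move=> u1 h; rewrite /limn_sup (_ : sups u = cst 1) ?lim_cst //.
apply/funext => N /=; apply/eqP; rewrite eq_le; apply/andP; split.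
  by apply: ge_sup => [|_ [n _ <-]]; [exists (u N), N => /= | exact: u1].
apply/ler_addgt0Pr => e e0; have [n Nn hn] := h e N e0.
rewrite -lerBlDr; apply: le_trans hn _; apply: ub_le_sup; last by exists n.
by exists 1 => _ [k _ <-]; exact: u1.
Qed.

Lemma limn_inf_eq0 (u : nat -> R) : (forall n, 0 <= u n) ->
  (forall e N, 0 < e -> exists2 n, (N <= n)%N & u n <= e) -> limn_inf u = 0.
Proof.
move=> u0 h; rewrite /limn_inf (_ : infs u = cst 0) ?lim_cst //.
apply/funext => N /=; apply/eqP; rewrite eq_le; apply/andP; split; last first.
  by apply: lb_le_inf => [|_ [n _ <-]]; [exists (u N), N => /= | exact: u0].
apply/ler_addgt0Pr => e e0; have [n Nn hn] := h e N e0.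
rewrite add0r; apply: le_trans hn; apply: ge_inf; last by exists n.
by exists 0 => _ [k _ <-]; exact: u0.
Qed.

Lemma count_iota_ge (p : pred nat) a b n : (b <= n)%N ->
  (forall i, (a <= i < b)%N -> p i) -> (b - a <= count p (iota 0 n))%N.
Proof.
move=> bn h; have [ba|ab] := leqP b a; first by rewrite (eqP ba).
have -> : n = (a + ((b - a) + (n - b)))%N by lia.
rewrite !iotaD !count_cat add0n; apply: leq_trans (leq_addl _ _).
apply: leq_trans (leq_addr _ _); have : all p (iota a (b - a)).
  by apply/allP => i; rewrite mem_iota => hi; apply: h; lia.
by rewrite all_count size_iota => /eqP ->.
Qed.

Lemma count_iota_le (p : pred nat) a n : (a <= n)%N ->
  (forall i, (a <= i < n)%N -> ~~ p i) -> (count p (iota 0 n) <= a)%N.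
Proof.
move=> an h; have -> : n = (a + (n - a))%N by lia.
rewrite iotaD count_cat add0n; have -> : count p (iota a (n - a)) = 0%N.
  apply/eqP; rewrite -leqn0 leqNgt -has_count -all_predC.
  by apply/allP => i; rewrite mem_iota => hi; apply: h; lia.
by rewrite addn0; apply: leq_trans (count_size _ _) _; rewrite size_iota.
Qed.

Variables (X : Type) (d : X -> X -> R) (f : X -> X).

Lemma close_freq_ge0 x y t n : 0 <= close_freq d f x y t n.
Proof. by rewrite divr_ge0. Qed.

Lemma close_freq_le1 x y t n : close_freq d f x y t n <= 1.
Proof.
rewrite /close_freq; case: n => [|n]; first by rewrite invr0 mulr0.
rewrite ler_pdivrMr ?ltr0n // mul1r ler_nat.
by apply: leq_trans (count_size _ _) _; rewrite size_iota.
Qed.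

Lemma DC1_pair_irrefl x : is_metric d -> ~ DC1_pair d f x x.
Proof.
move=> [_ dxx _ _] [_ [t t0]].
have E n : close_freq d f x x t n.+1 = 1.
  rewrite /close_freq (eq_count (a2 := predT)) ?count_predT ?size_iota ?divff //.
  by move=> i /=; have -> : d (iter i f x) (iter i f x) = 0 by apply/dxx.
suff -> : limn_inf (close_freq d f x x t) = 1 by move/eqP; rewrite oner_eq0.
have : close_freq d f x x t @ \oo --> (1 : R).
  by apply: cvg_near_cst; exists 1%N => // -[|n] // _; exact: E.
by move/cvg_limn_inf_sup => [].
Qed.

End Frequencies.

Lemma leq_self_double n : (n <= n.*2)%N.
Proof. by rewrite -addnn leq_addr. Qed.

Lemma block_index T D h i : (T + h <= i < T + D - h)%N ->
  exists i', [/\ i = (i' + T)%N, (i' <= D)%N & (h <= minn i' (D - i'))%N].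
Proof. by move=> hi; exists (i - T)%N; rewrite leq_min; split; lia. Qed.

Lemma block_count T D h c : (T + D - h - (T + h) <= c)%N -> (D <= c + 2 * h)%N.
Proof. lia. Qed.

Section Family.
Variables (R : realType) (X : Type) (d : X -> X -> R).
Hypothesis hd : is_metric d.
Hypothesis hcomp : d_compact d.
Variable f : X -> X.
Hypothesis fcont : d_continuous d f.
Hypothesis hspec : exp_specification d f.
Variables (m : nat) (A : X -> 'M[R]_m).
Hypothesis hA : holder_GL d A.
Variables (t : nat) (b : R) (bs : nat -> R).
Hypothesis tm : (0 < t <= m)%N.
Hypothesis hb : growth_rate (lq f A t) b.
Hypothesis unif : forall i, (i < t)%N -> uniform_level f A i (bs i).
Hypothesis nonuniform : exists2 k, 0 < k &
  forall C, exists x n, lq f A t x n < (b - k) * n%:R - C.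

Lemma exists_irregular_family : exists Y : (nat -> bool) -> X,
  (forall c, LI f A (Y c)) /\
  (forall c c', (forall N, exists2 j, (N <= j)%N & c j = c' j) ->
     (forall N, exists2 j, (N <= j)%N & c j != c' j) -> DC1_pair d f (Y c) (Y c')).
Proof.
have [lam lam0 spec] := hspec.
have /andP[t0 tm'] := tm.
have [d0 dxx dsym dtri] := hd.
have [z [k0 [C0 [t1 [k00 t10 zlow zfar]]]]] :=
  exists_low_point hd hcomp fcont spec hA lam0 tm' hb nonuniform.
have [k k_gt0 [C1 hC1]] := shadow_low hd hcomp hA lam0 tm' hb C0 k00.
have [C2 hC2] := shadow_high hd hcomp hA lam0 tm' hb (divr_gt0 k_gt0 (ltr0n R 8)).
have [K K0 [_ Kb _ _]] := lq_step hd hcomp f hA tm'.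
have /choice[hp hhp] n : exists x, (0 < n)%N -> b * n%:R - 1 <= lq f A t x n.
  case: n => [|n]; first by exists z.
  by have [x hx] := hb.2 n.+1 isT; exists x.
pose delta := Num.min 1 (t1 / 4).
have delta0 : 0 < delta by rewrite lt_min ltr01 divr_gt0.
have delta1 : delta <= 1 by rewrite ge_min lexx.
have deltat : delta <= t1 / 4 by rewrite ge_min lexx orbT.
have [N N0 hN] := infinite_specification hd hcomp fcont spec delta0.
have [Cn hCn] := eventually_gt_nat (8 * (K + `|b|) / k).
have Cn_large : 8 * (K + `|b|) <= k * Cn.+1%:R.
  by have := hCn Cn.+1 (leqnSn _); rewrite ltr_pdivrMr // [_ * k]mulrC => /ltW.
pose T := start N Cn.+1; pose D := dur N Cn.+1.
pose low (c : nat -> bool) j := if c j then f z else z.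
pose xs c j := if odd j then hp (D j) else low c j./2.
have /choice[Y hY] c : exists y, forall i,
    shadows d f delta lam (xs c i) (iter (T i) f y) (D i).
  by apply: hN => // j; rewrite /T startS.
have sh_low c j : shadows d f delta lam (low c j) (iter (T j.*2) f (Y c)) (D j.*2).
  by have := hY c j.*2; rewrite /xs odd_double doubleK.
exists Y; split=> [c [r [chi [G [_ lt_chi spl _ Gexp]]]]|c c' agree differ].
  pose L n i := lq f A t (iter n f (Y c)) i.
  have L_sub n i : L 0%N (n + i)%N <= L 0%N n + L n i by exact: (lqD f hA tm').
  have L_lo n i : L n i <= L 0%N (n + i)%N + K * n%:R by exact: Kb.
  have L_up e : 0 < e -> exists C, forall n i, L n i <= (b + e) * i%:R + C.
    by move=> /hb.1[C hC]; exists C => n i; exact: hC.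
  have L_low j i : (i <= D j.*2)%N -> L (T j.*2) i <= (b - k) * i%:R + C1.
    move=> iD; have sh := shadowsW (ltW delta0) lam0 iD (sh_low c j).
    apply: (hC1 _ _ _ _ delta1 sh); rewrite /low; case: (c j).
      by have := zlow 1%N i.
    by have := zlow 0%N i.
  have L_high j : (b - k / 8) * (D j.*2.+1)%:R - C2 <= L (T j.*2.+1) (D j.*2.+1).
    apply: (hC2 _ _ _ _ delta1 (hY c j.*2.+1)); rewrite /xs /= odd_double /=.
    apply: hhp; rewrite /D dur_odd muln_gt0 andTb.
    by apply: leq_trans (leq_start Cn.+1 N0 _).
  have hi := stop_high k_gt0 L_lo L_high Cn_large.
  have [k1 [s [C4 [s0 hlow]]]] := low_blocks N0 k_gt0 L_sub L_up L_low.
  apply: (@irregular_growth _ _ _ hd hcomp f _ _ hA (Y c) _ _ _ lt_chi (spl 0%N) Gexp t b k s C4 C2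
    (fun n => exists2 j, (k1 <= j)%N & n = stop N Cn.+1 j.*2)
    (fun n => exists j, n = stop N Cn.+1 j.*2.+1) bs) => //.
  - move=> n; exists (stop N Cn.+1 (maxn n k1).*2); last by exists (maxn n k1); rewrite ?leq_maxr.
    by apply: leq_trans (leq_stop _ N0 _); apply: leq_trans (leq_maxl n k1) (leq_self_double _).
  - move=> n; exists (stop N Cn.+1 n.*2.+1); last by exists n.
    by apply: leq_trans (leq_stop _ N0 _); apply/leqW/leq_self_double.
  - by move=> n [j kj ->] i ni; exact: hlow.
  - by move=> n [j ->]; exact: hi.
have stopE j : (stop N Cn.+1 j.*2)%:R = (T j.*2)%:R + (D j.*2)%:R :> R by rewrite natrD.
have dE j : j%:R * ((T j.*2)%:R + 1) <= (D j.*2)%:R :> R.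
  rewrite natr1 -natrM ler_nat /D dur_even /T; apply: leq_mul.
    exact/leqW/leq_self_double.
  by rewrite addn1 ltnS leq_addr.
have stop_gt0 j : 0 < (stop N Cn.+1 j.*2)%:R :> R.
  by rewrite ltr0n /stop dur_even addn_gt0 muln_gt0 /= addn1 orbT.
have stop_ge n j : (n <= j)%N -> (n <= stop N Cn.+1 j.*2)%N.
  by move=> nj; apply: leq_trans (leq_stop _ N0 _); apply: leq_trans nj (leq_self_double _).
split=> [u u0|].
  apply: limn_sup_eq1 => [n|e n0 e0]; first exact: close_freq_le1.
  have [h hh] := eventually_gt_nat (2 / (lam * u)).
  have [n1 hn1] := eventually_gt_nat ((1 + 2 * h%:R) / e).
  have [j jn cj] := agree (maxn n0 n1).
  exists (stop N Cn.+1 j.*2); first by apply/stop_ge/(leq_trans _ jn)/leq_maxl.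
  have close i : (T j.*2 + h <= i < stop N Cn.+1 j.*2 - h)%N ->
      d (iter i f (Y c)) (iter i f (Y c')) < u.
    move=> /block_index[i' [iE i'D mh]].
    have h1 := sh_low c j i' i'D; have h2 := sh_low c' j i' i'D.
    rewrite -!iterD -iE in h1 h2.
    have lowE : low c' j = low c j by rewrite /low cj.
    rewrite lowE in h2.
    have small : delta * expR (- lam * (minn i' (D j.*2 - i'))%:R) < u / 2.
      apply: le_lt_trans (_ : expR (- lam * h%:R) < _).
        rewrite -[leRHS]mul1r ler_pM ?expR_ge0 ?(ltW delta0) // ler_expR.
        by rewrite !mulNr lerN2 ler_wpM2l ?(ltW lam0) // ler_nat.
      have lu : 0 < lam * u by rewrite mulr_gt0.
      have := hh h (leqnn _); rewrite ltr_pdivrMr // => hlu.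
      rewrite mulNr expRN -[u / 2]invrK ltf_pV2 ?posrE ?invr_gt0 ?divr_gt0 ?expR_gt0 //.
      apply: lt_le_trans (expR_ge1Dx _); rewrite invfM invrK mulrC ltr_pdivrMr //.
      rewrite mulrDl; have : h%:R * (lam * u) = lam * h%:R * u by ring.
      lra.
    have := dtri (iter i f (Y c)) (iter i' f (low c j)) (iter i f (Y c')).
    rewrite [d (iter i f (Y c)) (iter i' f _)]dsym; lra.
  rewrite /close_freq ler_pdivlMr //.
  have cnt := @count_iota_ge (fun i => d (iter i f (Y c)) (iter i f (Y c')) < u)
    (T j.*2 + h)%N (stop N Cn.+1 j.*2 - h)%N (stop N Cn.+1 j.*2) (leq_subr _ _) close.
  have cnt' : (D j.*2 <= count (fun i => (d (iter i f (Y c)) (iter i f (Y c')) < u)%R)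
      (iota 0 (stop N Cn.+1 j.*2)) + 2 * h)%N.
    exact: block_count cnt.
  rewrite -(ler_nat R) natrD natrM in cnt'.
  have jn1 := hn1 j (leq_trans (leq_maxr _ _) jn); rewrite ltr_pdivrMr // in jn1.
  have dj := dE j; rewrite stopE; move: cnt'.
  set c0 := (count _ _)%:R => cnt'.
  move: dj; set TT := (T _)%:R; set DD := (D _)%:R; have TT0 : 0 <= TT :> R by [].
  move=> dj.
  have h3 : (1 + 2 * h%:R) * (TT + 1) <= j%:R * e * (TT + 1).
    by rewrite ler_wpM2r ?addr_ge0 // ltW.
  have h4 : e * (j%:R * (TT + 1)) <= e * DD by rewrite ler_wpM2l // ltW.
  have h5 : 0 <= h%:R * TT by rewrite mulr_ge0.
  have h6 : 0 <= e * TT by rewrite mulr_ge0 // ltW.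
  lra.
exists (t1 / 4); first by rewrite divr_gt0.
apply: limn_inf_eq0 => [n|e n0 e0]; first exact: close_freq_ge0.
have [n1 hn1] := eventually_gt_nat (1 / e).
have [j jn cj] := differ (maxn n0 n1).
exists (stop N Cn.+1 j.*2); first by apply/stop_ge/(leq_trans _ jn)/leq_maxl.
have far i : (T j.*2 <= i < stop N Cn.+1 j.*2)%N ->
    ~~ (d (iter i f (Y c)) (iter i f (Y c')) < t1 / 4).
  rewrite -[T _]addn0 -[stop _ _ _]subn0 => /block_index[i' [iE i'D _]].
  have h1 := sh_low c j i' i'D; have h2 := sh_low c' j i' i'D.
  rewrite -!iterD -iE in h1 h2.
  have e1 : delta * expR (- lam * (minn i' (D j.*2 - i'))%:R) <= t1 / 4.
    apply: le_trans deltat; rewrite ler_piMr ?(ltW delta0) // expR_le1.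
    by rewrite mulNr oppr_le0 mulr_ge0 // ltW.
  have far : t1 <= d (iter i' f (low c j)) (iter i' f (low c' j)).
    move: cj; rewrite /low; case: (c j); case: (c' j) => // _.
      by rewrite dsym; have := zfar i'; rewrite -iterSr.
    by have := zfar i'; rewrite -iterSr.
  rewrite -leNgt.
  have := dtri (iter i' f (low c j)) (iter i f (Y c)) (iter i' f (low c' j)).
  have := dtri (iter i f (Y c)) (iter i f (Y c')) (iter i' f (low c' j)).
  rewrite [d (iter i f (Y c')) (iter i' f _)]dsym; lra.
rewrite /close_freq ler_pdivrMr //.
have cnt := @count_iota_le (fun i => d (iter i f (Y c)) (iter i f (Y c')) < t1 / 4)
  (T j.*2) (stop N Cn.+1 j.*2) (leq_addr _ _) far.
rewrite -(ler_nat R) in cnt; apply: le_trans cnt _.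
have jn1 := hn1 j (leq_trans (leq_maxr _ _) jn); rewrite ltr_pdivrMr // in jn1.
have dj := dE j; rewrite stopE.
move: dj; set TT := (T _)%:R; set DD := (D _)%:R; have TT0 : 0 <= TT :> R by [].
move=> dj.
have h3 : 1 * (TT + 1) <= j%:R * e * (TT + 1) by rewrite ler_wpM2r ?addr_ge0 // ltW.
have h4 : e * (j%:R * (TT + 1)) <= e * DD by rewrite ler_wpM2l // ltW.
have h6 : 0 <= e * TT by rewrite mulr_ge0 // ltW.
lra.
Qed.

End Family.

Section Scrambling.

(* The 2-adic valuation takes every value infinitely often, so two distinct
   codes differ at infinitely many odd places; they agree at all even ones. *)
Definition code (w : nat -> bool) (j : nat) : bool :=
  odd j && w (logn 2 j./2.+1).

Lemma code_agree w w' N : exists2 j, (N <= j)%N & code w j = code w' j.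
Proof. by exists N.*2; rewrite /code ?odd_double // -addnn leq_addr. Qed.

Lemma code_differ w w' : w <> w' ->
  forall N, exists2 j, (N <= j)%N & code w j != code w' j.
Proof.
move=> ww' N; have [v hv] : exists v, w v != w' v.
  apply: contrapT => h; apply: ww'; apply/funext => v.
  by apply/eqP; apply: contraT => hv; case: h; exists v.
pose a := (2 ^ v * N.*2.+1)%N.
have a0 : (0 < a)%N by rewrite muln_gt0 expn_gt0.
have Na : (N < a)%N.
  apply: leq_trans (_ : N.*2.+1 <= _)%N; first by rewrite ltnS -addnn leq_addr.
  by rewrite /a leq_pmull // expn_gt0.
exists a.-1.*2.+1; first by rewrite -addnn; lia.
rewrite /code /= odd_double /= uphalf_double prednK //.
by rewrite /a lognM ?expn_gt0 // pfactorK // logn_coprime ?addn0 // coprime2n /= odd_double.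
Qed.

Lemma no_injection_cantor (g : (nat -> bool) -> nat) : ~ injective g.
Proof.
move=> ginj; pose w n := ~~ `[< exists2 w', g w' = n & w' n >].
have [/asboolP[w' gw' hw']|h] := boolP `[< exists2 w', g w' = g w & w' (g w) >].
  have : w (g w) by rewrite -(ginj _ _ gw') gw'.
  by move=> /negP; apply; apply/asboolP; exists w'.
by move/negP: (h); apply; apply/asboolP; exists w.
Qed.

Lemma uncountable_scrambled (R : realType) (X : Type) (d : X -> X -> R) (f : X -> X)
    (Y : (nat -> bool) -> X) (E : set X) : is_metric d ->
  (forall c, E (Y c)) ->
  (forall c c', (forall N, exists2 j, (N <= j)%N & c j = c' j) ->
     (forall N, exists2 j, (N <= j)%N & c j != c' j) -> DC1_pair d f (Y c) (Y c')) ->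
  exists S : set X, S `<=` E /\ ~ countable S /\ DC1_scrambled d f S.
Proof.
move=> hd YE Ysc.
have sc w w' : w <> w' -> DC1_pair d f (Y (code w)) (Y (code w')).
  by move=> ww'; apply: Ysc; [exact: code_agree | exact: code_differ].
exists (range (fun w => Y (code w))); split; [|split].
- by move=> _ [w _ <-]; exact: YE.
- move=> /countable_injP[g ginj].
  apply: (@no_injection_cantor (fun w => g (Y (code w)))) => w w' E'.
  apply: contrapT => ww'; have := sc w w' ww'.
  have -> : Y (code w) = Y (code w').
    by apply: ginj E'; apply/mem_set; [exists w | exists w'].
  exact: DC1_pair_irrefl.
- move=> _ _ [w _ <-] [w' _ <-] ne; apply: sc => E'; apply: ne; by rewrite E'.
Qed.

End Scrambling.

Lemma probability_ae_exists (R : realType) (dsp : measure_display)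
    (X : measurableType dsp) (mu : probability X R) (P : X -> Prop) :
  {ae mu, forall x, P x} -> exists x, P x.
Proof.
move=> [B [mB muB0 sub]]; apply: contrapT => none.
have BT : B = setT.
  apply/seteqP; split=> // x _; apply: sub => /= Px; apply: none; by exists x.
have := @probability_setT _ _ _ mu; rewrite -BT muB0 => /eqP.
by rewrite eq_sym onee_eq0.
Qed.

Theorem mainTheorem1 (R : realType) (dsp : measure_display)
  (X : measurableType dsp) (d : X -> X -> R)
  (hd : is_metric d) (hcomp : d_compact d)
  (hborel : (@measurable dsp X) = <<s d_open d >>)
  (f finv : X -> X) (hf : homeomorphism d f finv)
  (hspec : exp_specification d f)
  (m : nat) (A : X -> 'M[R]_m) (hA : holder_GL d A) :
  (forall (mu nu : probability X R) (s1 s2 : seq (R * nat)),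
      ergodic f mu -> ergodic f nu ->
      lyapunov_spectrum f finv A mu s1 -> lyapunov_spectrum f finv A nu s2 ->
      s1 = s2)
  \/
  (exists S : set X,
      S `<=` LI f A /\ ~ countable S /\ DC1_scrambled d f S).
Proof.
have [unif|notunif] := pselect (forall i, (i <= m)%N -> exists b, uniform_level f A i b).
  left=> mu nu s1 s2 _ _ [srt1 [E1 ae1]] [srt2 [E2 ae2]].
  have [y1 [sp1 _ rk1 ex1]] := probability_ae_exists ae1.
  have [y2 [sp2 _ rk2 ex2]] := probability_ae_exists ae2.
  have /choice[bs hbs] i : exists b, (i <= m)%N -> uniform_level f A i b.
    have [im|im] := leqP i m; last by exists 0.
    by have [b hb] := unif i im; exists b.
  apply: (spectrum_unique (y1 := y1) (y2 := y2) hd hcomp hA hbs srt1 srt2 sp1 sp2 rk1 rk2).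
  - by move=> i v v0 vE; have [] := ex1 i v v0 vE.
  - by move=> i v v0 vE; have [] := ex2 i v v0 vE.
have [[x0 _]|noX] := pselect (exists x : X, True); last first.
  left=> mu nu s1 s2 _ _ [_ [E1 ae1]].
  by have [y _] := probability_ae_exists ae1; case: noX; exists y.
right.
pose Q i := (i <= m)%N && `[< ~ exists b, uniform_level f A i b >].
have exQ : exists i, Q i.
  apply: contrapT => h; apply: notunif => i im; apply: contrapT => hi.
  by apply: h; exists i; rewrite /Q im; apply/asboolP.
pose t := ex_minn exQ.
have [tm tnot tmin] : [/\ (t <= m)%N, ~ (exists b, uniform_level f A t b) &
    forall i, Q i -> (t <= i)%N].
  by rewrite /t; case: ex_minnP => i /andP[im /asboolP hi] h.
have below i : exists b, (i < t)%N -> uniform_level f A i b.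
  have [it|ti] := ltnP i t; last by exists 0.
  have [[b hb]|h] := pselect (exists b, uniform_level f A i b); first by exists b.
  suff /tmin : Q i by rewrite leqNgt it.
  by rewrite /Q (leq_trans (ltnW it) tm) /=; apply/asboolP.
have /choice[bs hbs] := below.
have t0 : (0 < t)%N.
  rewrite lt0n; apply/eqP => t0; apply: tnot; exists 0; rewrite t0.
  have lq_0 x n : lq f A 0 x n = 0 by rewrite /lq qm0 ln1.
  split; first split.
  - by move=> e e0; exists 0 => x n; rewrite lq_0 addr0 add0r mulr_ge0 // ltW.
  - by move=> n _; exists x0; rewrite lq_0 mul0r sub0r oppr_le0.
  - move=> e e0; exists 0 => x n; rewrite lq_0 subr0 sub0r mulNr oppr_le0.
    by rewrite mulr_ge0 // ltW.
have [b hb] := exists_lq_growth_rate hd hcomp f hA tm x0.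
have nonuniform : exists2 k, 0 < k &
    forall C, exists x n, lq f A t x n < (b - k) * n%:R - C.
  apply: contrapT => h; apply: tnot; exists b; split => // e e0.
  apply: contrapT => hC; apply: h; exists e => // C.
  apply: contrapT => hx; apply: hC; exists C => x n.
  by rewrite leNgt; apply/negP => hlt; apply: hx; exists x, n.
have tm' : (0 < t <= m)%N by rewrite t0.
have [_ _ fcont _] := hf.
have [Y [YLI Ysc]] :=
  exists_irregular_family hd hcomp fcont hspec hA tm' hb hbs nonuniform.
exact: uncountable_scrambled Ysc.
Qed.
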